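(* The function $T\ni t\mapsto\chi_t\in\mathcal H^*$ satisfies: (i) The support of $t\mapsto\chi_t$ is the support of $\nu$. (ii) $\chi_t\in\mathcal H^*$ is a positive, central functional with $\chi_t(1)=1$, for $\nu$-almost every $t\in T$. (iii) For $h\in\mathcal H$, $z\in\mathcal Z$: $\chi_t(zh)=z(t)\chi_t(h)$ for $\nu$-almost every $t\in T$. (iv) For $\nu$-almost all $t$, $\chi_t$ extends to a continuous tracial state of the $C^*$-algebra $\mathfrak C$. (v) For all $h\in\mathcal H$, $$\tau(h)=\int_T\chi_t(h)\,d\nu(t).$$
   Context: **Hecke algebra.** $\mathcal R=(X,Y,R_0,R_0^\vee,F_0)$ is a reduced root datum ($X,Y$ lattices in perfect duality, $R_0\subset X$ a reduced root system with coroots $R_0^\vee\subset Y$, basis $F_0$, positive roots $R_{0,+}$), $W_0$ its Weyl group, $W=W_0\ltimes X$. $W$ acts on affine functions $(y,k)\in Y\times\mathbb Z$, $(y,k)(x)=\langle x,y\rangle+k$, by $(wf)(x)=f(w^{-1}x)$. $R^{\rm aff}=R_0^\vee\times\mathbb Z$; $(\alpha^\vee,k)$ is positive if $k>0$, or $k=0$ and $\alpha\in R_{0,+}$. $F^{\rm aff}=\{(\alpha^\vee,0):\alpha\in F_0\}\cup\{(\alpha^\vee,1):\alpha^\vee$ a minimal coroot in the dominance order$\}$; for $a=(\alpha^\vee,k)$ put $s_a(x)=x-a(x)\alpha$; $S^{\rm aff}=\{s_a:a\in F^{\rm aff}\}$; $l(w)=|R^{\rm aff}_+\cap w^{-1}R^{\rm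 aff}_-|$. Fix $\mathbf q>1$ and reals $f_s$ ($s\in S^{\rm aff}$), equal for $W$-conjugate $s$, and put $q(s)=\mathbf q^{f_s}$; extend $q$ to $W$ by $q(ww')=q(w)q(w')$ if $l(ww')=l(w)+l(w')$ and $q(\omega)=1$ if $l(\omega)=0$. $\mathcal H$ is the complex algebra with basis $(T_w)_{w\in W}$, $T_wT_{w'}=T_{ww'}$ if lengths add, $(T_s+1)(T_s-q(s))=0$ for $s\in S^{\rm aff}$; $T_w^*=T_{w^{-1}}$ (conjugate-linear anti-involution); $\tau(T_w)=\delta_{w,e}$; $(h_1,h_2)=\tau(h_1^*h_2)$; $N_w=q(w)^{-1/2}T_w$ is an orthonormal basis; $\mathfrak H$ is the Hilbert completion; $\mathfrak C$ is the completion of $\mathcal H$ in the operator norm of left multiplication on $\mathfrak H$. $\mathcal H^*$ is the algebraic dual. $\mathcal H_+$ is the set of Hermitian $h$ with $(hx,x)\ge0$ for all $x\in\mathcal H$; $\chi\in\mathcal H^*$ is positive if $\chi(h)\ge0$ for all $h\in\mathcal H_+$, and central if it vanishes on commutators. **Center.** $X^+=\{x:\langle x,\alpha^\vee\rangle\ge0\ \forall\alpha\in R_{0,+}\}$; $x\mapsto\theta_x$ is the homomorphism $X\to\mathcal H^\times$ with $\theta_x=N_{t_x}$ for $x\in X^+$ ($t_x$ the translation by $x$); $\mathcal A=\operatorname{span}\{\theta_x\}\simeq\mathbb C[X]$ is the ring of regular functions on $T=\operatorname{Hom}(X,\mathbb C^\times)$, $\theta_x(t)=x(t)$; the center of $\mathcal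 H$ is $\mathcal Z=\mathcal A^{W_0}$. **Measure $\nu$ and local traces.** The spectrum of the closure $\overline{\mathcal Z}$ of $\mathcal Z$ in $\mathfrak C$ is identified, by restriction of characters to $\mathcal Z$, with a compact subset $S$ of $W_0\backslash T$. $\nu$ is the $W_0$-invariant Borel probability measure on $T$, supported on the preimage of $S$, corresponding to the state $\tau|_{\overline{\mathcal Z}}$: $\tau(z)=\int_Tz\,d\nu$. For each $h\in\mathcal H$ the functional $z\mapsto\tau(zh)$ on $\mathcal Z$ is represented by a unique $W_0$-invariant complex measure on (the preimage in $T$ of) $S$; this measure is absolutely continuous with respect to $\nu$ with essentially bounded density. $t\mapsto\chi_t(h)$ denotes the resulting measurable, essentially bounded, $W_0$-invariant density (chosen linearly in $h$), so $\tau(zh)=\int_Tz(t)\chi_t(h)\,d\nu(t)$ for all $z\in\mathcal Z$; one sets $\chi_t(h)=0$ for $t$ outside the support of $\nu$. *)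

(* Defs.v *)
From HB Require Import structures.
From mathcomp Require Import all_boot all_order all_algebra finmap.
From mathcomp Require Import complex.
From mathcomp Require Import all_classical all_reals all_analysis.

Set Implicit Arguments.
Unset Strict Implicit.
Unset Printing Implicit Defensive.

Import Order.TTheory GRing.Theory Num.Theory.
Import numFieldNormedType.Exports.

Local Open Scope classical_set_scope.
Local Open Scope ring_scope.
Local Open Scope complex_scope.

Definition is_lattice (V : zmodType) : Prop :=
  exists (n : nat) (b : 'I_n -> V),
    bijective (fun c : {ffun 'I_n -> int} => \sum_(i < n) b i *~ c i).

Definition nat_span (V : zmodType) (F : {fset V}) : set V :=
  [set x | exists c : V -> nat, x = \sum_(a <- F) a *+ c a].

Record root_datum := RootDatum {
  rd_X : zmodType;
  rd_Y : zmodType;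
  rd_pair : rd_X -> rd_Y -> int;
  rd_roots : {fset rd_X};
  rd_coroot : rd_X -> rd_Y; (* only meaningful on [rd_roots] *)
  rd_simple : {fset rd_X};
  rd_latticeX : is_lattice rd_X;
  rd_latticeY : is_lattice rd_Y;
  rd_pairDl : forall x x' y,
    rd_pair (x + x') y = rd_pair x y + rd_pair x' y;
  rd_pairDr : forall x y y',
    rd_pair x (y + y') = rd_pair x y + rd_pair x y';
  rd_perfectl : forall f : {additive rd_Y -> int},
    exists! x, forall y, rd_pair x y = f y;
  rd_perfectr : forall f : {additive rd_X -> int},
    exists! y, forall x, rd_pair x y = f x;
  rd_pair2 : forall a, a \in rd_roots -> rd_pair a (rd_coroot a) = 2;
  rd_coroot_inj : {in rd_roots &, injective rd_coroot};
  rd_roots_refl : forall a b, a \in rd_roots -> b \in rd_roots ->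
    b - a *~ rd_pair b (rd_coroot a) \in rd_roots;
  rd_coroots_refl : forall a b, a \in rd_roots -> b \in rd_roots ->
    exists2 c, c \in rd_roots &
      rd_coroot b - rd_coroot a *~ rd_pair a (rd_coroot b) = rd_coroot c;
  rd_reduced : forall a b (m n : int), a \in rd_roots -> b \in rd_roots ->
    m != 0 -> b *~ m = a *~ n -> b = a \/ b = - a;
  rd_simple_sub : {subset rd_simple <= rd_roots};
  rd_simple_free : forall c : rd_X -> int,
    \sum_(a <- rd_simple) a *~ c a = 0 -> {in rd_simple, forall a, c a = 0};
  rd_simple_base : forall a, a \in rd_roots ->
    nat_span rd_simple a \/ nat_span rd_simple (- a)
}.

Section RootDatum.
Variable D : root_datum.
Local Notation X := (rd_X D).
Local Notation Y := (rd_Y D).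

Definition pos_root (a : X) : Prop :=
  a \in rd_roots D /\ nat_span (rd_simple D) a.

Definition dominant (x : X) : Prop :=
  forall a, pos_root a -> 0 <= rd_pair x (rd_coroot a).

Definition refl (a x : X) : X := x - a *~ rd_pair x (rd_coroot a).

Inductive is_weyl : (X -> X) -> Prop :=
| is_weyl1 : is_weyl id
| is_weylM a w : a \in rd_roots D -> is_weyl w -> is_weyl (refl a \o w).

Lemma rd_pair0l y : rd_pair (0 : X) y = 0.
Proof. by apply: (addrI (rd_pair 0 y)); rewrite -rd_pairDl !addr0. Qed.

Lemma rd_pairNl x y : rd_pair (- x : X) y = - rd_pair x y.
Proof. by apply/eqP; rewrite -addr_eq0 -rd_pairDl addNr rd_pair0l. Qed.

Lemma rd_pairMzl x y n : rd_pair (x *~ n : X) y = rd_pair x y * n.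
Proof.
have natP m : rd_pair (x *+ m : X) y = rd_pair x y * m%:Z.
  elim: m => [|m IH]; first by rewrite mulr0n rd_pair0l mulr0.
  by rewrite mulrS rd_pairDl IH -addn1 PoszD mulrDr mulr1 addrC.
case: n => m; first by rewrite -pmulrn natP.
by rewrite NegzE mulrNz rd_pairNl -pmulrn natP mulrN.
Qed.

Lemma reflK a : a \in rd_roots D -> involutive (refl a).
Proof.
move=> aR x; rewrite /refl rd_pairDl rd_pairNl rd_pairMzl (rd_pair2 aR).
set n := rd_pair x _; rewrite -addrA -opprD -mulrzDr.
by rewrite addrA mulr_natl mulr2n subrr mulr0z subr0.
Qed.

Lemma reflD a : {morph refl a : x y / x + y}.
Proof. by move=> x y; rewrite /refl rd_pairDl mulrzDr opprD addrACA. Qed.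

Lemma is_weyl_comp v w : is_weyl v -> is_weyl w -> is_weyl (v \o w).
Proof. by move=> vW wW; elim: vW => // a v' aR _ IH; exact: is_weylM. Qed.

Lemma is_weyl_inv w : is_weyl w ->
  exists v, [/\ is_weyl v, v \o w = id & w \o v = id].
Proof.
elim=> [|a w' aR _ [v [vW vw wv]]]; first by exists id; split=> //; exact: is_weyl1.
exists (v \o refl a); split.
- by apply: is_weyl_comp => //; apply: (is_weylM aR is_weyl1).
- apply/funext => x /=; rewrite (reflK aR).
  by rewrite -[LHS]/((v \o w') x) vw.
- apply/funext => x /=; rewrite -[w' _]/((w' \o v) (refl a x)) wv.
  exact: reflK.
Qed.

Lemma is_weylD w : is_weyl w -> {morph w : x y / x + y}.
Proof. by elim=> [|a w' aR _ IH] x y //=; rewrite IH reflD. Qed.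

(* [W_0], realized as a group of automorphisms of [X]. *)
Definition weyl : Type := {w : X -> X | `[< is_weyl w >]}.
HB.instance Definition _ :=
  Choice.copy weyl {w : X -> X | `[< is_weyl w >]}.

Definition weyl_fun (w : weyl) : X -> X := val w.
Coercion weyl_fun : weyl >-> Funclass.

Lemma weyl_funP (w : weyl) : is_weyl w.
Proof. exact/asboolP/(valP w). Qed.

Definition mk_weyl w (wW : is_weyl w) : weyl := exist _ w (asboolT wW).

Lemma weyl_ext (v w : weyl) : v =1 w -> v = w.
Proof. by move=> vw; apply: val_inj; apply/funext. Qed.

Definition weyl_one : weyl := mk_weyl is_weyl1.
Definition weyl_mul (v w : weyl) : weyl :=
  mk_weyl (is_weyl_comp (weyl_funP v) (weyl_funP w)).
Definition weyl_inv (w : weyl) : weyl :=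
  let v := cid (is_weyl_inv (weyl_funP w)) in
  mk_weyl (let: And3 vW _ _ := projT2 v in vW).

Lemma weyl_invK (w : weyl) :
  (forall x, weyl_inv w (w x) = x) /\ (forall x, w (weyl_inv w x) = x).
Proof.
rewrite /weyl_inv; case: (cid _) => v vP.
have [_ vw wv] := vP; split=> x.
- have e : (v \o w) x = x by rewrite vw.
  exact: e.
- have e : (w \o v) x = x by rewrite wv.
  exact: e.
Qed.

Let weylA : associative weyl_mul.
Proof. by move=> u v w; apply: weyl_ext => x. Qed.
Let weyl1g : left_id weyl_one weyl_mul.
Proof. by move=> w; apply: weyl_ext => x. Qed.
Let weylg1 : right_id weyl_one weyl_mul.
Proof. by move=> w; apply: weyl_ext => x. Qed.
Let weylVg : left_inverse weyl_one weyl_inv weyl_mul.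
Proof. by move=> w; apply: weyl_ext; exact: (weyl_invK w).1. Qed.
Let weylgV : right_inverse weyl_one weyl_inv weyl_mul.
Proof. by move=> w; apply: weyl_ext; exact: (weyl_invK w).2. Qed.
HB.instance Definition _ := isGroup.Build weyl weylA weyl1g weylg1 weylVg weylgV.

(* [AffWeyl w x] is the element [t_x w] of [W_0 |>< X]: first [w], then the
   translation by [x]. *)
Record affweyl := AffWeyl { aw_lin : weyl; aw_trans : X }.

Let aw_pair (w : affweyl) := (aw_lin w, aw_trans w).
Let aw_unpair (p : weyl * X) := AffWeyl p.1 p.2.
Let aw_pairK : cancel aw_pair aw_unpair. Proof. by case. Qed.
HB.instance Definition _ := Choice.copy affweyl (can_type aw_pairK).

Definition aw_one := AffWeyl 1%g 0.
Definition aw_mul (v w : affweyl) :=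
  AffWeyl (aw_lin v * aw_lin w)%g (aw_trans v + aw_lin v (aw_trans w)).
Definition aw_inv (w : affweyl) :=
  AffWeyl (aw_lin w)^-1%g (- weyl_fun (aw_lin w)^-1%g (aw_trans w)).

Let weylD (w : weyl) : {morph w : x y / x + y}.
Proof. exact: is_weylD (weyl_funP w). Qed.
Let weyl0 (w : weyl) : w 0 = 0.
Proof. by apply: (addrI (w 0)); rewrite -weylD !addr0. Qed.
Let weylN (w : weyl) x : w (- x) = - w x.
Proof. by apply/eqP; rewrite -addr_eq0 -weylD addNr weyl0. Qed.

Let awA : associative aw_mul.
Proof.
by move=> u v w; rewrite /aw_mul /= mulgA weylD addrA.
Qed.
Let aw1g : left_id aw_one aw_mul.
Proof. by case=> w x; rewrite /aw_mul /= mul1g add0r. Qed.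
Let awg1 : right_id aw_one aw_mul.
Proof. by case=> w x; rewrite /aw_mul /= mulg1 weyl0 addr0. Qed.
Let awVg : left_inverse aw_one aw_inv aw_mul.
Proof. by case=> w x; rewrite /aw_mul /aw_inv /= mulVg addNr. Qed.
Let awgV : right_inverse aw_one aw_inv aw_mul.
Proof.
case=> w x; rewrite /aw_mul /aw_inv /= mulgV weylN.
by rewrite (weyl_invK w).2 subrr.
Qed.
HB.instance Definition _ := isGroup.Build affweyl awA aw1g awg1 awVg awgV.

Definition aw_act (w : affweyl) (x : X) : X := aw_lin w x + aw_trans w.

Definition transl (x : X) : affweyl := AffWeyl 1%g x.

Definition aff_eval (a : Y * int) (x : X) : int := rd_pair x a.1 + a.2.

(* [aff_eval] is injective because the pairing is perfect, so that the action
   of [W] on [Y * int] is given by its action on functions. *)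
Definition fun_act (w : affweyl) (f : X -> int) : X -> int :=
  fun x => f (aw_act w^-1%g x).

Definition aff_root : set (Y * int) :=
  [set a | exists2 b, b \in rd_roots D & a.1 = rd_coroot b].

Definition aff_pos : set (Y * int) :=
  [set a | exists2 b, b \in rd_roots D &
    a.1 = rd_coroot b /\ (0 < a.2 \/ (a.2 = 0 /\ pos_root b))].

Definition aff_neg : set (Y * int) := aff_root `\` aff_pos.

(* [fset_set] is meaningful here: R^aff_+ meets w^-1 R^aff_- in a finite set. *)
Definition len (w : affweyl) : nat :=
  #|` fset_set [set a | aff_pos a /\
        exists2 b, aff_neg b & fun_act w (aff_eval a) = aff_eval b] |.

(* The dominance order: [y <= y'] iff [y' - y] is a sum of simple coroots. *)
Definition dominance_le (y y' : Y) : Prop :=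
  nat_span [fset rd_coroot a | a in rd_simple D]%fset (y' - y).

Definition minimal_coroot (a : X) : Prop :=
  a \in rd_roots D /\
  forall b, b \in rd_roots D ->
    dominance_le (rd_coroot b) (rd_coroot a) -> rd_coroot b = rd_coroot a.

(* A root [a] together with [k] stands for the affine root [(a^vee, k)]. *)
Definition simple_aff (a : X) (k : int) : Prop :=
  (a \in rd_simple D /\ k = 0) \/ (minimal_coroot a /\ k = 1).

Definition Saff : set affweyl :=
  [set s | exists a k, simple_aff a k /\
    forall x, aw_act s x = x - a *~ aff_eval (rd_coroot a, k) x].

Definition is_weight (R : realType) (qq : R) (f q : affweyl -> R) : Prop :=
  [/\ forall s, Saff s -> q s = qq `^ f s,
      forall w w', len (w * w')%g = (len w + len w')%N ->
        q (w * w')%g = q w * q w'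
    & forall w, len w = 0%N -> q w = 1].

End RootDatum.

(* All fields are determined, up to a unique isomorphism, by [D] and [q]: [T_w]
   is a basis on which the product, [hecke_star] and [hecke_tau] are given. *)
Record hecke_algebra (R : realType) (D : root_datum) (q : affweyl D -> R) :=
  HeckeAlgebra {
  hecke_sort :> algType R[i];
  hecke_T : affweyl D -> hecke_sort;
  hecke_star : hecke_sort -> hecke_sort;
  hecke_tau : {scalar hecke_sort};
  hecke_basis : forall h, exists! c : {fsfun affweyl D -> R[i] with 0},
    h = \sum_(w <- finsupp c) c w *: hecke_T w;
  hecke_TM : forall w w', len (w * w')%g = (len w + len w')%N ->
    hecke_T w * hecke_T w' = hecke_T (w * w')%g;
  hecke_quadratic : forall s, Saff s ->
    (hecke_T s + 1) * (hecke_T s - (q s)%:C%:A) = 0;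
  hecke_starP : forall (c : R[i]) h h',
    hecke_star (c *: h + h') = c^* *: hecke_star h + hecke_star h';
  hecke_starM : forall h h', hecke_star (h * h') = hecke_star h' * hecke_star h;
  hecke_starK : involutive hecke_star;
  hecke_starT : forall w, hecke_star (hecke_T w) = hecke_T w^-1%g;
  hecke_tauT : forall w, hecke_tau (hecke_T w) = (w == 1%g)%:R
}.

Section Hecke.
Variables (R : realType) (D : root_datum) (q : affweyl D -> R).
Variable H : hecke_algebra q.
Local Notation X := (rd_X D).

(* Linear in the second argument, as is [hilb_dot] below. *)
Definition hecke_ip (h1 h2 : H) : R[i] := hecke_tau H (hecke_star h1 * h2).

Definition hecke_N (w : affweyl D) : H := ((Num.sqrt (q w))^-1)%:C *: hecke_T H w.

Definition hecke_pos (h : H) : Prop :=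
  hecke_star h = h /\ forall x : H, 0 <= hecke_ip (h * x) x.

Definition positive_functional (chi : {scalar H}) : Prop :=
  forall h, hecke_pos h -> 0 <= chi h.

Definition central_functional (chi : {scalar H}) : Prop :=
  forall h h' : H, chi (h * h' - h' * h) = 0.

Definition is_theta (theta : X -> H) : Prop :=
  [/\ theta 0 = 1,
      forall x y, theta (x + y) = theta x * theta y
    & forall x, dominant x -> theta x = hecke_N (transl x)].

(* [A] is identified with [C[X]]: an element of [A] is given by a Laurent
   polynomial [p], as [bernstein theta p]; its value at [t] in [T] is
   [laurent_eval p t] (below). *)
Definition laurent := {fsfun X -> R[i] with 0}.

Definition laurent_inv (p : laurent) : Prop :=
  forall (w : weyl D) x, p (w x) = p x.

Definition bernstein (theta : X -> H) (p : laurent) : H :=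
  \sum_(x <- finsupp p) p x *: theta x.

(* [Z = A^{W_0}]; by Bernstein's theorem this is the center of [H]. *)
Definition hecke_Z (theta : X -> H) : set H :=
  [set bernstein theta p | p in laurent_inv].

Record hilbert_completion := HilbertCompletion {
  hilb :> completeNormedModType R[i];
  hilb_dot : hilb -> hilb -> R[i];
  hilb_emb : {linear H -> hilb};
  hilb_dotP : forall (c : R[i]) u v w,
    hilb_dot u (c *: v + w) = c * hilb_dot u v + hilb_dot u w;
  hilb_dotC : forall u v, hilb_dot u v = (hilb_dot v u)^*;
  hilb_norm : forall u, `|u| ^+ 2 = hilb_dot u u;
  hilb_embE : forall h h', hilb_dot (hilb_emb h) (hilb_emb h') = hecke_ip h h';
  hilb_dense : closure (range hilb_emb) = setT
}.

Variable E : hilbert_completion.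

Definition bounded_op : set (E -> E) :=
  [set A | (forall (c : R[i]) u v, A (c *: u + v) = c *: A u + A v) /\
           continuous A].

Definition opnorm (A : E -> E) : R :=
  sup [set complex.Re `|A u| | u in [set u : E | `|u| <= 1]].

(* The continuous extension to [E] of left multiplication by [h]. *)
Definition lmul (h : H) : E -> E :=
  xget (fun=> 0) [set A | bounded_op A /\
    forall x : H, A (hilb_emb E x) = hilb_emb E (h * x)].

Definition op_closure (P : set H) : set (E -> E) :=
  [set A | bounded_op A /\ forall e : R, 0 < e ->
    exists2 h, P h & opnorm (A \- lmul h) < e].

(* As [B(E)] is complete, the completion of [H] is its closure in [B(E)]. *)
Definition cstar : set (E -> E) := op_closure setT.

Definition adjoint (A B : E -> E) : Prop :=
  forall u v, hilb_dot (A u) v = hilb_dot u (B v).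

Definition linear_on (P : set (E -> E)) (phi : (E -> E) -> R[i]) : Prop :=
  forall (c : R[i]) A B, P A -> P B ->
    phi (fun u => c *: A u + B u) = c * phi A + phi B.

Definition continuous_on (P : set (E -> E)) (phi : (E -> E) -> R[i]) : Prop :=
  forall A, P A -> forall e : R, 0 < e -> exists2 d : R, 0 < d &
    forall B, P B -> opnorm (B \- A) < d -> `|phi B - phi A| < e%:C.

(* Only the restriction of [phi] to [cstar] matters. *)
Definition tracial_state (phi : (E -> E) -> R[i]) : Prop :=
  [/\ linear_on cstar phi,
      continuous_on cstar phi,
      forall A B, cstar A -> cstar B -> adjoint A B -> 0 <= phi (B \o A),
      phi id = 1
    & forall A B, cstar A -> cstar B -> phi (A \o B) = phi (B \o A)].

Definition character_on (P : set (E -> E)) (phi : (E -> E) -> R[i]) : Prop :=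
  [/\ linear_on P phi,
      forall A B, P A -> P B -> phi (A \o B) = phi A * phi B
    & phi id = 1].

End Hecke.

Arguments lmul {R D q H} E h.
Arguments op_closure {R D q H} E P.

Section Torus.
Variables (R : realType) (D : root_datum).
Local Notation X := (rd_X D).

(* For [X] of finite rank, pointwise convergence is the usual topology. *)
Definition is_char : set {ptws X -> (R[i] : numFieldType)} :=
  [set t | (forall x, t x != 0) /\ forall x y, t (x + y) = t x * t y].

Definition torus : Type := set_type is_char.
HB.instance Definition _ := Topological.on torus.

Definition torus_fun (t : torus) : X -> R[i] := set_val t.
Coercion torus_fun : torus >-> Funclass.

Lemma torus_funP (t : torus) : is_char t.
Proof. exact: set_valP. Qed.

Lemma is_char1 : is_char (fun=> 1).
Proof. by split=> [x|x y]; rewrite ?oner_eq0 ?mulr1. Qed.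
HB.instance Definition _ := isPointed.Build torus (SigSub (mem_set is_char1)).

Lemma torus_act_subproof (w : weyl D) (t : torus) :
  is_char (fun x => t (weyl_fun w^-1%g x)).
Proof.
have [t0 tD] := torus_funP t; split=> [x|x y]; first exact: t0.
by rewrite (is_weylD (weyl_funP _)) -tD.
Qed.

Definition torus_act (w : weyl D) (t : torus) : torus :=
  SigSub (mem_set (torus_act_subproof w t)).

Definition laurent_eval (p : laurent R D) (t : torus) : R[i] :=
  \sum_(x <- finsupp p) p x * t x.

Definition torus_borel := g_sigma_algebraType (@open torus).

Definition cintegral (nu : {measure set torus_borel -> \bar R})
    (f : torus -> R[i]) : R[i] :=
  (\int[nu]_(t in setT) complex.Re (f t))%R +i*
  (\int[nu]_(t in setT) complex.Im (f t))%R.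

Definition measure_support (nu : {measure set torus_borel -> \bar R}) :
    set torus :=
  [set t | forall U : set torus, open U -> U t -> (0 < nu U)%E].

Section Spectral.
Variables (q : affweyl D -> R) (H : hecke_algebra q) (E : hilbert_completion H).
Variable theta : X -> H.

(* The preimage in [T] of the spectrum [S] of the closure of [Z]: the points
   at which evaluation on [Z] is the restriction of a character. *)
Definition spectrum : set torus :=
  [set t | exists2 phi, character_on (op_closure E (hecke_Z theta)) phi &
    forall p, laurent_inv p ->
      phi (lmul E (bernstein theta p)) = laurent_eval p t].

Definition is_spectral_measure (nu : probability torus_borel R) : Prop :=
  [/\ forall w (A : set torus_borel), measurable A ->
        nu (torus_act w @^-1` A) = nu A,
      nu.-negligible (~` spectrum)
    & forall p, laurent_inv p ->
        hecke_tau H (bernstein theta p) = cintegral nu (laurent_eval p)].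

(* [chi_t(h)] is the density with respect to [nu] of the measure representing
   [z |-> tau (z h)]. *)
Definition is_local_trace (nu : probability torus_borel R)
    (chi : torus -> {scalar H}) : Prop :=
  [/\ forall h,
        measurable_fun [set: torus_borel] (fun t => complex.Re (chi t h)) /\
        measurable_fun [set: torus_borel] (fun t => complex.Im (chi t h)),
      forall h, exists M : R, {ae nu, forall t, `|chi t h| <= M%:C},
      forall w t h, chi (torus_act w t) h = chi t h,
      forall h p, laurent_inv p ->
        hecke_tau H (bernstein theta p * h) =
        cintegral nu (fun t => laurent_eval p t * chi t h)
    & forall t, ~ measure_support nu t -> forall h, chi t h = 0].

End Spectral.
End Torus.

(* Main.v *)
(* By Bernstein's relations Z is central, and z^* has symbol conj(p(-x)); a Neumann
   series bounds the characters of the closure of Z, so on the support of nu the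
   elements of Z are bounded and closed under conjugation.  Their real parts form
   an algebra separating the W_0-orbits, hence dense in the invariant functions of
   L^2(nu): an invariant density orthogonal to Z vanishes, and one which is
   nonnegative against squares is nonnegative.  Applied to tau(z h), tau(z h h')
   and tau(z^* z h) this gives (iii), centrality and positivity almost everywhere
   for each h, then for all h by separability of the coefficients.  Cauchy-Schwarz
   bounds chi_t by the operator norm, so chi_t extends to the C*-algebra. *)

(* A coroot may be divisible by 2; then no weight pairs to 1 with it and its finite and affine
   parameters may differ. So Bernstein's relations are not written with divided differences: only
   [theta x + theta (refl a x)] is shown to commute with the simple generator, starting from the
   pairings 0, 1 and 2. Pairing 2 rests on a quadratic relation attached to an affine reflection
   that raises the length by 1.

   A point of [spectrum] comes from a purely algebraic character, with no continuity and no
   compatibility with star assumed; both are derived.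

   Elements of Z are bounded, and real parts lie in Z, only almost everywhere, and the torus is not
   compact. Density in L2 therefore goes through indicators instead of uniform approximation: a
   polynomial iteration yields superlevel sets, countable operations yield invariant closed sets,
   and averaging over W_0 yields all invariant Borel sets.

   The positive cone is uncountable and no continuity of [chi t] is known beforehand. But [chi t] is
   continuous in the coefficients on each finite span of basis elements, which makes countably many
   positive elements enough. *)
Require Import Defs.
From HB Require Import structures.
From mathcomp Require Import all_boot all_order all_algebra finmap.
From mathcomp Require Import complex.
From mathcomp Require Import all_classical all_reals all_analysis.
From mathcomp Require Import measurable_realfun.
From mathcomp Require Import zify ring lra.

Set Implicit Arguments.
Unset Strict Implicit.
Unset Printing Implicit Defensive.

Import Order.TTheory GRing.Theory Num.Theory.
Import numFieldNormedType.Exports.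

Local Open Scope classical_set_scope.
Local Open Scope ring_scope.

(** * Root combinatorics *)

Section RootCombinatorics.
Variable D : root_datum.
Local Notation X := (rd_X D).
Local Notation Y := (rd_Y D).
Local Notation R := (rd_roots D).
Local Notation F0 := (rd_simple D).
Local Notation "<< x , y >>" := (@rd_pair D x y) (at level 0, format "<< x ,  y >>").
Local Notation co := (@rd_coroot D).

Lemma pair0r (x : X) : <<x, 0>> = 0.
Proof. by apply: (addrI <<x, 0>>); rewrite -rd_pairDr !addr0. Qed.

Lemma pairNr (x : X) y : <<x, - y>> = - <<x, y>>.
Proof. by apply/eqP; rewrite -addr_eq0 -rd_pairDr addNr pair0r. Qed.

Lemma pairMnr (x : X) y n : <<x, y *+ n>> = <<x, y>> *+ n.
Proof. by elim: n => [|n IH]; rewrite ?mulr0n ?pair0r // !mulrS rd_pairDr IH. Qed.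

Lemma pairMzr (x : X) y n : <<x, y *~ n>> = <<x, y>> * n.
Proof.
case: n => m; first by rewrite -pmulrn pairMnr -mulr_natr natz.
by rewrite NegzE mulrNz pairNr -pmulrn pairMnr mulrN -mulr_natr natz.
Qed.

Lemma pairBl (x x' : X) y : <<x - x', y>> = <<x, y>> - <<x', y>>.
Proof. by rewrite rd_pairDl rd_pairNl. Qed.

Lemma pairBr (x : X) y y' : <<x, y - y'>> = <<x, y>> - <<x, y'>>.
Proof. by rewrite rd_pairDr pairNr. Qed.

Lemma pair_suml (I : Type) (s : seq I) (P : pred I) (F : I -> X) y :
  <<\sum_(i <- s | P i) F i, y>> = \sum_(i <- s | P i) <<F i, y>>.
Proof.
by apply: (big_morph (fun x => <<x, y>>)) => [x x'|];
  rewrite ?rd_pairDl ?rd_pair0l.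
Qed.

Lemma pair_sumr (I : Type) (s : seq I) (P : pred I) (F : I -> Y) x :
  <<x, \sum_(i <- s | P i) F i>> = \sum_(i <- s | P i) <<x, F i>>.
Proof.
by apply: (big_morph (fun y => <<x, y>>)) => [y y'|];
  rewrite ?rd_pairDr ?pair0r.
Qed.

Lemma pair_injl (x x' : X) : (forall y, <<x, y>> = <<x', y>>) -> x = x'.
Proof.
move=> e; pose f y := <<x, y>>.
have fB : zmod_morphism f by move=> y y'; rewrite /f pairBr.
pose M := GRing.isZmodMorphism.Build _ _ f fB.
pose F : {additive Y -> int} := HB.pack f M.
have [z [_ zU]] := rd_perfectl F.
by rewrite -(zU x) ?(zU x') // => y; rewrite -e.
Qed.

Lemma pair_injr (y y' : Y) : (forall x, <<x, y>> = <<x, y'>>) -> y = y'.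
Proof.
move=> e; pose f x := <<x, y>>.
have fB : zmod_morphism f by move=> x x'; rewrite /f pairBl.
pose M := GRing.isZmodMorphism.Build _ _ f fB.
pose F : {additive X -> int} := HB.pack f M.
have [z [_ zU]] := rd_perfectr F.
by rewrite -(zU y) ?(zU y') // => x; rewrite -e.
Qed.

Lemma refl_root (a b : X) : a \in R -> b \in R -> refl a b \in R.
Proof. exact: rd_roots_refl. Qed.

Lemma refl_self (a : X) : a \in R -> refl a a = - a.
Proof. by move=> aR; rewrite /refl rd_pair2 // -pmulrn mulr2n opprD addrA subrr sub0r. Qed.

Lemma opp_root a : a \in R -> - a \in R.
Proof. by move=> aR; rewrite -refl_self //; exact: refl_root. Qed.

Lemma opp_rootE a : (- a \in R) = (a \in R).
Proof. by apply/idP/idP => /opp_root //; rewrite opprK. Qed.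

Lemma root_neq0 a : a \in R -> a != 0.
Proof.
move=> aR; apply/eqP => a0; have := rd_pair2 aR.
by rewrite a0 rd_pair0l.
Qed.

Lemma reflN (a x : X) : refl a (- x) = - refl a x.
Proof. by rewrite /refl rd_pairNl mulrNz !opprD. Qed.

Definition corefl (a : X) (y : Y) : Y := y - co a *~ <<a, y>>.

Lemma pair_refl (a x : X) y : <<refl a x, y>> = <<x, corefl a y>>.
Proof.
by rewrite /refl /corefl pairBl pairBr rd_pairMzl pairMzr mulrC.
Qed.

Lemma coreflK a : a \in R -> involutive (corefl a).
Proof. by move=> aR y; apply: pair_injr => x; rewrite -!pair_refl reflK. Qed.

Lemma sum_refl (V : nmodType) (F : X -> V) a : a \in R ->
  \sum_(b <- R) F (refl a b) = \sum_(b <- R) F b.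
Proof.
move=> aR; rewrite -(big_map (@refl D a) predT F) /=; apply: perm_big.
have inj : injective (@refl D a) by apply: can_inj (@reflK D a aR).
apply: uniq_perm; rewrite ?map_inj_uniq ?fset_uniq //.
apply: (uniq_min_size _ _ _).2; rewrite ?map_inj_uniq ?fset_uniq ?size_map //.
by move=> _ /mapP [b bR ->]; exact: refl_root.
Qed.

Lemma sum_corefl (V : nmodType) (F : Y -> V) a : a \in R ->
  \sum_(b <- R) F (corefl a (co b)) = \sum_(b <- R) F (co b).
Proof.
move=> aR; rewrite -(big_map co predT F) -(big_map (corefl a \o co) predT F) /=.
apply: perm_big; rewrite map_comp.
have inj : injective (corefl a) by apply: can_inj (coreflK aR).
have un : uniq (map co R) by rewrite map_inj_in_uniq ?fset_uniq //; exact: rd_coroot_inj.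
apply: uniq_perm; rewrite ?(map_inj_uniq inj) //.
apply: (uniq_min_size _ _ _).2; rewrite ?(map_inj_uniq inj) ?size_map //.
move=> _ /mapP [_ /mapP [b bR ->] ->].
by have [c cR e] := rd_coroots_refl aR bR; rewrite /corefl e; apply: map_f.
Qed.

(** Invariant forms that replace the Euclidean inner product. They may degenerate outside the root
    span, but are positive at each root or coroot, whose own term is 4. *)
Definition xform (x x' : X) : int := \sum_(a <- R) <<x, co a>> * <<x', co a>>.
Definition yform (y y' : Y) : int := \sum_(a <- R) <<a, y>> * <<a, y'>>.

Lemma xformC x x' : xform x x' = xform x' x.
Proof. by apply: eq_bigr => a _; rewrite mulrC. Qed.
Lemma xformDl x x' z : xform (x + x') z = xform x z + xform x' z.
Proof. by rewrite -big_split; apply: eq_bigr => a _; rewrite rd_pairDl mulrDl. Qed.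
Lemma xformNl x z : xform (- x) z = - xform x z.
Proof. by rewrite /xform -sumrN; apply: eq_bigr => a _; rewrite rd_pairNl mulNr. Qed.
Lemma xformMzl x n z : xform (x *~ n) z = xform x z * n.
Proof.
by rewrite /xform mulr_suml; apply: eq_bigr => a _; rewrite rd_pairMzl mulrAC.
Qed.

Lemma xform_refl a x x' : a \in R -> xform (refl a x) (refl a x') = xform x x'.
Proof.
move=> aR; rewrite [RHS]/xform -(sum_corefl (fun y => <<x, y>> * <<x', y>>) aR).
by apply: eq_bigr => b _; rewrite !pair_refl.
Qed.

Lemma yform_corefl a y y' : a \in R -> yform (corefl a y) (corefl a y') = yform y y'.
Proof.
move=> aR; rewrite [RHS]/yform -(sum_refl (fun b => <<b, y>> * <<b, y'>>) aR).
by apply: eq_bigr => b _; rewrite -!pair_refl.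
Qed.

Lemma xform_ge0 x : 0 <= xform x x.
Proof. by apply: sumr_ge0 => a _; rewrite -expr2 sqr_ge0. Qed.

Lemma xform_gt0 a : a \in R -> 0 < xform a a.
Proof.
move=> aR; rewrite /xform (big_fsetD1 a) //= rd_pair2 //.
by apply: ltr_pwDl => //; apply: sumr_ge0 => b _; rewrite -expr2 sqr_ge0.
Qed.

Lemma yform_gt0 a : a \in R -> 0 < yform (co a) (co a).
Proof.
move=> aR; rewrite /yform (big_fsetD1 a) //= rd_pair2 //.
by apply: ltr_pwDl => //; apply: sumr_ge0 => b _; rewrite -expr2 sqr_ge0.
Qed.

Lemma xformNr x z : xform x (- z) = - xform x z.
Proof. by rewrite xformC xformNl xformC. Qed.

(** Expanding the invariance of the form under [refl a] gives back the formula 2(x,a)/(a,a) for the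
    pairing. *)
Lemma xform_coroot (a x : X) : a \in R -> <<x, co a>> * xform a a = 2 * xform x a.
Proof.
move=> aR; have := xform_refl x a aR; rewrite refl_self // /refl xformNr.
rewrite xformDl xformNl xformMzl; set p := xform x a; set q := xform a a.
by set n := <<_, _>>; lia.
Qed.

Lemma yform_root (a : X) y : a \in R -> <<a, y>> * yform (co a) (co a) = 2 * yform (co a) y.
Proof.
move=> aR; have := yform_corefl (co a) y aR.
have -> : corefl a (co a) = - co a.
  by rewrite /corefl rd_pair2 // -pmulrn mulr2n opprD addrA subrr sub0r.
have -> : yform (- co a) (corefl a y) = - yform (co a) y + <<a, y>> * yform (co a) (co a).
  rewrite /yform -sumrN mulr_sumr -big_split; apply: eq_bigr => b _ /=.
  by rewrite /corefl pairBr pairMzr pairNr; ring.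
by lia.
Qed.

(* With [c_a = 2 n_a / yform(a^, a^)] one gets [<v,y> = sum_b k_b <b,y>] where
   [k_b = sum_a c_a <b,a^>], and [sum_b k_b^2 = sum_a c_a <v,a^> = 0]. *)
Lemma root_span_rad (n : X -> int) (v : X) : v = \sum_(a <- R) a *~ n a ->
  (forall a, a \in R -> <<v, co a>> = 0) -> v = 0.
Proof.
move=> vE v0; apply: pair_injl => y; rewrite rd_pair0l.
pose c a : rat := 2 * (n a)%:~R / (yform (co a) (co a))%:~R.
pose k b : rat := \sum_(a <- R) c a * <<b, co a>>%:~R.
have pvE z : <<v, z>>%:~R = \sum_(b <- R) k b * <<b, z>>%:~R :> rat.
  rewrite vE pair_suml rmorph_sum /=.
  under [RHS]eq_bigr => b _ do rewrite /k mulr_suml.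
  rewrite exchange_big /= big_seq [RHS]big_seq; apply: eq_bigr => a aR.
  have y0 : (yform (co a) (co a))%:~R != 0 :> rat.
    by rewrite intr_eq0 gt_eqF // yform_gt0.
  have e : \sum_(b <- R) (<<b, co a>> * <<b, z>>)%:~R = (yform (co a) z)%:~R :> rat.
    by rewrite -rmorph_sum.
  under [RHS]eq_bigr => b _ do rewrite -mulrA -intrM.
  rewrite -mulr_sumr e rd_pairMzl /c intrM.
  have := congr1 (fun m : int => m%:~R : rat) (yform_root z aR).
  by rewrite !intrM => h; rewrite mulrAC; apply/(canRL (mulfK y0)); rewrite mulrAC h; ring.
have k0 : \sum_(b <- R) k b ^+ 2 = 0.
  under eq_bigr => b _ do rewrite expr2 {2}/k mulr_sumr.
  rewrite exchange_big /= big_seq big1 // => a aR.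
  under eq_bigr => b _ do rewrite mulrCA.
  by rewrite -mulr_sumr -pvE v0 // mulr0.
have kb b : b \in R -> k b = 0.
  move=> bR; move/eqP: k0; rewrite psumr_eq0 => [/allP/(_ b bR)|c' _]; last exact: sqr_ge0.
  by rewrite /= sqrf_eq0 => /eqP.
apply/eqP; rewrite -(intr_eq0 rat) pvE big_seq big1 // => b bR.
by rewrite kb // mul0r.
Qed.

Lemma xform_weyl (w : X -> X) x x' : is_weyl w -> xform (w x) (w x') = xform x x'.
Proof. by move=> wW; elim: wW x x' => [|a w' aR _ IH] x x' //=; rewrite xform_refl. Qed.

Lemma weyl_root (w : weyl D) a : (w a \in R) = (a \in R).
Proof.
have im v b : is_weyl v -> b \in R -> v b \in R.
  by move=> vW bR; elim: vW => [|a' w' aR _ IH] //=; exact: refl_root.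
apply/idP/idP => [h|]; last exact/im/weyl_funP.
by rewrite -[a](weyl_invK w).1; apply: im h; exact: weyl_funP.
Qed.

(** By [xform_coroot] the pairing with a coroot is determined by the invariant form, so equivariance
    of the coroot map comes for free. *)
Lemma weyl_coroot (w : weyl D) a x : a \in R -> <<w x, co (w a)>> = <<x, co a>>.
Proof.
move=> aR; have wR : w a \in R by rewrite weyl_root.
apply: (@mulIf _ (xform a a)); first by rewrite gt_eqF // xform_gt0.
rewrite xform_coroot // -(xform_weyl a a (weyl_funP w)) xform_coroot //.
by rewrite xform_weyl //; exact: weyl_funP.
Qed.

Lemma weyl0 (w : weyl D) : w 0 = 0.
Proof. by apply: (addrI (w 0)); rewrite -(is_weylD (weyl_funP w)) !addr0. Qed.
Lemma weylD (w : weyl D) x y : w (x + y) = w x + w y.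
Proof. exact: is_weylD (weyl_funP w) x y. Qed.
Lemma weylN (w : weyl D) x : w (- x) = - w x.
Proof. by apply/eqP; rewrite -addr_eq0 -weylD addNr weyl0. Qed.
Lemma weylB (w : weyl D) x y : w (x - y) = w x - w y.
Proof. by rewrite weylD weylN. Qed.

Lemma is_weyl_span (w : X -> X) x : is_weyl w ->
  exists n : X -> int, w x - x = \sum_(a <- R) a *~ n a.
Proof.
elim=> [|a w' aR _ [n IH]] /=.
  by exists (fun=> 0); rewrite subrr big1 // => a _; rewrite mulr0z.
exists (fun b => n b - (b == a)%:R * <<w' x, co a>>).
rewrite /refl addrAC IH.
under [RHS]eq_bigr => b _ do rewrite mulrzBr.
rewrite sumrB; congr (_ - _).
rewrite (big_fsetD1 a) //= eqxx mul1r [X in _ + X]big1_fset ?addr0 // => b.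
by rewrite in_fsetD1 => /andP [/negPf -> _] _; rewrite mul0r mulr0z.
Qed.

(** [w x - x] lies in the root span; as [w] fixes every root, hence every coroot functional, this
    difference is orthogonal to all coroots. *)
Lemma weyl_eq1 (w : weyl D) : {in R, w =1 id} -> w =1 id.
Proof.
move=> wR x; have [n e] := is_weyl_span x (weyl_funP w).
apply/eqP; rewrite -subr_eq0; apply/eqP; apply: (root_span_rad e) => a aR.
by rewrite pairBl -{1}(wR a aR) weyl_coroot // subrr.
Qed.

(** A Weyl element is determined by its permutation of the roots, even when the roots do not span
    [X]. *)
Lemma weyl_finite : finite_set [set: weyl D].
Proof.
pose f (w : weyl D) : {ffun R -> R} := [ffun b : R => insubd b (w (val b))].
apply: (@sub_finite_set _ _ (f @^-1` setT)) => //.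
apply: finite_preimage; last exact: finite_finset.
move=> v w _ _ e.
have vw a : a \in R -> v a = w a.
  move=> aR; have := congr1 (fun g : {ffun R -> R} => val (g [` aR]%fset)) e.
  by rewrite !ffunE !val_insubd !weyl_root aR.
apply: weyl_ext => x.
have h z : ((v^-1 * w)%g : weyl D) z = z.
  apply: weyl_eq1 => a aR; change (weyl_fun v^-1%g (w a) = a).
  by rewrite -vw //; exact: (weyl_invK v).1.
by rewrite -[RHS](weyl_invK v).2; rewrite -[in LHS](h x).
Qed.

Definition rpos (a : X) : bool := `[< nat_span F0 a >].

Lemma simple_root a : a \in F0 -> a \in R.
Proof. exact: rd_simple_sub. Qed.

Lemma simple_uniq (c d : X -> int) :
  \sum_(a <- F0) a *~ c a = \sum_(a <- F0) a *~ d a -> {in F0, c =1 d}.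
Proof.
move=> e a aF; apply/eqP; rewrite -subr_eq0; apply/eqP.
apply: (@rd_simple_free D (fun a => c a - d a)) => //.
under eq_bigr => b _ do rewrite mulrzBr.
by rewrite sumrB e subrr.
Qed.

Lemma nat_spanP (a : X) : nat_span F0 a <->
  exists c : X -> int, (forall b, 0 <= c b) /\ a = \sum_(b <- F0) b *~ c b.
Proof.
split=> [[c ->]|[c [c0 ->]]]; first by exists (fun b => (c b)%:Z).
exists (fun b => `|c b|%N); apply: eq_bigr => b _.
by rewrite -{1}(gez0_abs (c0 b)).
Qed.

Lemma rposN (a : X) : a \in R -> rpos (- a) = ~~ rpos a.
Proof.
move=> aR; suff h : ~ (nat_span F0 a /\ nat_span F0 (- a)).
  rewrite /rpos; case: (rd_simple_base aR) => k.
    by rewrite [in RHS]asboolT //=; apply: asboolF => k'; apply: h.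
  by rewrite asboolT // asboolF // => k'; apply: h.
move=> [/nat_spanP [c [c0 aE]] /nat_spanP [d [d0 naE]]].
have /simple_uniq cd : \sum_(b <- F0) b *~ c b = \sum_(b <- F0) b *~ (- d b).
  by under [RHS]eq_bigr => b _ do rewrite mulrNz; rewrite sumrN -naE opprK -aE.
have := root_neq0 aR; rewrite aE big_seq big1 ?eqxx // => b bF.
have := cd b bF; have := c0 b; have := d0 b => ? ? e.
by have -> : c b = 0 by lia.
Qed.

Lemma rpos_simple a : a \in F0 -> rpos a.
Proof.
move=> aF; apply/asboolP/nat_spanP; exists (fun b => (b == a)%:R); split=> [b|].
  by case: eqP.
rewrite (big_fsetD1 a) //= eqxx mulr1z [X in _ + X]big1_fset ?addr0 // => b.
by rewrite in_fsetD1 => /andP [/negPf ->].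
Qed.

Lemma sum_simple_delta (c : X -> int) (g : X) n : g \in F0 ->
  \sum_(b <- F0) b *~ (c b - (b == g)%:R * n) = \sum_(b <- F0) b *~ c b - g *~ n.
Proof.
move=> gF; under eq_bigr => b _ do rewrite mulrzBr.
rewrite sumrB; congr (_ - _).
rewrite (big_fsetD1 g) //= eqxx mul1r [X in _ + X]big1_fset ?addr0 // => b.
by rewrite in_fsetD1 => /andP [/negPf -> _] _; rewrite mul0r mulr0z.
Qed.

(** The reflection changes only the coefficient at [g]. If the image were negative, all other
    coefficients of [a] would vanish, and reducedness would leave [a = g] or [a = - g]. *)
Lemma rpos_refl (g a : X) : g \in F0 -> a \in R -> rpos a -> a != g -> rpos (refl g a).
Proof.
move=> gF aR pa ag; have gR := simple_root gF.
have sR : refl g a \in R by exact: refl_root.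
apply: contraT; rewrite -rposN // => /asboolP/nat_spanP [d [d0 dE]].
move/asboolP/nat_spanP: (pa) => [c [c0 cE]].
have /simple_uniq cd : \sum_(b <- F0) b *~ (c b - (b == g)%:R * <<a, co g>>) =
    \sum_(b <- F0) b *~ (- d b).
  rewrite sum_simple_delta // -cE; under [RHS]eq_bigr => b _ do rewrite mulrNz.
  by rewrite sumrN -dE opprK.
have c0' b : b \in F0 -> b != g -> c b = 0.
  move=> bF bg; have := cd b bF; rewrite (negPf bg) mul0r subr0.
  by have := c0 b; have := d0 b => ? ? ?; lia.
have aE : a *~ 1 = g *~ c g.
  rewrite mulr1z {1}cE (big_fsetD1 g) //= [X in _ + X]big1_fset ?addr0 // => b.
  by rewrite in_fsetD1 => /andP [bg bF] _; rewrite c0'.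
case: (rd_reduced gR aR _ aE) => // [e|e]; first by rewrite e eqxx in ag.
by move: pa; rewrite e rposN // rpos_simple.
Qed.

(** Twice the usual half sum of positive roots, so that it lies in [X]. *)
Definition rho2 : X := \sum_(a <- R | rpos a) a.

(** The reflection in [g] permutes the positive roots other than [g], so their sum pairs to zero
    with its coroot and only the term of [g] is left. *)
Lemma rho2_simple (g : X) : g \in F0 -> <<rho2, co g>> = 2.
Proof.
move=> gF; have gR := simple_root gF.
pose Q a := rpos a && (a != g).
have Q1 a : a \in R -> Q a -> Q (refl g a).
  move=> aR /andP [pa ag]; rewrite /Q rpos_refl //=; apply/eqP => e.
  move: pa; rewrite -(reflK gR a) e refl_self //.
  by rewrite rposN // rpos_simple.
have Qr a : a \in R -> Q (refl g a) = Q a.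
  move=> aR; apply/idP/idP; last exact: Q1.
  by move/(Q1 _ (refl_root gR aR)); rewrite reflK.
have s0 : \sum_(a <- R | Q a) <<a, co g>> = 0.
  rewrite big_mkcond; pose f a := if Q a then <<a, co g>> else 0; set S := LHS.
  suff : S = - S by move=> ?; lia.
  rewrite {1}/S -[LHS](sum_refl f gR) -sumrN big_seq [RHS]big_seq; apply: eq_bigr => a aR.
  rewrite /f.
  rewrite Qr //; case: ifP => _; rewrite ?oppr0 //.
  by rewrite pair_refl /corefl rd_pair2 // pairBr pairMzr; ring.
rewrite pair_suml big_mkcond (big_fsetD1 g) //= rpos_simple // rd_pair2 //.
rewrite -[RHS]addr0; congr (_ + _); rewrite -[RHS]s0.
rewrite [RHS]big_mkcond [RHS](big_fsetD1 g) //= {1}/Q eqxx andbF add0r.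
apply: eq_big_seq => a; rewrite in_fsetD1 => /andP [ag _].
by rewrite /Q ag andbT.
Qed.

Fact wref_subproof (a : X) : a \in R -> is_weyl (refl a).
Proof. by move=> aR; exact: (is_weylM aR (is_weyl1 D)). Qed.

(** Total in [a], so that it can be written without a proof of membership; off the roots the value
    is a default. *)
Definition wref (a : X) : weyl D :=
  if pselect (a \in R) is left aR then mk_weyl (wref_subproof aR) else 1%g.

Lemma wrefE (a x : X) : a \in R -> wref a x = refl a x.
Proof. by rewrite /wref; case: pselect. Qed.

Lemma coroot_refl (a b : X) : a \in R -> b \in R -> co (refl a b) = corefl a (co b).
Proof.
move=> aR bR; apply: pair_injr => x.
by rewrite -[x in LHS](reflK aR) -pair_refl -!(wrefE _ aR) weyl_coroot.
Qed.

Lemma corefl_self (a : X) : a \in R -> corefl a (co a) = - co a.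
Proof. by move=> aR; rewrite /corefl rd_pair2 // -pmulrn mulr2n opprD addrA subrr sub0r. Qed.

Lemma corootN (a : X) : a \in R -> co (- a) = - co a.
Proof. by move=> aR; rewrite -corefl_self // -coroot_refl // refl_self. Qed.

(** The cone behind the dominance order, with coefficients indexed by simple roots instead of their
    coroots; see [dominance_leP]. *)
Definition cspan (y : Y) : Prop :=
  exists c : X -> int, (forall b, 0 <= c b) /\ y = \sum_(b <- F0) co b *~ c b.

Lemma cspanD y y' : cspan y -> cspan y' -> cspan (y + y').
Proof.
move=> [c [c0 ->]] [d [d0 ->]]; exists (fun b => c b + d b); split=> [b|].
  exact: addr_ge0.
by under [RHS]eq_bigr => b _ do rewrite mulrzDr; rewrite big_split.
Qed.

Lemma cspanMz y (n : int) : 0 <= n -> cspan y -> cspan (y *~ n).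
Proof.
move=> n0 [c [c0 ->]]; exists (fun b => c b * n); split=> [b|].
  exact: mulr_ge0.
by rewrite mulrz_suml; apply: eq_bigr => b _; rewrite mulrzA.
Qed.

Lemma cspan_simple a : a \in F0 -> cspan (co a).
Proof.
move=> aF; exists (fun b => (b == a)%:R); split=> [b|]; first by case: eqP.
rewrite (big_fsetD1 a) //= eqxx mulr1z [X in _ + X]big1_fset ?addr0 // => b.
by rewrite in_fsetD1 => /andP [/negPf ->].
Qed.

Lemma pair_sign (a b : X) : a \in R -> b \in R -> (0 < <<a, co b>>) = (0 < <<b, co a>>).
Proof.
move=> aR bR; have h1 := xform_coroot a bR; have h2 := xform_coroot b aR.
rewrite -(pmulr_lgt0 _ (xform_gt0 bR)) h1 xformC -h2.
by rewrite pmulr_lgt0 // xform_gt0.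
Qed.

(** Induction on the height of [a]. Since [xform a a] is positive, some simple [b] has positive form
    with [a]; then [refl b a] has smaller height, and its coroot differs from that of [a] by a
    positive multiple of the coroot of [b]. *)
Lemma cspan_rpos (a : X) : a \in R -> rpos a -> cspan (co a).
Proof.
move=> aR /asboolP/nat_spanP [c [c0 aE]].
have [n hn] : exists n : nat, \sum_(b <- F0) c b <= n%:Z.
  by exists `|(\sum_(b <- F0) c b)%R|%N; set S := (\sum_(_ <- _) _)%R; lia.
elim: n a aR c c0 aE hn => [|n IH] a aR c c0 aE hn.
- have /eqP : \sum_(b <- F0) c b = 0.
    by apply/eqP; rewrite eq_le hn sumr_ge0.
  rewrite psumr_eq0 // => /allP z.
  have := root_neq0 aR; rewrite aE big_seq big1 ?eqxx // => b /z /eqP /= ->.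
  by [].
have [b bF cb] : exists2 b, b \in F0 & 0 < c b * xform b a.
  apply: contrapT => h; have := xform_gt0 aR; rewrite {1}aE; apply/negP; rewrite -leNgt.
  have -> : xform (\sum_(b <- F0) b *~ c b) a = \sum_(b <- F0) c b * xform b a.
    rewrite (big_morph (fun x => xform x a) (id1 := 0) (op1 := +%R)).
    - by apply: eq_bigr => b _; rewrite xformMzl mulrC.
    - by move=> x x'; exact: xformDl.
    - by rewrite /xform big1 // => b _; rewrite rd_pair0l mul0r.
  rewrite big_seq sumr_le0 // => b bF; rewrite leNgt; apply/negP => cb.
  by apply: h; exists b.
have bR := simple_root bF.
have xb : 0 < xform b a.
  by have := c0 b; rewrite le_eqVlt => /predU1P [e|cp]; [rewrite -e mul0r in cb|rewrite pmulr_rgt0 in cb].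
have n0 : 0 < <<a, co b>>.
  by rewrite -(pmulr_lgt0 _ (xform_gt0 bR)) xform_coroot // xformC mulr_gt0.
have m0 : 0 < <<b, co a>> by rewrite pair_sign.
have [->|ab] := eqVneq a b; first exact: cspan_simple.
have pa : rpos a by apply/asboolP/nat_spanP; exists c.
have /asboolP/nat_spanP [d [d0 dE]] := rpos_refl bF aR pa ab.
have cd : {in F0, forall e, c e - (e == b)%:R * <<a, co b>> = d e}.
  by apply: simple_uniq; rewrite sum_simple_delta // -aE -dE.
have := IH _ (refl_root bR aR) d d0 dE.
rewrite coroot_refl // /corefl => /(_ _) h.
rewrite -[co a](subrK (co b *~ <<b, co a>>)); apply: cspanD.
  apply: h; rewrite -(eq_big_seq _ cd) sumrB.
  rewrite [X in _ - X](big_fsetD1 b) //= eqxx mul1r.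
  rewrite [X in _ - (_ + X)]big1_fset ?addr0.
    by move: hn n0; rewrite -addn1 PoszD; set S := \sum_(_ <- _) _; set m := <<_, _>>; lia.
  by move=> e; rewrite in_fsetD1 => /andP [/negPf -> _] _; rewrite mul0r.
by apply: cspanMz; [exact: ltW | exact: cspan_simple].
Qed.

Lemma cspan_rho2 y : cspan y -> 0 <= <<rho2, y>>.
Proof.
move=> [c [c0 ->]]; rewrite pair_sumr big_seq; apply: sumr_ge0 => b bF.
by rewrite pairMzr rho2_simple // mulr_ge0.
Qed.

Lemma rho2_gt0 (a : X) : a \in R -> rpos a -> 0 < <<rho2, co a>>.
Proof.
move=> aR pa; have cs := cspan_rpos aR pa; rewrite lt_neqAle cspan_rho2 // andbT.
apply/eqP => e; have := rd_pair2 aR; move: cs e => [c [c0 ->]].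
rewrite pair_sumr big_seq => /esym/eqP; rewrite psumr_eq0; last first.
  by move=> b bF; rewrite pairMzr rho2_simple // mulr_ge0.
move=> /allP z; rewrite pair_sumr big_seq big1 // => b bF.
have := z b bF; rewrite bF /= pairMzr rho2_simple // mulf_eq0 /= => /eqP ->.
by rewrite mulr0z pair0r.
Qed.

(** Turns positivity of a root into a linear inequality on its coroot, which can be transported by
    the Weyl group and added up. *)
Lemma rposE (a : X) : a \in R -> rpos a = (0 < <<rho2, co a>>).
Proof.
move=> aR; apply/idP/idP; first exact: rho2_gt0.
apply: contraTT; rewrite -rposN // => /(rho2_gt0 (opp_root aR)).
by rewrite corootN // pairNr oppr_gt0 -leNgt => /ltW.
Qed.

Lemma dominance_leP (y y' : Y) : dominance_le y y' <-> cspan (y' - y).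
Proof.
have inj : {in F0 &, injective co}.
  by move=> a b /simple_root aR /simple_root bR; exact: rd_coroot_inj.
rewrite /dominance_le /nat_span; split=> [[c /= ->]|[c [c0 ->]]].
  exists (fun b => (c (co b))%:Z); split=> //.
  by rewrite big_imfset //=; apply: eq_bigr => b _.
exists (fun y => \sum_(b <- F0 | co b == y) `|c b|%N)%N; rewrite big_imfset //=.
apply: eq_big_seq => b bF; rewrite -[X in _ *~ X](gez0_abs (c0 b)); congr (_ *+ _).
rewrite big_mkcond (big_fsetD1 b) //= eqxx big1_fset ?addn0 // => e.
rewrite in_fsetD1 => /andP [eb eF] _; case: eqP => // /(inj _ _ eF bF) h.
by rewrite h eqxx in eb.
Qed.

Lemma pos_rootP (a : X) : pos_root a <-> a \in R /\ rpos a.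
Proof. by rewrite /pos_root /rpos; split=> -[? /asboolP]. Qed.

End RootCombinatorics.

(** * Affine roots and length *)

Section MinimalCoroot.
Variable D : root_datum.
Local Notation X := (rd_X D).
Local Notation Y := (rd_Y D).
Local Notation R := (rd_roots D).
Local Notation F0 := (rd_simple D).
Local Notation "<< x , y >>" := (@rd_pair D x y) (at level 0, format "<< x ,  y >>").
Local Notation co := (@rd_coroot D).

Lemma sum_root_delta (a : X) n : a \in R -> \sum_(b <- R) b *~ ((b == a)%:R * n) = a *~ n.
Proof.
move=> aR; rewrite (big_fsetD1 a) //= eqxx mul1r [X in _ + X]big1_fset ?addr0 // => b.
by rewrite in_fsetD1 => /andP [/negPf -> _] _; rewrite mul0r mulr0z.
Qed.

Lemma xform_eq0 (x : X) : xform x x = 0 -> forall a, a \in R -> <<x, co a>> = 0.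
Proof.
move=> /eqP; rewrite psumr_eq0 => [/allP h a aR|a _]; last by rewrite -expr2 sqr_ge0.
by have := h a aR; rewrite /= -expr2 sqrf_eq0 => /eqP.
Qed.

(** Strict Cauchy-Schwarz for non-proportional roots. The vector [v] is the multiple by [xform a a]
    of the component of [b] orthogonal to [a]; it is not isotropic, since otherwise it would vanish
    and contradict reducedness. *)
Lemma pair_prod_le3 (a b : X) : a \in R -> b \in R -> b != a -> b != - a ->
  <<a, co b>> * <<b, co a>> <= 3.
Proof.
move=> aR bR ba bna.
have h1 := xform_coroot a bR; have h2 := xform_coroot b aR.
have A0 := xform_gt0 aR; have B0 := xform_gt0 bR.
pose v := b *~ xform a a - a *~ xform b a.
have vv : xform v v = xform a a * (xform a a * xform b b - xform b a ^+ 2).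
  rewrite /v !(xformDl, xformNl, xformMzl) !(xformC _ (_ - _)).
  by rewrite !(xformDl, xformNl, xformMzl) (xformC a b); ring.
have v0 : xform v v != 0.
  apply/eqP => /xform_eq0 h.
  have vE : v = \sum_(e <- R) e *~ ((e == b)%:R * xform a a - (e == a)%:R * xform b a).
    under eq_bigr => e _ do rewrite mulrzBr.
    by rewrite sumrB !sum_root_delta.
  have /eqP := root_span_rad vE h; rewrite subr_eq0 => /eqP e.
  by case: (rd_reduced aR bR _ e) ba bna => [|->|->]; rewrite ?eqxx // gt_eqF.
have {}v0 : 0 < xform v v by rewrite lt_neqAle eq_sym v0 xform_ge0.
rewrite vv pmulr_rgt0 // in v0; rewrite xformC in h1.
move: h1 h2 A0 B0 v0; set p := <<a, _>>; set k := <<b, _>>.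
set A := xform a a; set B := xform b b; set c := xform b a => h1 h2 A0 B0 v0.
have AB : 0 < A * B by exact: mulr_gt0.
have e : (p * k) * (A * B) = 4 * c ^+ 2.
  have -> : (p * k) * (A * B) = (p * B) * (k * A) by ring.
  by rewrite h1 h2; ring.
have : (p * k) * (A * B) < 4 * (A * B) by rewrite e; lia.
by rewrite ltr_pM2r // => ?; lia.
Qed.

Variable a : X.
Hypothesis mina : minimal_coroot a.
Let aR : a \in R. Proof. by case: mina. Qed.

Lemma minimal_uniq b : b \in R -> cspan (co a - co b) -> b = a.
Proof.
by move=> bR /dominance_leP h; apply: rd_coroot_inj => //; case: mina => _; apply.
Qed.

(** A positive pairing would make the coroot of [refl b a] strictly smaller than that of [a] in the
    dominance order. *)
Lemma minimal_le0 b : b \in R -> rpos b -> <<a, co b>> <= 0.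
Proof.
move=> bR pb; rewrite leNgt; apply/negP; rewrite pair_sign // => n0.
have e : co (refl b a) = co a - co b *~ <<b, co a>> by rewrite coroot_refl.
have /minimal_uniq h : cspan (co a - co (refl b a)).
  by rewrite e opprB addrC subrK; apply: cspanMz; [exact: ltW | exact: cspan_rpos].
have := h (refl_root bR aR) => {}h; have : <<b, co a>> *+ 2 = 0.
  have := congr1 (rd_pair b) e; rewrite h pairBr pairMzr rd_pair2 //.
  by set n := <<_, _>>; lia.
by move: n0; set n := <<_, _>>; lia.
Qed.

Lemma minimal_rneg : ~~ rpos a.
Proof. by apply/negP => /(minimal_le0 aR); rewrite rd_pair2. Qed.

(** If [e] were negative, the sum of the coroots of [a] and [b] would be a positive coroot, so the
    coroot of [- b] would lie below that of [a], forcing [- b = a]. *)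
Lemma minimal_diff_pos b e : b \in R -> b != - a -> e \in R ->
  co e = - co a - co b -> rpos e.
Proof.
move=> bR ba eR ee; apply: contraT; rewrite -rposN // => /(cspan_rpos (opp_root eR)).
rewrite corootN // ee opprB opprK addrC -[X in _ + X]opprK -corootN //.
move=> /(minimal_uniq (opp_root bR)) h.
by rewrite -h opprK eqxx in ba.
Qed.

(** With [minimal_le0] this says that the affine simple reflection changes the level of an affine
    root by at most one, apart from those over [a] and [- a]. A pairing of at most -2 forces the
    opposite pairing to be -1; the coroot of [refl a b] then lies strictly below that of [a],
    against minimality. *)
Lemma minimal_ge_m1 b : b \in R -> rpos b -> b != - a -> - 1 <= <<a, co b>>.
Proof.
move=> bR pb ba; rewrite leNgt; apply/negP => m2.
have ab : b != a by apply: contraNneq minimal_rneg => <-.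
have := pair_prod_le3 aR bR ab ba.
set m := <<a, _>> in m2 *; have := pair_sign aR (opp_root bR).
rewrite corootN // pairNr rd_pairNl -/m !oppr_gt0; set k := <<b, _>> => sg mk.
have k1 : k = - 1.
  have k0 : k < 0 by rewrite -sg; lia.
  by nia.
have e1 : co (refl b (- a)) = - co a - co b.
  by rewrite coroot_refl ?opp_root // corootN // /corefl pairNr -/k k1 opprK.
have p1 := minimal_diff_pos bR ba (refl_root bR (opp_root aR)) e1.
have r1 := rho2_gt0 (refl_root bR (opp_root aR)) p1; rewrite e1 in r1.
have e2 : co (refl a b) = co b - co a *~ m by rewrite coroot_refl.
have pna : rpos (- a) by rewrite rposN // minimal_rneg.
have e3 : co a - co (refl a b) = co (- a) *~ (- m - 2) + co (refl b (- a)).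
  rewrite e1 e2 corootN //; apply: pair_injr => x.
  by rewrite !(rd_pairDr, pairMzr, pairNr); ring.
have m0 : 0 <= - m - 2 by lia.
have : cspan (co a - co (refl a b)).
  rewrite e3; apply: cspanD; last by apply: cspan_rpos => //; rewrite refl_root ?opp_root.
  by apply: cspanMz => //; apply: cspan_rpos; rewrite ?opp_root.
move=> /(minimal_uniq (refl_root aR bR)) h; have := congr1 (rd_pair (rho2 D)) e3.
rewrite h subrr pair0r rd_pairDr pairMzr e1 => /esym/eqP.
have r2 := rho2_gt0 (opp_root aR) pna.
by rewrite gt_eqF // ltr_wpDl // mulr_ge0 // ltW.
Qed.

End MinimalCoroot.

Section AffineRoots.
Variable D : root_datum.
Local Notation X := (rd_X D).
Local Notation Y := (rd_Y D).
Local Notation R := (rd_roots D).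
Local Notation F0 := (rd_simple D).
Local Notation "<< x , y >>" := (@rd_pair D x y) (at level 0, format "<< x ,  y >>").
Local Notation co := (@rd_coroot D).
Local Notation W := (affweyl D).

(* The affine root [(b^vee, k)] is encoded by the pair [(b, k)]. *)
Local Notation aroot := (X * int)%type.
Implicit Types (v w : W) (b c : aroot).

Definition is_aroot (b : aroot) : bool := b.1 \in R.

Definition apos (b : aroot) : bool := (0 < b.2) || ((b.2 == 0) && rpos b.1).

Definition aopp (b : aroot) : aroot := (- b.1, - b.2).

(** Coordinates of [fun_act] on affine roots, as [fun_act_aff] shows; they are meaningful only at
    affine roots, [rd_coroot] being arbitrary elsewhere. *)
Definition aact (w : W) (b : aroot) : aroot :=
  (aw_lin w b.1, b.2 - <<aw_trans w, co (aw_lin w b.1)>>).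

Lemma aact_root w b : is_aroot (aact w b) = is_aroot b.
Proof. exact: weyl_root. Qed.

Lemma aopp_root b : is_aroot (aopp b) = is_aroot b.
Proof. exact: opp_rootE. Qed.

Lemma aoppK : involutive aopp.
Proof. by case=> a k; rewrite /aopp /= !opprK. Qed.

Lemma apos_opp b : is_aroot b -> apos (aopp b) = ~~ apos b.
Proof.
case: b => a k aR; rewrite /apos /= rposN // oppr_eq0 oppr_gt0.
by case: (ltrgtP k 0).
Qed.

Lemma aact_mul v w b : is_aroot b -> aact (v * w)%g b = aact v (aact w b).
Proof.
case: b => a k aR; congr pair => /=.
change (aw_trans (v * w)%g) with (aw_trans v + aw_lin v (aw_trans w)).
change (aw_lin (v * w)%g a) with (aw_lin v (aw_lin w a)).
by rewrite rd_pairDl weyl_coroot ?weyl_root //; ring.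
Qed.

Lemma aact1 b : aact 1%g b = b.
Proof. by case: b => a k; rewrite /aact /= rd_pair0l subr0. Qed.

Lemma aact_opp w b : is_aroot b -> aact w (aopp b) = aopp (aact w b).
Proof.
case: b => a k aR; rewrite /aact /aopp /= weylN corootN ?weyl_root // pairNr.
by congr pair; ring.
Qed.

Lemma aactK w b : is_aroot b -> aact w^-1%g (aact w b) = b.
Proof. by move=> bR; rewrite -aact_mul // mulVg aact1. Qed.

Lemma aactKV w b : is_aroot b -> aact w (aact w^-1%g b) = b.
Proof. by move=> bR; rewrite -aact_mul // mulgV aact1. Qed.

Definition invs (w : W) : set aroot := [set b | is_aroot b /\ apos b /\ ~~ apos (aact w b)].

Lemma invs_finite w : finite_set (invs w).
Proof.
(* An inversion has level between 0 and the pairing that [w] subtracts from it, and [M] dominates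
   all these pairings. *)
pose M : nat := (\sum_(a <- R) `|<<aw_trans w, co (aw_lin w a)>>|)%N.
apply: (@sub_finite_set _ _ ((fun p : X * nat => (p.1, p.2%:Z)) @`
    ([set` R] `*` `I_M.+1))); last first.
  by apply: finite_image; apply: finite_setX => //; exact: finite_fset.
move=> [a k] [aR [pb nb]]; rewrite /is_aroot /= in aR.
exists (a, `|k|%N) => /=; last first.
  by rewrite gez0_abs //; move: pb; rewrite /apos /= => /orP [/ltW|/andP [/eqP ->]].
split=> //=.
have h : (`|<<aw_trans w, co (aw_lin w a)>>| <= M)%N.
  by rewrite /M (big_fsetD1 a) //= leq_addr.
move: pb nb h; rewrite /apos /=; set n := <<_, _>>; set m := M.
by move=> /orP [h1|/andP [/eqP h1 _]] /norP [h2 _] h3; lia.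
Qed.

Lemma aff_eval_inj : injective (@aff_eval D).
Proof.
move=> [y k] [y' k'] e; have e0 z : <<z, y>> + k = <<z, y'>> + k'.
  by have := congr1 (fun f : X -> int => f z) e.
have ek : k = k' by have := e0 0; rewrite !rd_pair0l !add0r.
by congr pair => //; apply: pair_injr => z; apply: (addIr k); rewrite e0 ek.
Qed.

Lemma fun_act_aff (w : W) b : is_aroot b ->
  fun_act w (aff_eval (co b.1, b.2)) = aff_eval (co (aact w b).1, (aact w b).2).
Proof.
case: b => a k aR; apply/funext => z; rewrite /fun_act /aff_eval /aw_act /=.
set v := weyl_fun _; rewrite -[in LHS](weyl_coroot (aw_lin w)) // weylD weylN.
have vK u : aw_lin w (v u) = u by exact: (weyl_invK (aw_lin w)).2.
by rewrite !vK pairBl; ring.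
Qed.

Lemma len_invs w : len w = #|` fset_set (invs w)|.
Proof.
pose g (b : aroot) : Y * int := (co b.1, b.2).
have ginj : {in invs w &, injective g}.
  move=> [a k] [a' k'] /set_mem [/= aR _] /set_mem [/= aR' _] [e ->].
  by congr pair; apply: rd_coroot_inj.
rewrite /len; have -> : [set a | aff_pos a /\ exists2 b, aff_neg b &
    fun_act w (aff_eval a) = aff_eval b] = g @` invs w.
  apply/seteqP; split.
    move=> [y k] [[a aR [/= -> h]] [[y' k'] [_ np] e]].
    have e2 := fun_act_aff w (b := (a, k)) aR; rewrite /= in e2.
    rewrite e in e2; have e3 := aff_eval_inj e2.
    exists (a, k) => //; split=> //; split.
      by rewrite /apos /=; case: h => [->|[-> /pos_rootP [_ ->]]]; rewrite ?eqxx ?orbT.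
    apply/negP => pb; apply: np; rewrite e3; exists (aact w (a, k)).1.
      by have := aact_root w (a, k); rewrite /is_aroot /= => ->.
    split=> //; move/orP: pb => [h0|/andP [/eqP h0 pr]]; [by left|right].
    split=> //; apply/pos_rootP; split=> //.
    by have := aact_root w (a, k); rewrite /is_aroot /= => ->.
  move=> _ [[a k] [aR [pb nb]] <-]; have bR : (aact w (a, k)).1 \in R.
    by have := aact_root w (a, k); rewrite /is_aroot => ->.
  split.
    exists a => //; split=> //=; move/orP: pb => /= [->|/andP [/eqP -> pr]]; [by left|right].
    by split=> //; apply/pos_rootP.
  exists (g (aact w (a, k))); last exact: fun_act_aff.
  split; first by exists (aact w (a, k)).1.
  move=> [c cR [e h]]; move/negP: nb; apply.
  have {}e : (aact w (a, k)).1 = c by apply: rd_coroot_inj.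
  rewrite /apos e; case: h => [/= ->|[/= h0 /pos_rootP [_ ->]]] //.
  by apply/orP; right; rewrite andbT; apply/eqP.
have fi := invs_finite w.
rewrite fset_set_image //; apply: card_in_imfset.
by move=> x y; rewrite !in_fset_set // => hx hy; apply: ginj.
Qed.

(** Each such root is counted once in the length of [v], once in that of [w], and not in that of
    [v * w]; hence the factor 2 in [len_mul]. *)
Definition cancelled (v w : W) : set aroot :=
  [set b | is_aroot b /\ apos b /\ ~~ apos (aact w b) /\ apos (aact (v * w)%g b)].

Lemma card_fset_setU (T : choiceType) (A B : set T) :
  finite_set A -> finite_set B -> A `&` B = set0 ->
  #|` fset_set (A `|` B)| = (#|` fset_set A| + #|` fset_set B|)%N.
Proof.
by move=> fA fB d; rewrite fset_setU // cardfsU -fset_setI // d fset_set0 cardfs0 subn0.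
Qed.

(** Positive roots are sorted by the signs of their images under [w] and [v * w]. Inversions of
    [v * w] are A and B, those of [w] are B and C, and those of [v] correspond to A and C. *)
Lemma len_mul (v w : W) :
  (len v + len w = len (v * w)%g + 2 * #|` fset_set (cancelled v w)|)%N.
Proof.
pose A := [set b : aroot | is_aroot b /\ apos b /\ apos (aact w b) /\ ~~ apos (aact (v * w)%g b)].
pose B := [set b : aroot | is_aroot b /\ apos b /\ ~~ apos (aact w b) /\ ~~ apos (aact (v * w)%g b)].
pose C := cancelled v w.
have fA : finite_set A.
  by apply: sub_finite_set (invs_finite (v * w)%g) => b [? [? [? ?]]].
have fB : finite_set B by apply: sub_finite_set (invs_finite w) => b [? [? [? ?]]].
have fC : finite_set C by apply: sub_finite_set (invs_finite w) => b [? [? [? ?]]].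
have e1 : invs (v * w)%g = A `|` B.
  apply/seteqP; split=> b; last by case=> -[? [? [? ?]]].
  by move=> [? [? ?]]; case: (boolP (apos (aact w b))) => h; [left|right].
have e2 : invs w = B `|` C.
  apply/seteqP; split=> b; last by case=> -[? [? [? ?]]].
  by move=> [? [? ?]]; case: (boolP (apos (aact (v * w)%g b))) => h; [right|left].
(* The image under [w], with its sign corrected, is the inversion of [v] belonging to a root of A or
   C. *)
pose g b := if apos (aact w b) then aact w b else aopp (aact w b).
have e3 : invs v = g @` (A `|` C).
  apply/seteqP; split=> c.
    move=> [cR [pc nc]]; pose b := aact w^-1%g c.
    have bR : is_aroot b by rewrite /b aact_root.
    have wb : aact w b = c by exact: aactKV.
    have vwb : aact (v * w)%g b = aact v c by rewrite aact_mul // wb.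
    case: (boolP (apos b)) => pb.
      by exists b; [left; do ![split => //]; rewrite ?wb ?vwb|rewrite /g wb pc].
    exists (aopp b).
      right; split; rewrite ?aopp_root //; split; rewrite ?apos_opp //.
      rewrite !aact_opp // wb vwb !apos_opp ?aact_root // pc; split=> //.
    by rewrite /g aact_opp // wb apos_opp // pc aoppK.
  move=> [b bAC <-].
  have bR : is_aroot b by case: bAC => -[].
  have e := aact_mul v w bR.
  case: bAC => -[_ [pb [wb vwb]]]; rewrite /g.
    by rewrite wb; split; rewrite ?aact_root // -e.
  rewrite (negPf wb); split; rewrite ?aopp_root ?aact_root //.
  by rewrite apos_opp ?aact_root // aact_opp ?aact_root // apos_opp ?aact_root // -e vwb.
have ginj : {in A `|` C &, injective g}.
  move=> b c /set_mem bh /set_mem ch.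
  have bR : is_aroot b by case: bh => -[].
  have cR : is_aroot c by case: ch => -[].
  have pb : apos b by case: bh => -[_ []].
  have pc : apos c by case: ch => -[_ []].
  have inj : forall b' c', is_aroot b' -> is_aroot c' -> aact w b' = aact w c' -> b' = c'.
    by move=> b' c' bR' cR' h; rewrite -(aactK w bR') h aactK.
  rewrite /g; case: ifP => wb; case: ifP => wc; first exact: inj.
  - rewrite -aact_opp // => /inj; rewrite aopp_root => /(_ bR cR) h.
    by move: pb; rewrite h apos_opp // pc.
  - rewrite -aact_opp // => /inj; rewrite aopp_root => /(_ bR cR) h.
    by move: pc; rewrite -h apos_opp // pb.
  - by move/(can_inj aoppK); exact: inj.
rewrite !len_invs e1 e2 e3 -/C fset_set_image; last by rewrite finite_setU.
rewrite card_in_imfset; last first.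
  by move=> x y; rewrite !in_fset_set ?finite_setU // => hx hy; apply: ginj.
rewrite !card_fset_setU //; first by lia.
all: apply/seteqP; split=> // b [[_ [_ [+ +]]] [_ [_ [+ +]]]].
all: by case: (apos (aact w b)); case: (apos (aact (v * w)%g b)).
Qed.

Lemma len_add (v w : W) :
  (forall b, is_aroot b -> apos b -> ~~ apos (aact w b) -> ~~ apos (aact (v * w)%g b)) ->
  len (v * w)%g = (len v + len w)%N.
Proof.
move=> h; rewrite len_mul (_ : cancelled v w = set0) ?fset_set0 ?cardfs0 ?addn0 //.
by apply/seteqP; split=> // b [bR [pb [wb]]]; apply/negP; exact: h.
Qed.

Lemma len1 : len (1 : W)%g = 0%N.
Proof.
rewrite len_invs (_ : invs _ = set0) ?fset_set0 ?cardfs0 //.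
by apply/seteqP; split=> // b [_ [pb]]; rewrite aact1 pb.
Qed.

Lemma lenV w : len w^-1%g = len w.
Proof.
have := len_mul w^-1%g w; rewrite mulVg len1 (_ : cancelled _ _ = invs w).
  by rewrite -len_invs; lia.
apply/seteqP; split=> b [bR [pb h]]; split=> //; split=> //; first by case: h.
by rewrite mulVg aact1.
Qed.

Lemma invs0 w b : len w = 0%N -> is_aroot b -> apos b -> apos (aact w b).
Proof.
move=> w0 bR pb; apply: contraT => nb.
have : b \in fset_set (invs w) by rewrite in_fset_set ?inE //; exact: invs_finite.
by move/eqP: w0; rewrite len_invs cardfs_eq0 => /eqP ->; rewrite in_fset0.
Qed.

Definition aref (b : aroot) : W := AffWeyl (wref b.1) (- (b.1 *~ b.2)).

Lemma aact_aref b c : is_aroot b -> is_aroot c ->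
  aact (aref b) c = (refl b.1 c.1, c.2 - b.2 * <<b.1, co c.1>>).
Proof.
move=> bR cR; rewrite /aact /= wrefE //; congr pair.
rewrite coroot_refl // rd_pairNl rd_pairMzl -pair_refl refl_self // rd_pairNl.
by ring.
Qed.

Lemma affweyl_ext (v w : W) : aw_act v =1 aw_act w -> v = w.
Proof.
case: v w => [v x] [w y] e.
have exy : x = y by have := e 0; rewrite /aw_act /= !weyl0 !add0r.
rewrite exy; congr AffWeyl; apply: weyl_ext => z.
by have := e z; rewrite /aw_act /= exy => /addIr.
Qed.

Lemma aw_act_mul (v w : W) x : aw_act (v * w)%g x = aw_act v (aw_act w x).
Proof.
rewrite /aw_act weylD.
change (aw_lin v (aw_lin w x) + (aw_trans v + aw_lin v (aw_trans w)) =
  aw_lin v (aw_lin w x) + aw_lin v (aw_trans w) + aw_trans v).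
by rewrite -addrA [aw_trans v + _]addrC.
Qed.

Lemma aw_act1 x : aw_act (1 : W)%g x = x.
Proof. by rewrite /aw_act addr0. Qed.

Lemma aw_act_aref b x : is_aroot b -> aw_act (aref b) x = x - b.1 *~ (<<x, co b.1>> + b.2).
Proof. by move=> bR; rewrite /aw_act /= wrefE // /refl mulrzDr opprD addrA. Qed.

Lemma aref_mul b : is_aroot b -> (aref b * aref b)%g = 1%g.
Proof.
move=> bR; apply: affweyl_ext => x; rewrite aw_act_mul aw_act1 !aw_act_aref //.
rewrite pairBl rd_pairMzl rd_pair2 //; set n := <<_, _>>.
rewrite -[RHS]subr0 -[X in _ = _ - X](mulr0z b.1) -addrA -opprD -mulrzDr.
by congr (_ - _ *~ _); ring.
Qed.

Lemma arefV b : is_aroot b -> (aref b)^-1%g = aref b.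
Proof.
move=> bR; rewrite -[RHS]mul1g -(mulVg (aref b)) -mulgA aref_mul //.
by rewrite mulg1.
Qed.

Lemma aref_self b : is_aroot b -> aact (aref b) b = aopp b.
Proof.
move=> bR; rewrite aact_aref // refl_self // rd_pair2 //.
by congr pair; ring.
Qed.

Lemma aref_conj w b : is_aroot b -> aref (aact w b) = (w * aref b * w^-1)%g.
Proof.
move=> bR; apply: affweyl_ext => x; rewrite !aw_act_mul.
have [z ->] : exists z, x = aw_act w z.
  by exists (aw_act w^-1%g x); rewrite -aw_act_mul mulgV aw_act1.
rewrite -(aw_act_mul w^-1%g w) mulVg aw_act1 !aw_act_aref ?aact_root //.
rewrite /aw_act /= weylB.
have e n : aw_lin w (b.1 *~ n) = aw_lin w b.1 *~ n.
  pose f := weyl_fun (aw_lin w).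
  have fB : zmod_morphism f by move=> u u'; exact: weylB.
  pose M := GRing.isZmodMorphism.Build _ _ f fB.
  pose F : {additive X -> X} := HB.pack f M.
  exact: (raddfMz F).
rewrite e rd_pairDl weyl_coroot //.
have -> : <<z, co b.1>> + <<aw_trans w, co (aw_lin w b.1)>> +
  (b.2 - <<aw_trans w, co (aw_lin w b.1)>>) = <<z, co b.1>> + b.2 by ring.
by rewrite addrAC.
Qed.

Definition asimple b : Prop := simple_aff b.1 b.2.

Lemma SaffP s : Saff s <-> exists2 b, asimple b & s = aref b.
Proof.
have rt b : asimple b -> is_aroot b.
  by case=> [[/simple_root]|[[]]].
split=> [[a [k [sa h]]]|[b sb ->]].
  exists (a, k) => //; apply: affweyl_ext => x.
  by rewrite h aw_act_aref //; exact: (rt (a, k)).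
by exists b.1, b.2; split=> // x; rewrite aw_act_aref //; exact: rt.
Qed.

Lemma asimple_root b : asimple b -> is_aroot b.
Proof. by case=> [[/simple_root]|[[]]]. Qed.

Lemma asimple_pos b : asimple b -> apos b.
Proof.
by case=> [[/rpos_simple h e]|[_ e]]; rewrite /apos e // h eqxx orbT.
Qed.

Lemma pair_eq0C (a a' : X) : a \in R -> a' \in R -> <<a, co a'>> = 0 -> <<a', co a>> = 0.
Proof.
move=> aR a'R h; have := xform_coroot a a'R; rewrite h mul0r => /esym/eqP.
rewrite mulf_eq0 /= => /eqP e; have /eqP := xform_coroot a' aR.
by rewrite xformC e mulr0 mulf_eq0 (gt_eqF (xform_gt0 aR)) orbF => /eqP.
Qed.

(** For a finite simple root this is [rpos_refl]. For [(a, 1)] with minimal coroot, the level drops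
    by at most one except over [a], so a positive level can fail to stay positive only by reaching
    0, where the finite part has to be checked. *)
Lemma asimple_perm b c : asimple b -> is_aroot c -> apos c -> c != b ->
  apos (aact (aref b) c).
Proof.
move=> sb cR pc cb; have bR := asimple_root sb; rewrite aact_aref //.
case: b c sb cR pc cb bR => [a k] [d m] sb dR pc cb aR; rewrite /is_aroot /= in dR aR.
case: sb => /= -[].
  move=> aF k0; move: pc; rewrite /apos /= k0 mul0r subr0.
  case/orP => [->//|/andP [/eqP m0 pd]].
  rewrite rpos_refl ?m0 ?eqxx ?orbT //; apply: contraNneq cb => ->.
  by rewrite k0 m0.
move=> mina k1; move: pc; rewrite /apos /= k1 mul1r; set n := <<a, co d>>.
have [pd|nd] := boolP (rpos d).
  have n0 : n <= 0 by exact: minimal_le0.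
  rewrite andbT => pc; have m0 : 0 <= m by case/orP: pc => [/ltW|/eqP ->].
  have [//|mn] := ltP 0 (m - n).
  have n00 : n = 0 by lia.
  rewrite /refl (pair_eq0C aR dR n00) mulr0z subr0 pd andbT.
  by apply/eqP; lia.
rewrite andbF orbF => m0.
(* Over [a] itself the level drops by 2. As level 1 is excluded it was at least 2, and at level 2
   the image [(- a, 0)] is positive because [a] is negative. *)
have [e|da] := eqVneq d a.
  have n2 : n = 2 by rewrite /n e rd_pair2.
  have m1 : m != 1 by apply: contraNneq cb => ->; rewrite e k1.
  rewrite e refl_self // rposN // minimal_rneg // andbT n2.
  by have [/eqP ->|m2] := boolP (m == 2); [rewrite subrr eqxx orbT|apply/orP; left; lia].
have pd : rpos (- d) by rewrite rposN.
have dna : - d != - a by apply: contraNneq da => /oppr_inj ->.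
have := minimal_ge_m1 mina (opp_root dR) pd dna.
rewrite corootN // pairNr -/n => n1.
have [//|mn] := ltP 0 (m - n).
have n11 : n = 1 by lia.
have m11 : m = 1 by lia.
rewrite n11 m11 subrr eqxx /=.
apply: (minimal_diff_pos mina (opp_root dR) dna (refl_root aR dR)).
by rewrite coroot_refl // /corefl -/n n11 mulr1z corootN // opprK addrC.
Qed.

Lemma invs_aref b : asimple b -> invs (aref b) = [set b].
Proof.
move=> sb; have bR := asimple_root sb; have pb := asimple_pos sb.
apply/seteqP; split=> c /=.
  move=> [cR [pc nc]]; apply/eqP; apply: contraNT nc; exact: asimple_perm.
by move=> ->; split=> //; split=> //; rewrite aref_self // apos_opp // pb.
Qed.

Lemma len_aref b : asimple b -> len (aref b) = 1%N.
Proof. by move=> sb; rewrite len_invs invs_aref // fset_set1 cardfs1. Qed.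

(** Only [b] can be cancelled, as [aref b] has no other inversion. *)
Lemma len_simple w b : asimple b ->
  if apos (aact w b) then len (w * aref b)%g = (len w).+1
  else len w = (len (w * aref b)%g).+1.
Proof.
move=> sb; have bR := asimple_root sb; have pb := asimple_pos sb.
have := len_mul w (aref b); rewrite len_aref //.
have sub c : cancelled w (aref b) c -> c = b.
  by move=> [cR [pc [nc _]]]; have : invs (aref b) c by []; rewrite invs_aref.
have wsb : aact (w * aref b)%g b = aopp (aact w b).
  by rewrite aact_mul // aref_self // aact_opp.
case: ifP => wb.
  rewrite (_ : cancelled _ _ = set0) ?fset_set0 ?cardfs0; first by lia.
  apply/seteqP; split=> // c h; have e := sub c h; case: h => _ [_ [_]].
  by rewrite e wsb apos_opp ?aact_root // wb.
rewrite (_ : cancelled _ _ = [set b]) ?fset_set1 ?cardfs1; first by lia.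
apply/seteqP; split=> // c /= ->; split=> //; split=> //.
by rewrite aref_self // apos_opp // pb wsb apos_opp ?aact_root // wb.
Qed.

End AffineRoots.

(** * Induction on the length in the extended affine Weyl group *)

Section LengthInduction.
Variable D : root_datum.
Local Notation X := (rd_X D).
Local Notation Y := (rd_Y D).
Local Notation R := (rd_roots D).
Local Notation F0 := (rd_simple D).
Local Notation "<< x , y >>" := (@rd_pair D x y) (at level 0, format "<< x ,  y >>").
Local Notation co := (@rd_coroot D).
Local Notation W := (affweyl D).
Local Notation aroot := (X * int)%type.
Implicit Types (v w : W) (b c : aroot).

Lemma cspan_rho2_eq0 (y : Y) : cspan y -> <<rho2 D, y>> = 0 -> y = 0.
Proof.
move=> [c [c0 ->]]; rewrite pair_sumr big_seq => /eqP; rewrite psumr_eq0; last first.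
  by move=> b bF; rewrite pairMzr rho2_simple // mulr_ge0.
move=> /allP z; rewrite big_seq big1 // => b bF.
have := z b bF; rewrite bF /= pairMzr rho2_simple // mulf_eq0 /= => /eqP ->.
by rewrite mulr0z.
Qed.

(** Among the coroots below that of [a], take one of least pairing with [rho2]. *)
Lemma minimal_below (a : X) : a \in R ->
  exists2 d, minimal_coroot d & cspan (co a - co d).
Proof.
move=> aR; pose P (i : R) := `[< cspan (co a - co (val i)) >].
have Pa : P [` aR]%fset.
  by apply/asboolP; rewrite subrr; exists (fun=> 0); split=> //; rewrite big1.
case: (Order.TotalTheory.arg_minP (fun i : R => <<rho2 D, co (val i)>>) Pa) => d /asboolP Pd dmin.
exists (val d) => //; split=> [|b bR /dominance_leP h]; first exact: valP.
have e : co a - co b = co a - co (val d) + (co (val d) - co b) by rewrite addrA subrK.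
have := dmin [` bR]%fset; rewrite /P e => /(_ _) h2.
have {}h2 : <<rho2 D, co (val d)>> <= <<rho2 D, co b>>.
  by apply: h2; apply/asboolP; exact: cspanD.
have := cspan_rho2 h; rewrite pairBr => h3.
have /(cspan_rho2_eq0 h)/eqP : <<rho2 D, co (val d) - co b>> = 0 by rewrite pairBr; lia.
by rewrite subr_eq0 => /eqP ->.
Qed.

Lemma weylVK (u : weyl D) x : u (weyl_fun u^-1%g x) = x.
Proof. exact: (weyl_invK u).2. Qed.

Lemma weylKV (u : weyl D) x : weyl_fun u^-1%g (u x) = x.
Proof. exact: (weyl_invK u).1. Qed.

Lemma weyl_pairV (u : weyl D) x a : a \in R -> <<x, co (u a)>> = <<weyl_fun u^-1%g x, co a>>.
Proof.
by move=> aR; rewrite -[in RHS](weyl_coroot u) // weylVK.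
Qed.

(** Positivity of the image of [(b, m)] is lexicographic positivity of two functions that are
    additive in the coroot and [m] ([PE], [PD]). It is thus enough to build positive affine roots as
    sums of simple ones. *)
Lemma asimple_apos w : (forall b, asimple b -> apos (aact w b)) ->
  forall b, is_aroot b -> apos b -> apos (aact w b).
Proof.
move=> hs; set x1 := weyl_fun (aw_lin w)^-1%g (aw_trans w).
set x2 := weyl_fun (aw_lin w)^-1%g (rho2 D).
pose P (y : Y) (m : int) := 0 < m - <<x1, y>> \/ m = <<x1, y>> /\ 0 <= <<x2, y>>.
have PE b : is_aroot b -> apos (aact w b) <-> P (co b.1) b.2.
  case: b => a m aR; have waR : aw_lin w a \in R by rewrite weyl_root.
  rewrite /apos /P /= weyl_pairV // rposE // weyl_pairV // subr_eq0.
  have nz : <<x2, co a>> != 0.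
    rewrite /x2 -weyl_pairV //; have [p|n] := boolP (rpos (aw_lin w a)).
      by rewrite gt_eqF // rho2_gt0.
    rewrite -rposN // in n; have := rho2_gt0 (opp_root waR) n.
    by rewrite corootN // pairNr oppr_gt0 => ?; rewrite lt_eqF.
  split=> [/orP [->|/andP [/eqP -> /ltW ->]]|[->|[-> h]]]; [by left|by right|by []|].
  by apply/orP; right; rewrite eqxx lt_def nz.
have PD y y' m m' : P y m -> P y' m' -> P (y + y') (m + m').
  by rewrite /P !rd_pairDr => -[?|[? ?]] [?|[? ?]]; [left|left|left|right]; lia.
have PM y (n : nat) m : P y m -> P (y *+ n) (m *+ n).
  move=> h; elim: n => [|n IH]; rewrite ?mulr0n ?mulrS; last exact: PD.
  by right; rewrite !pair0r.
have Pcs y : cspan y -> P y 0.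
  move=> [c [c0 ->]]; rewrite big_seq.
  apply: (big_ind (fun y => P y 0)) => [|y1 y2 h1 h2|b bF].
  - by right; rewrite !pair0r.
  - by rewrite -[0]addr0; exact: PD.
  rewrite -(gez0_abs (c0 b)) -pmulrn -[0](mul0rn _ `|c b|); apply: PM.
  have /PE := hs (b, 0) (or_introl (conj bF erefl)); apply.
  exact: simple_root.
have P1 a : a \in R -> P (co a) 1.
  move=> aR; have [d md /Pcs h] := minimal_below aR.
  rewrite -[co a](subrK (co d)) -[1]add0r; apply: PD => //.
  have /PE := hs (d, 1) (or_intror (conj md erefl)); apply.
  by case: md.
move=> [a m] aR pb; apply/PE => //=.
(* The imaginary root, obtained by adding a coroot at level 1 and its opposite at level 0 or 1; it
   raises the level at will. *)
have P01 : P 0 1.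
  (* In either sign the positive one of the two opposite coroots is taken at level 0 and the other
     at level 1. *)
  have [p|n] := boolP (rpos a).
    rewrite -(subrr (co a)) -[1]add0r -corootN //; apply: PD; last exact/P1/opp_root.
    exact/Pcs/cspan_rpos.
  rewrite -(subrr (co a)) -[1]addr0 -corootN //; apply: PD; first exact: P1.
  by apply/Pcs/cspan_rpos; rewrite ?opp_root // rposN.
move: pb => /orP /= [m0|/andP [/eqP -> pa]]; last exact/Pcs/cspan_rpos.
have -> : m = 1 + 1 *+ `|m - 1|%N by rewrite natz; lia.
by rewrite -[co a]addr0 -[X in _ + X](mul0rn _ `|m - 1|%N); apply: PD; [exact: P1|exact: PM].
Qed.

Lemma len_gt0 w : (0 < len w)%N -> exists2 b, asimple b & ~~ apos (aact w b).
Proof.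
move=> l0; apply: contrapT => h.
have /asimple_apos hw : forall b, asimple b -> apos (aact w b).
  by move=> b sb; apply: contraT => nb; case: h; exists b.
move: l0; rewrite len_invs (_ : invs w = set0) ?fset_set0 ?cardfs0 //.
by apply/seteqP; split=> // b [bR [pb]]; rewrite hw.
Qed.

Lemma aref_mulK w b : asimple b -> (w * aref b * aref b)%g = w.
Proof. by move=> /asimple_root bR; rewrite -mulgA aref_mul // mulg1. Qed.

Lemma affweyl_ind (P : W -> Prop) :
  (forall w, len w = 0%N -> P w) ->
  (forall w b, asimple b -> len (w * aref b)%g = (len w).+1 -> P w -> P (w * aref b)%g) ->
  forall w, P w.
Proof.
move=> P0 PS w; move: {2}(len w) (erefl (len w)) => n.
elim: n w => [|n IH] w wn; first exact: P0.
have [|b sb nb] := len_gt0 (w := w); first by rewrite wn.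
have := len_simple w sb; rewrite (negPf nb) => h.
rewrite -(aref_mulK w sb); apply: PS => //; first by rewrite aref_mulK.
by apply: IH; move: h; rewrite wn => -[].
Qed.

(** Induction on the length of [w]: strip a simple right descent [a] and replace [b] by its image
    under [aref a]. Undoing the right multiplication by [aref a] at the end costs at most 1. *)
Lemma len_aref_lt w b : is_aroot b -> apos b -> ~~ apos (aact w b) ->
  (len (w * aref b)%g < len w)%N.
Proof.
move: {2}(len w) (erefl (len w)) => n.
elim: n w b => [|n IH] w b wn bR pb nb; first by rewrite invs0 in nb.
have [|a sa na] := len_gt0 (w := w); first by rewrite wn.
have := len_simple w sa; rewrite (negPf na) => h.
have [<-|ab] := eqVneq a b; first by rewrite h.
have aR := asimple_root sa.
have pb' : apos (aact (aref a) b) by apply: asimple_perm => //; rewrite eq_sym.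
have bR' : is_aroot (aact (aref a) b) by rewrite aact_root.
have := IH (w * aref a)%g _ _ bR' pb'.
rewrite -aact_mul // aref_mulK // => /(_ _ nb) {IH}.
have {h} lw : len (w * aref a)%g = n by move: h; rewrite wn => -[].
rewrite aref_conj // arefV // !mulgA aref_mulK // lw => /(_ erefl) lt.
have := len_simple (w * aref b)%g sa; rewrite wn ltnS; case: ifP => _ e.
  by apply: leq_trans (ltnW lt); rewrite e.
by rewrite e.
Qed.

Lemma len_aref_gt w b : is_aroot b -> apos b -> apos (aact w b) ->
  (len w < len (w * aref b)%g)%N.
Proof.
move=> bR pb wb; have := @len_aref_lt (w * aref b)%g b bR pb.
rewrite -mulgA aref_mul // mulg1; apply.
by rewrite aact_mul // aref_self // aact_opp // apos_opp ?aact_root // wb.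
Qed.

Lemma len0Ml v w : len v = 0%N -> len (v * w)%g = len w.
Proof.
move=> v0; rewrite len_add ?v0 // => b bR pb nb.
rewrite aact_mul //; apply: contraNN nb => h.
rewrite -(aactK v (b := aact w b)) ?aact_root //.
by apply: invs0; rewrite ?lenV ?aact_root.
Qed.

Lemma len0Mr v w : len v = 0%N -> len (w * v)%g = len w.
Proof. by move=> v0; rewrite -lenV invgM len0Ml ?lenV. Qed.

Lemma weyl_simple_rpos (u : weyl D) : (forall a, a \in F0 -> rpos (u a)) ->
  forall a, a \in R -> rpos a -> rpos (u a).
Proof.
move=> hu a aR pa; have uR : u a \in R by rewrite weyl_root.
apply: contraT; rewrite -rposN // => /(rho2_gt0 (opp_root uR)).
rewrite corootN // pairNr oppr_gt0 weyl_pairV //.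
have [c [c0 ->]] := cspan_rpos aR pa.
rewrite ltNge => /negP []; rewrite pair_sumr big_seq; apply: sumr_ge0.
move=> b bF; rewrite pairMzr mulr_ge0 // -weyl_pairV ?simple_root // ltW //.
by apply: rho2_gt0; rewrite ?weyl_root ?simple_root // hu.
Qed.

End LengthInduction.

Local Open Scope complex_scope.

(** * Hecke algebra and trace *)

Lemma conjcM (K : rcfType) (x y : K[i]) : conjc (x * y) = conjc x * conjc y.
Proof. exact: rmorphM. Qed.

Lemma conjcD (K : rcfType) (x y : K[i]) : conjc (x + y) = conjc x + conjc y.
Proof. exact: rmorphD. Qed.

Section HeckeBasics.
Variables (R : realType) (D : root_datum) (qq : R) (f q : affweyl D -> R).
Hypotheses (hqq : 1 < qq) (hq : is_weight qq f q).
Variable H : hecke_algebra q.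
Local Notation X := (rd_X D).
Local Notation W := (affweyl D).
Local Notation T := (@hecke_T R D q H).
Local Notation tau := (hecke_tau H).
Local Notation star := (@hecke_star R D q H).
Local Notation aroot := (X * int)%type.
Implicit Types (v w : W) (b : aroot) (h : H).

Lemma q_len0 w : len w = 0%N -> q w = 1.
Proof. by case: hq => _ _; apply. Qed.

Lemma qM v w : len (v * w)%g = (len v + len w)%N -> q (v * w)%g = q v * q w.
Proof. by case: hq => _ h _; exact: h. Qed.

Lemma q_aref_gt0 b : asimple b -> 0 < q (aref b).
Proof.
move=> sb; case: hq => e _ _; rewrite e; last by apply/SaffP; exists b.
by apply: powR_gt0; exact: lt_trans hqq.
Qed.

Lemma q_gt0 w : 0 < q w.
Proof.
elim/affweyl_ind: w => [w /q_len0 -> //|w b sb lb IH].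
by rewrite qM ?len_aref ?addn1 // mulr_gt0 // q_aref_gt0.
Qed.

Lemma qV w : q w^-1%g = q w.
Proof.
elim/affweyl_ind: w => [w w0|w b sb lb IH]; first by rewrite !q_len0 // lenV.
have la := len_aref sb; rewrite invgM arefV ?asimple_root //.
have e : len (aref b * w^-1)%g = (len (aref b) + len w^-1%g)%N.
  by rewrite -[X in (X * _)%g]arefV ?asimple_root // -invgM !lenV lb la.
by rewrite (qM e) qM ?la ?addn1 // IH mulrC.
Qed.

Lemma TM v w : len (v * w)%g = (len v + len w)%N -> T v * T w = T (v * w)%g.
Proof. exact: hecke_TM. Qed.

Lemma hecke_ind (P : H -> Prop) : P 0 ->
  (forall (c : R[i]) h h', P h -> P h' -> P (c *: h + h')) ->
  (forall w, P (T w)) -> forall h, P h.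
Proof.
move=> P0 PD PT h; have [c [-> _]] := hecke_basis h.
apply: big_ind => // [x y Px Py|w _]; first by rewrite -[x]scale1r; exact: PD.
by rewrite -[_ *: _]addr0; exact: PD.
Qed.

Lemma T1 : T 1%g = 1.
Proof.
suff h1 h : T 1%g * h = h by rewrite -[LHS]mulr1 h1.
elim/hecke_ind: h => [|c h h' IH IH'|w]; first by rewrite mulr0.
- by rewrite mulrDr -scalerAr IH IH'.
- by rewrite TM mul1g // len1.
Qed.

Lemma T_quad b : asimple b ->
  T (aref b) * T (aref b) = (q (aref b) - 1)%:C *: T (aref b) + (q (aref b))%:C%:A.
Proof.
move=> sb; have : Saff (aref b) by apply/SaffP; exists b.
move=> /(@hecke_quadratic _ _ _ H); rewrite mulrDl mul1r mulrBr -scalerAr mulr1.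
set t := T _; set c := (q _)%:C => e; rewrite rmorphB rmorph1 /= scalerBl scale1r -/c.
apply/eqP; rewrite -subr_eq0 -e; apply/eqP.
by rewrite opprD opprB !addrA; congr (_ - _); rewrite addrAC.
Qed.

Definition invertible (a : H) : Prop := exists a', a * a' = 1 /\ a' * a = 1.

Lemma invertibleM a a' : invertible a -> invertible a' -> invertible (a * a').
Proof.
move=> [b [e1 e2]] [b' [e1' e2']]; exists (b' * b); split.
- by rewrite mulrA -[a * a' * b']mulrA e1' mulr1.
- by rewrite mulrA -[b' * b * a]mulrA e2 mulr1.
Qed.

Local Notation N := (@hecke_N R D q H).

Lemma sqrtq_neq0 w : Num.sqrt (q w) != 0.
Proof. by rewrite gt_eqF // sqrtr_gt0 q_gt0. Qed.

Lemma T_N w : T w = (Num.sqrt (q w))%:C *: N w.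
Proof.
rewrite /hecke_N scalerA -rmorphM /= mulfV ?sqrtq_neq0 //.
by rewrite scale1r.
Qed.

Lemma NM v w : len (v * w)%g = (len v + len w)%N -> N v * N w = N (v * w)%g.
Proof.
move=> l; rewrite /hecke_N -scalerAl -scalerAr scalerA TM // qM //.
by rewrite sqrtrM ?(ltW (q_gt0 _)) // -rmorphM -invfM.
Qed.

Lemma N_len0 w : len w = 0%N -> N w = T w.
Proof. by move=> w0; rewrite T_N q_len0 // sqrtr1 scale1r. Qed.

Lemma N1 : N 1%g = 1.
Proof. by rewrite N_len0 ?len1 // T1. Qed.

Definition qdiff (s : W) : R[i] := (Num.sqrt (q s) - (Num.sqrt (q s))^-1)%:C.

Lemma N_quad b : asimple b -> N (aref b) * N (aref b) = qdiff (aref b) *: N (aref b) + 1.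
Proof.
move=> sb; have r0 := sqrtq_neq0 (aref b).
have rr : Num.sqrt (q (aref b)) ^+ 2 = q (aref b) by rewrite sqr_sqrtr // ltW // q_gt0.
rewrite {1 2}/hecke_N -scalerAl -scalerAr scalerA T_quad // T_N scalerDr !scalerA.
rewrite -!rmorphM /= /qdiff; set r := Num.sqrt _ in r0 rr *; rewrite -rr.
by congr (_%:C *: _ + _); [field|rewrite (_ : _ * _ = 1) ?scale1r //; field].
Qed.

Definition Ninv (b : aroot) : H := N (aref b) - (qdiff (aref b))%:A.

Lemma N_mulV b : asimple b -> N (aref b) * Ninv b = 1.
Proof. by move=> sb; rewrite mulrBr N_quad // -scalerAr mulr1 addrAC subrr add0r. Qed.

Lemma N_Vmul b : asimple b -> Ninv b * N (aref b) = 1.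
Proof. by move=> sb; rewrite mulrBl N_quad // -scalerAl mul1r addrAC subrr add0r. Qed.

Lemma N_invertible w : invertible (N w).
Proof.
elim/affweyl_ind: w => [w w0|w b sb lb IH].
  by exists (N w^-1%g); rewrite !NM ?mulgV ?mulVg ?N1 // ?lenV w0 len1.
rewrite -NM ?len_aref ?addn1 //; apply: invertibleM => //.
by exists (Ninv b); rewrite N_mulV // N_Vmul.
Qed.

Lemma hecke_gen (P : H -> Prop) :
  (forall (c : R[i]) h h', P h -> P h' -> P (c *: h + h')) ->
  (forall h h', P h -> P h' -> P (h * h')) ->
  (forall w, len w = 0%N -> P (T w)) ->
  (forall b, asimple b -> P (T (aref b))) -> forall h, P h.
Proof.
move=> PD PM P0 PS; have P1 : P 1 by rewrite -T1; apply: P0; exact: len1.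
apply: hecke_ind => // [|w]; first by rewrite -(addNr 1) -scaleN1r; exact: PD.
elim/affweyl_ind: w => [w w0|w b sb lb IH]; first exact: P0.
by rewrite -TM ?len_aref ?addn1 //; apply: PM => //; exact: PS.
Qed.

Lemma starP (c : R[i]) h h' : star (c *: h + h') = conjc c *: star h + star h'.
Proof. exact: hecke_starP. Qed.

Lemma starD h h' : star (h + h') = star h + star h'.
Proof. by rewrite -[h]scale1r starP !scale1r conjc1 scale1r. Qed.

Lemma star0 : star 0 = 0.
Proof. by apply: (addrI (star 0)); rewrite -starD !addr0. Qed.

Lemma starZ (c : R[i]) h : star (c *: h) = conjc c *: star h.
Proof. by rewrite -[c *: h]addr0 starP star0 addr0. Qed.

Lemma starN h : star (- h) = - star h.
Proof. by apply/eqP; rewrite -addr_eq0 -starD addNr star0. Qed.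

Lemma star_sum (I : Type) (r : seq I) (P : pred I) (F : I -> H) :
  star (\sum_(i <- r | P i) F i) = \sum_(i <- r | P i) star (F i).
Proof. by apply: (big_morph star starD star0). Qed.

Lemma star1 : star 1 = 1.
Proof. by rewrite -T1 hecke_starT invg1. Qed.

Lemma tau_star h : tau (star h) = conjc (tau h).
Proof.
elim/hecke_ind: h => [|c h h' IH IH'|w]; first by rewrite star0 linear0 conjc0.
- by rewrite starP !linearP IH IH' /= rmorphD rmorphM.
- rewrite hecke_starT !hecke_tauT conjc_nat (_ : (w^-1 == 1)%g = (w == 1)%g) //.
  by apply/eqP/eqP => [e|->]; rewrite ?invg1 // -[w]invgK e invg1.
Qed.

Lemma star_tau h : tau h = conjc (tau (star h)).
Proof. by rewrite tau_star conjcK. Qed.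

Lemma tau_Tsimple w b : asimple b -> tau (T w * T (aref b)) = (w == aref b)%:R * (q (aref b))%:C.
Proof.
move=> sb; have bR := asimple_root sb; have l1 := len_aref sb; have := len_simple w sb.
case: ifP => _ l.
  rewrite TM ?l1 ?addn1 // hecke_tauT.
  have -> : (w * aref b == 1)%g = false.
    by apply/eqP => e; move: l; rewrite e len1.
  case: eqP => [e|_]; last by rewrite mul0r.
  by move: l; rewrite e aref_mul // len1.
have e : T w = T (w * aref b)%g * T (aref b) by rewrite TM ?aref_mulK // l l1 addn1.
rewrite e -mulrA T_quad // mulrDr -scalerAr -e -scalerAr mulr1 linearD !linearZ /= !hecke_tauT.
have -> : (w == 1)%g = false by apply/eqP => e'; move: l; rewrite e' len1.
rewrite mulr0 add0r mulrC (_ : (w * aref b == 1)%g = (w == aref b)) //.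
apply/eqP/eqP => [h|->]; last exact: aref_mul.
by rewrite -[w](aref_mulK w sb) h mul1g.
Qed.

(** It is enough that [h'] be a generator and [h] a basis element. For a simple reflection,
    [tau_Tsimple] gives a value that is nonzero only if [h] is that same generator. *)
Lemma tau_mulC h h' : tau (h * h') = tau (h' * h).
Proof.
elim/hecke_gen: h' h => [c a a' IH IH' h|a a' IH IH' h|w w0 h|b sb h].
- by rewrite mulrDl mulrDr -scalerAl -scalerAr !linearP IH IH'.
- by rewrite mulrA IH' mulrA IH mulrA.
- elim/hecke_ind: h => [|c h h' IH IH'|v]; first by rewrite mul0r mulr0.
    by rewrite mulrDl mulrDr -scalerAl -scalerAr !linearP IH IH'.
  have lwv := len0Ml v w0; have lvw := len0Mr v w0.
  rewrite !TM ?lwv ?lvw ?w0 ?addn0 // !hecke_tauT.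
  rewrite (_ : (v * w == 1)%g = (w * v == 1)%g) //; apply/eqP/eqP => e.
    by rewrite -[w]invgK -[v](mulgK w) e mul1g invgK mulgV.
  by rewrite -[v]invgK -[w](mulgK v) e mul1g invgK mulgV.
- elim/hecke_ind: h => [|c h h' IH IH'|v]; first by rewrite mul0r mulr0.
    by rewrite mulrDl mulrDr -scalerAl -scalerAr !linearP IH IH'.
  (* Applying the star moves the simple generator to the right, so the same formula evaluates both
     sides. *)
  rewrite [RHS]star_tau hecke_starM !hecke_starT arefV ?asimple_root //.
  rewrite !tau_Tsimple // conjcM conjc_nat conjc_real.
  rewrite (_ : (v^-1 == aref b)%g = (v == aref b)) //.
  apply/eqP/eqP => [e|->]; last by rewrite arefV ?asimple_root.
  by rewrite -[v]invgK e arefV ?asimple_root.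
Qed.

End HeckeBasics.

(** * Translations and the longest element *)

Section Translations.
Variable D : root_datum.
Local Notation X := (rd_X D).
Local Notation R := (rd_roots D).
Local Notation F0 := (rd_simple D).
Local Notation "<< x , y >>" := (@rd_pair D x y) (at level 0, format "<< x ,  y >>").
Local Notation co := (@rd_coroot D).
Local Notation W := (affweyl D).
Local Notation aroot := (X * int)%type.
Implicit Types (v w : W) (b c : aroot) (x y : X).

Lemma dominantP x : dominant x <-> forall a, a \in F0 -> 0 <= <<x, co a>>.
Proof.
split=> [h a aF|h a /pos_rootP [aR /(cspan_rpos aR) [c [c0 ->]]]].
  by apply/h/pos_rootP; split; [exact: simple_root|exact: rpos_simple].
rewrite pair_sumr big_seq; apply: sumr_ge0 => b bF.
by rewrite pairMzr mulr_ge0 // h.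
Qed.

Lemma dominant_pair x a : dominant x -> a \in R -> rpos a -> 0 <= <<x, co a>>.
Proof. by move=> dx aR pa; apply/dx/pos_rootP. Qed.

Lemma dominant_pairN x a : dominant x -> a \in R -> ~~ rpos a -> <<x, co a>> <= 0.
Proof.
move=> dx aR; rewrite -rposN // => /(dominant_pair dx (opp_root aR)).
by rewrite corootN // pairNr oppr_ge0.
Qed.

(** The pairing is minus the coefficient of [g] in the positive root [refl g a]. *)
Lemma simple_obtuse (a g : X) : a \in F0 -> g \in F0 -> a != g -> <<a, co g>> <= 0.
Proof.
move=> aF gF ag; have aR := simple_root aF.
have /asboolP/nat_spanP [d [d0 dE]] := rpos_refl gF aR (rpos_simple aF) ag.
have aE : a = \sum_(b <- F0) b *~ (b == a)%:R.
  rewrite (big_fsetD1 a) //= eqxx mulr1z [X in _ + X]big1_fset ?addr0 // => b.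
  by rewrite in_fsetD1 => /andP [/negPf ->].
have /simple_uniq cd : \sum_(b <- F0) b *~ ((b == a)%:R - (b == g)%:R * <<a, co g>>) =
    \sum_(b <- F0) b *~ d b by rewrite sum_simple_delta // -aE -dE.
have := cd g gF; rewrite eqxx eq_sym (negPf ag) mul1r sub0r => e.
by rewrite -oppr_ge0 e.
Qed.

Lemma dominant_rho2 : dominant (rho2 D).
Proof. by move=> a /pos_rootP [aR pa]; rewrite ltW // rho2_gt0. Qed.

Lemma rho2B_simple a g : a \in F0 -> g \in F0 -> g != a -> 2 <= <<rho2 D - a, co g>>.
Proof.
move=> aF gF ga; rewrite pairBl rho2_simple //.
by have := simple_obtuse aF gF; rewrite eq_sym => /(_ ga); lia.
Qed.

Lemma rho2B_self a : a \in F0 -> <<rho2 D - a, co a>> = 0.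
Proof. by move=> aF; rewrite pairBl rho2_simple // rd_pair2 ?simple_root. Qed.

Lemma dominant_rho2B a : a \in F0 -> dominant (rho2 D - a).
Proof.
move=> aF; apply/dominantP => g gF; have [->|ga] := eqVneq g a.
  by rewrite rho2B_self.
by apply: le_trans (rho2B_simple aF gF ga).
Qed.

Lemma pairMnl x n (y : rd_Y D) : <<x *+ n, y>> = <<x, y>> * n%:Z.
Proof. by rewrite pmulrn rd_pairMzl. Qed.

Lemma dominantMn x n : dominant x -> dominant (x *+ n).
Proof. by move=> dx a pa; rewrite pairMnl mulr_ge0 // dx. Qed.

(** [rho2 - a] is orthogonal to the coroot of [a] and pairs to at least 2 with every other simple
    coroot, so multiples of it repair dominance without changing the pairing with [a]. *)
Lemma dominant_shift a x : a \in F0 -> 0 <= <<x, co a>> ->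
  exists k : nat, dominant (x + (rho2 D - a) *+ k).
Proof.
move=> aF x0; pose k := (\sum_(g <- F0) `|<<x, co g>>|)%N; exists k.
apply/dominantP => g gF; rewrite rd_pairDl pairMnl.
have [->|ga] := eqVneq g a; first by rewrite rho2B_self // mul0r addr0.
have h : (`|<<x, co g>>| <= k)%N by rewrite /k (big_fsetD1 g) //= leq_addr.
by have := rho2B_simple aF gF ga; move: h; set m := <<_, _>>; set n := <<_, _>>; nia.
Qed.

Lemma dominant_diff x : exists y z, [/\ dominant y, dominant z & x = y - z].
Proof.
pose k := (\sum_(g <- F0) `|<<x, co g>>|)%N.
exists (x + rho2 D *+ k), (rho2 D *+ k); split; last by rewrite addrK.
  apply/dominantP => g gF; rewrite rd_pairDl pairMnl rho2_simple //.
  have h : (`|<<x, co g>>| <= k)%N by rewrite /k (big_fsetD1 g) //= leq_addr.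
  by move: h; set n := <<_, _>>; lia.
by apply: dominantMn; exact: dominant_rho2.
Qed.

Lemma transl_mul x y : (transl x * transl y)%g = transl (x + y) :> W.
Proof. by apply: affweyl_ext => z; rewrite aw_act_mul /aw_act /= -addrA [y + x]addrC. Qed.

Definition wlin (u : weyl D) : W := AffWeyl u 0.

Lemma wlin_mul u u' : (wlin u * wlin u')%g = wlin (u * u')%g.
Proof. by apply: affweyl_ext => z; rewrite aw_act_mul /aw_act /= !addr0. Qed.

Lemma wlinV u : (wlin u)^-1%g = wlin u^-1%g.
Proof.
have h : (wlin u * wlin u^-1 = 1)%g by rewrite wlin_mul mulgV.
by rewrite -[LHS]mulg1 -h mulgA mulVg mul1g.
Qed.

Lemma wlin_transl u x : (wlin u * transl x)%g = (transl (u x) * wlin u)%g.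
Proof. by apply: affweyl_ext => z; rewrite !aw_act_mul /aw_act /= !addr0 weylD. Qed.

Lemma aact_transl x b : aact (transl x) b = (b.1, b.2 - <<x, co b.1>>).
Proof. by []. Qed.

Lemma aact_wlin u b : aact (wlin u) b = (u b.1, b.2).
Proof. by rewrite /aact /= rd_pair0l subr0. Qed.

Lemma aref_wlin a : aref (a, 0) = wlin (wref a).
Proof. by rewrite /aref /= mulr0z oppr0. Qed.

Lemma asimple_fin a : a \in F0 -> asimple (a, 0).
Proof. by left. Qed.

Lemma len_transl x y : dominant x -> dominant y ->
  len (transl x * transl y : W)%g = (len (transl x : W) + len (transl y : W))%N.
Proof.
move=> dx dy; apply: len_add => -[c k] cR; rewrite transl_mul !aact_transl /apos /=.
rewrite /is_aroot /= in cR; rewrite rd_pairDl.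
have [pc|nc] := boolP (rpos c).
  by have := dominant_pair dx cR pc; have := dominant_pair dy cR pc;
    set m := <<x, _>>; set n := <<y, _>>; lia.
by have := dominant_pairN dx cR nc; have := dominant_pairN dy cR nc;
    set m := <<x, _>>; set n := <<y, _>>; lia.
Qed.

Lemma rpos_refl_other (a c : X) : a \in F0 -> c \in R -> c != a -> c != - a ->
  rpos (refl a c) = rpos c.
Proof.
move=> aF cR ca cna; have aR := simple_root aF; have [pc|nc] := boolP (rpos c).
  exact: rpos_refl.
rewrite -(opprK c) reflN rposN ?refl_root ?opp_root //.
rewrite rpos_refl ?opp_root ?rposN ?opprK //.
by apply: contraNneq cna => <-; rewrite opprK.
Qed.

Lemma coroot_refl_pair (a c x : X) : a \in R -> c \in R ->
  <<x, co (refl a c)>> = <<x, co c>> - <<x, co a>> * <<a, co c>>.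
Proof. by move=> aR cR; rewrite coroot_refl // /corefl pairBr pairMzr. Qed.

Lemma len_transl_simple_add a x : a \in F0 -> dominant x -> <<x, co a>> = 0 ->
  len (transl x * aref (a, 0))%g = (len (transl x : W)).+1.
Proof.
move=> aF dx x0; have := len_simple (transl x) (asimple_fin aF).
by rewrite aact_transl /apos /= x0 subr0 eqxx rpos_simple.
Qed.

Lemma len_transl_simple_sub a x : a \in F0 -> 0 < <<x, co a>> ->
  len (transl x : W) = (len (transl x * aref (a, 0))%g).+1.
Proof.
move=> aF x0; have := len_simple (transl x) (asimple_fin aF).
rewrite aact_transl /apos /= sub0r oppr_gt0 oppr_eq0.
by rewrite (gt_eqF x0) ltNge (ltW x0).
Qed.

Lemma simple_transl_comm a x : a \in F0 -> <<x, co a>> = 0 ->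
  (aref (a, 0) * transl x)%g = (transl x * aref (a, 0))%g.
Proof.
move=> aF x0; rewrite aref_wlin wlin_transl wrefE ?simple_root //.
by rewrite /refl x0 mulr0z subr0.
Qed.

Lemma len_simple_transl a x : a \in F0 -> dominant x -> <<x, co a>> = 0 ->
  len (aref (a, 0) * transl x)%g = (len (transl x : W)).+1.
Proof. by move=> aF dx x0; rewrite simple_transl_comm // len_transl_simple_add. Qed.

(** Additivity of lengths makes the normalized basis element of [t_x s_a] square to
    [theta (x + refl a x)]; this is the source of Bernstein's relation at pairing 1. *)
Lemma len_transl_refl_sqr a x : a \in F0 -> dominant x -> <<x, co a>> = 1 ->
  len ((transl x * aref (a, 0)) * (transl x * aref (a, 0)))%g =
    (2 * len (transl x * aref (a, 0%R))%g)%N /\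
  ((transl x * aref (a, 0)) * (transl x * aref (a, 0)))%g = transl (x + refl a x).
Proof.
move=> aF dx x1; have aR := simple_root aF.
have e : ((transl x * aref (a, 0)) * (transl x * aref (a, 0)))%g = transl (x + refl a x).
  rewrite mulgA -[(transl x * _ * _)%g]mulgA aref_wlin wlin_transl wrefE // mulgA.
  by rewrite -aref_wlin -mulgA aref_mul // mulg1 transl_mul.
split=> //; rewrite mul2n -addnn; apply: len_add => -[c k] cR; rewrite e.
rewrite /is_aroot /= in cR; rewrite aact_mul // aref_wlin aact_wlin !aact_transl /= wrefE //.
rewrite /apos /= rd_pairDl pair_refl -coroot_refl //.
have [-> |ca] := eqVneq c a.
  by rewrite refl_self // corootN // pairNr x1; lia.
have [-> |cna] := eqVneq c (- a).
  by rewrite reflN refl_self // opprK rposN // rpos_simple //= corootN // pairNr x1; lia.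
have sR := refl_root aR cR; have e2 := rpos_refl_other aF cR ca cna.
rewrite e2; have [pc|nc] := boolP (rpos c).
  have := dominant_pair dx cR pc; rewrite -e2 in pc; have := dominant_pair dx sR pc.
  by set m := <<x, _>>; set n := <<x, _>>; lia.
have := dominant_pairN dx cR nc; rewrite -e2 in nc; have := dominant_pairN dx sR nc.
by set m := <<x, _>>; set n := <<x, _>>; lia.
Qed.

(** The affine reflection [s_(-a,1)] is [t_a s_a]. *)
Lemma transl_affine_refl a : a \in F0 ->
  (transl (rho2 D) * aref (a, 0))%g = (transl (rho2 D - a) * aref (- a, 1%R))%g.
Proof.
move=> aF; have aR := simple_root aF; apply: affweyl_ext => z.
rewrite !aw_act_mul !aw_act_aref ?/is_aroot ?opp_root // /aw_act /= addr0.
rewrite corootN // pairNr mulNrz opprK mulrzDr mulrNz mulr1z.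
by rewrite [rho2 D - a]addrC !addrA -[_ + a - a]addrA subrr addr0.
Qed.

(* The inversion [(-a^vee, 1)] is the only one cancelled in the square
   of [t_(2rho - a) s_(-a,1)], which is [t_(2rho - a)^2]. *)
Lemma len_transl_affine_refl a : a \in F0 ->
  len (transl (rho2 D - a) * aref (- a, 1%R))%g = (len (transl (rho2 D - a) : W)).+1.
Proof.
move=> aF; have aR := simple_root aF; set u := rho2 D - a; set v := (_ * _)%g.
have du : dominant u by exact: dominant_rho2B.
have u0 : <<u, co a>> = 0 by exact: rho2B_self.
have vv : (v * v)%g = (transl u * transl u)%g.
  have vE : v = (aref (- a, 1%R) * transl u)%g.
    apply: affweyl_ext => z; rewrite !aw_act_mul !aw_act_aref ?/is_aroot ?opp_root // /aw_act /=.
    by rewrite rd_pairDl corootN // pairNr pairNr u0 oppr0 addr0 addrAC.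
  by rewrite {2}vE /v mulgA -[(transl u * _ * _)%g]mulgA aref_mul ?/is_aroot ?opp_root // mulg1.
have vact (c : X) k : c \in R -> aact v (c, k) = (refl a c, k + <<a, co c>> - <<u, co c>>).
  move=> cR; rewrite aact_mul // aact_aref ?/is_aroot ?opp_root // aact_transl /=.
  have -> : refl (- a) c = refl a c by rewrite /refl corootN // pairNr mulrNz mulNrz opprK.
  by rewrite coroot_refl_pair // u0 mul0r subr0 mul1r rd_pairNl opprK.
have cE : cancelled v v = [set (- a, 1)].
  apply/seteqP; split=> [[c k] [cR [pb [nb pp]]]|_ ->].
    rewrite /is_aroot /= in cR.
    move: pb nb pp; rewrite vv transl_mul vact // aact_transl rd_pairDl /apos /=.
    have uE : <<u, co c>> = <<rho2 D, co c>> - <<a, co c>> by rewrite pairBl.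
    have [pc|nc] := boolP (rpos c).
      have := rho2_gt0 cR pc; have := dominant_pair du cR pc; rewrite uE.
      set p := <<rho2 D, _>>; set m := <<a, _>>; move=> h1 h2 h3 h4 h5; exfalso; move: h3 h4 h5.
      by case: (rpos (refl a c)); lia.
    have [-> |cna] := eqVneq c (- a).
      rewrite reflN refl_self // opprK rpos_simple // corootN // !pairNr u0 rd_pair2 //.
      move=> h1 h2 h3; congr pair; move: h1 h2.
      by case: (rpos (- a)); lia.
    have ca : c != a by apply: contraNneq nc => ->; exact: rpos_simple.
    have nd : ~~ rpos (refl a c) by rewrite rpos_refl_other.
    have := dominant_pairN du (refl_root aR cR) nd.
    rewrite -rposN ?refl_root // in nd; have := rho2_gt0 (opp_root (refl_root aR cR)) nd.
    rewrite corootN ?refl_root // pairNr !coroot_refl_pair // u0 (rho2_simple aF) mul0r subr0 uE.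
    set p := <<rho2 D, _>>; set m := <<a, _>>.
    by move=> h1 h2 h3 h4 h5; exfalso; move: h3 h4; case: (rpos (refl a c)); lia.
  split; first exact: opp_root.
  rewrite vv transl_mul vact ?opp_root // aact_transl rd_pairDl corootN // !pairNr u0.
  rewrite reflN refl_self // opprK /apos /= rd_pair2 // rposN // rpos_simple //.
have := len_mul v v; rewrite cE fset_set1 cardfs1 vv len_transl // addnn addnn mul2n -doubleD => /double_inj ->.
by rewrite addn1.
Qed.

(** Expresses an affine simple reflection by a dominant translation and a finite reflection with
    lengths adding, so that its generator is a quotient of elements already known to commute with
    the center. *)
Lemma len_minimal_refl a : minimal_coroot a ->
  len (aref (a, 1%R) * wlin (wref a))%g = (len (aref (a, 1%R)) + len (wlin (wref a)))%N /\
  (aref (a, 1%R) * wlin (wref a))%g = transl (- a) /\ dominant (- a).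
Proof.
move=> mina; have aR : a \in R by case: mina.
have e : (aref (a, 1%R) * wlin (wref a))%g = transl (- a).
  apply: affweyl_ext => z; rewrite !aw_act_mul aw_act_aref // /aw_act /= !wrefE // addr0.
  by rewrite pair_refl corefl_self // pairNr /refl mulrzDr mulrNz mulr1z opprD opprK addrA subrK.
have dna : dominant (- a).
  by move=> b /pos_rootP [bR pb]; rewrite rd_pairNl oppr_ge0 minimal_le0.
split; last by split.
apply: len_add => -[c k] cR; rewrite /is_aroot /= in cR.
rewrite e aact_wlin aact_transl /= wrefE // /apos /= rd_pairNl opprK.
have sR := refl_root aR cR.
have [pc|nc] := boolP (rpos c); last by have := minimal_le0 mina (opp_root cR); rewrite rposN // nc corootN // pairNr => /(_ isT); set m := <<a, _>>; case: (rpos (refl a c)); lia.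
have m0 := minimal_le0 mina cR pc.
have [n0|n0] := eqVneq <<a, co c>> 0; last first.
  by move: n0 m0; set m := <<a, _>>; case: (rpos (refl a c)); lia.
rewrite /refl (pair_eq0C aR cR n0) mulr0z subr0 pc; set m := <<a, _>>; lia.
Qed.

(** The same reduction for elements of length 0. Dominance holds because such an element and its
    inverse preserve positivity: a negative pairing of its translation part would show at level 0 or
    -1. *)
Lemma len0_dominant (w : W) : len w = 0%N ->
  dominant (aw_trans w) /\ (w * wlin (aw_lin w)^-1)%g = transl (aw_trans w) /\
  len (w * wlin (aw_lin w)^-1)%g = (len w + len (wlin (aw_lin w)^-1%g))%N.
Proof.
move=> w0; split; last split; last by rewrite len0Ml // w0.
  move=> a /pos_rootP [aR pa].
  set u := aw_lin w; pose b := weyl_fun u^-1%g a.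
  have ub : u b = a by exact: weylVK.
  have bR : b \in R by rewrite -(weyl_root u) ub.
  have w0' c : is_aroot c -> apos (aact w c) = apos c.
    move=> cR; have [pc|nc] := boolP (apos c); first exact: invs0.
    apply: contraNF nc => h; rewrite -(aactK w cR); apply: invs0 => //.
      by rewrite lenV.
    by rewrite aact_root.
  have [pb|nb] := boolP (rpos b).
    have := w0' (b, - 1) bR; rewrite /apos /aact /= -/u ub ?pb pa.
    by set m := <<_, _>>; lia.
  have := w0' (b, 0) bR; rewrite /apos /aact /= -/u ub (negPf nb) pa.
  by set m := <<_, _>>; lia.
apply: affweyl_ext => z; rewrite aw_act_mul /aw_act /= addr0.
by rewrite weylVK.
Qed.

Lemma weyl_not_pos (u : weyl D) : (0 < len (wlin u))%N ->
  exists2 a, a \in F0 & ~~ rpos (u a).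
Proof.
move=> l0; apply: contrapT => h.
have hu : forall a, a \in F0 -> rpos (u a).
  by move=> a aF; apply: contraT => na; case: h; exists a.
move: l0; rewrite len_invs (_ : invs _ = set0) ?fset_set0 ?cardfs0 //.
apply/seteqP; split=> // -[a k] [aR [pb]]; rewrite aact_wlin => /negP; apply.
move: pb; rewrite /apos /= => /orP [->//|/andP [-> pa]].
by rewrite (weyl_simple_rpos hu) ?orbT.
Qed.

Lemma len_wlin_simple (u : weyl D) a : a \in F0 ->
  if rpos (u a) then len (wlin (u * wref a)%g) = (len (wlin u)).+1
  else len (wlin u) = (len (wlin (u * wref a)%g)).+1.
Proof.
move=> aF; have := len_simple (wlin u) (asimple_fin aF).
by rewrite aact_wlin aref_wlin wlin_mul /apos /=.
Qed.

(** Take an element of maximal length, which exists as W_0 is finite. If it kept a simple root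
    positive, multiplying by that reflection would lengthen it. *)
Lemma longest_weyl : exists u : weyl D, forall a, a \in R -> rpos (u a) = ~~ rpos a.
Proof.
have [n hn] : exists n : nat, forall u : weyl D, (len (wlin u) <= n)%N.
  exists (\max_(u <- fset_set [set: weyl D]) len (wlin u)) => u.
  have uin : u \in fset_set [set: weyl D] by rewrite in_fset_set ?inE //; exact: weyl_finite.
  by rewrite (big_fsetD1 u uin) /= leq_maxl.
have [u umax] : exists u : weyl D, forall u', (len (wlin u') <= len (wlin u))%N.
  elim: n hn => [|n IH] hn; first by exists 1%g => u'; exact: leq_trans (hn u') _.
  have [[u un]|h] := pselect (exists u : weyl D, len (wlin u) = n.+1).
    by exists u => u'; rewrite un.
  apply: IH => u; rewrite -ltnS ltn_neqAle hn andbT; apply/eqP => un.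
  by apply: h; exists u.
exists u.
have neg a : a \in F0 -> rpos (- u a).
  move=> aF; have aR := simple_root aF; rewrite rposN ?weyl_root //.
  have := len_wlin_simple u aF; case: ifP => // _ e; exfalso.
  by have := umax (u * wref a)%g; rewrite e ltnn.
have neg2 a : a \in R -> rpos a -> ~~ rpos (u a).
  move=> aR pa; have uR : u a \in R by rewrite weyl_root.
  rewrite rposE // -leNgt weyl_pairV //.
  have [c [c0 ->]] := cspan_rpos aR pa.
  rewrite pair_sumr big_seq; apply: sumr_le0 => b bF.
  rewrite pairMzr mulr_le0_ge0 // -weyl_pairV ?simple_root //.
  have bR := simple_root bF; have ubR : u b \in R by rewrite weyl_root.
  by rewrite leNgt -rposE // -rposN // neg.
move=> a aR; have [pa|na] := boolP (rpos a); first by rewrite (negPf (neg2 a aR pa)).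
rewrite -[a]opprK weylN rposN ?weyl_root ?opp_root //.
by apply: neg2; rewrite ?opp_root ?rposN.
Qed.

Section Longest.
Variable u : weyl D.
Hypothesis hu : forall a, a \in R -> rpos (u a) = ~~ rpos a.

Lemma dominant_longest x : dominant x -> dominant (- u x).
Proof.
move=> dx a /pos_rootP [aR pa]; rewrite rd_pairNl oppr_ge0 -[a](weylVK u).
set b := weyl_fun _ a; have bR : b \in R by rewrite -(weyl_root u) weylVK.
rewrite weyl_coroot //; apply: dominant_pairN => //.
by rewrite -hu // weylVK.
Qed.

(** By [transl_longest] the two products are the same element, factored in two ways with lengths
    adding. This moves the star of a translation element past the longest element. *)
Lemma len_transl_longest x : dominant x ->
  len (transl (- x) * wlin u^-1)%g = (len (transl (- x) : W) + len (wlin u^-1%g))%N /\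
  len (wlin u^-1 * transl (- u x))%g = (len (wlin u^-1%g) + len (transl (- u x) : W))%N.
Proof.
move=> dx; split; apply: len_add => -[c k] cR; rewrite /is_aroot /= in cR.
  rewrite aact_mul // aact_wlin aact_transl /apos /=.
  set b := weyl_fun _ c; have bR : b \in R by rewrite -(weyl_root u) weylVK.
  have e : rpos c = ~~ rpos b by rewrite -hu // weylVK.
  rewrite rd_pairNl opprK e; have [pb|nb] := boolP (rpos b); first by lia.
  by have := dominant_pairN dx bR nb; set m := <<_, _>>; lia.
rewrite aact_mul // aact_transl aact_wlin /apos /=.
set b := weyl_fun _ c; have bR : b \in R by rewrite -(weyl_root u) weylVK.
have e : rpos c = ~~ rpos b by rewrite -hu // weylVK.
have dux := dominant_longest dx.
have [pc|nc] := boolP (rpos c).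
  have := dominant_pair dux cR pc; move: pc; rewrite e => /negPf ->.
  by set m := <<_, _>>; lia.
by have := dominant_pairN dux cR nc; move: nc; rewrite e negbK => ->; set m := <<_, _>>; lia.
Qed.

Lemma transl_longest x : (wlin u^-1 * transl (- u x))%g = (transl (- x) * wlin u^-1)%g.
Proof. by rewrite wlin_transl weylN weylKV. Qed.

End Longest.

End Translations.

(** * Bernstein's center *)

Section Bernstein.
Variables (R : realType) (D : root_datum) (qq : R) (f q : affweyl D -> R).
Hypotheses (hqq : 1 < qq) (hq : is_weight qq f q).
Variable H : hecke_algebra q.
Local Notation X := (rd_X D).
Local Notation F0 := (rd_simple D).
Local Notation "<< x , y >>" := (@rd_pair D x y) (at level 0, format "<< x ,  y >>").
Local Notation co := (@rd_coroot D).
Local Notation W := (affweyl D).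
Local Notation T := (@hecke_T R D q H).
Local Notation N := (@hecke_N R D q H).
Local Notation star := (@hecke_star R D q H).
Local Notation aroot := (X * int)%type.
Implicit Types (v w : W) (b : aroot) (h : H) (x y : X).
Let NM := @NM R D qq f q hqq hq H.
Let N_mulV := @N_mulV R D qq f q hqq hq H.
Let N_len0 := @N_len0 R D qq f q hqq hq H.
Let N_Vmul := @N_Vmul R D qq f q hqq hq H.
Let N_invertible := @N_invertible R D qq f q hqq hq H.

Lemma N_simple w b : asimple b -> len (w * aref b)%g = (len w).+1 ->
  N (w * aref b)%g = N w * N (aref b).
Proof. by move=> sb l; rewrite NM // l len_aref // addn1. Qed.

(* If [s_b] is an affine reflection with [l(w s_b) = l(w) + 1], then
   [N_w^-1 N_(w s_b)] is conjugate to [N_s] for some simple [s]. *)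
Lemma N_refl_quad w b : is_aroot b -> apos b -> len (w * aref b)%g = (len w).+1 ->
  exists c : R[i], forall Z, N w * Z = 1 -> Z * N w = 1 ->
    Z * N (w * aref b)%g * (Z * N (w * aref b)%g) = c *: (Z * N (w * aref b)%g) + 1.
Proof.
move: {2}(len w) (erefl (len w)) => n.
elim/ltn_ind: n w b => n IH w b wn bR pb lb.
have [|a sa na] := len_gt0 (w := (w * aref b)%g); first by rewrite lb.
have aR := asimple_root sa.
have [ab|ab] := eqVneq b a.
  rewrite ab in lb *; exists (qdiff q (aref a)) => Z e1 e2.
  have -> : Z * N (w * aref a)%g = N (aref a) by rewrite N_simple // mulrA e2 mul1r.
  exact: (N_quad hqq hq H sa).
have wb : apos (aact w b).
  apply: contraT => nb; have := len_aref_lt bR pb nb.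
  by rewrite lb ltnNge leqnSn.
have pb' : apos (aact (aref a) b) by exact: asimple_perm.
have bR' : is_aroot (aact (aref a) b) by rewrite aact_root.
have lwa : len (w * aref b * aref a)%g = len w.
  by have := len_simple (w * aref b)%g sa; rewrite (negPf na) lb => -[].
have wr : (w * aref a * aref (aact (aref a) b))%g = (w * aref b * aref a)%g.
  by rewrite aref_conj // arefV // !mulgA aref_mulK.
(* Otherwise [w s_a] would be longer than [w], while multiplying it by the conjugated reflection
   raises its length further and yet ends at the length of [w]. *)
have nwa : ~~ apos (aact w a).
  apply/negP => pa; have := len_simple w sa; rewrite pa => l1.
  have := @len_aref_gt _ (w * aref a)%g _ bR' pb'.
  rewrite -aact_mul // aref_mulK // => /(_ wb); rewrite wr lwa l1.
  by rewrite ltnNge leqnSn.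
have := len_simple w sa; rewrite (negPf nwa) => l1.
have lt : (len (w * aref a)%g < n)%N by rewrite -wn l1.
have lb' : len (w * aref a * aref (aact (aref a) b))%g = (len (w * aref a)%g).+1.
  by rewrite wr lwa.
have [c hc] := IH _ lt _ _ erefl bR' pb' lb'.
exists c => Z e1 e2; set A := N (aref a); set A' := Ninv H a.
have AA' : A * A' = 1 by exact: N_mulV.
have A'A : A' * A = 1 by exact: N_Vmul.
have Nw : N w = N (w * aref a)%g * A by rewrite -N_simple ?aref_mulK.
have Nwr : N (w * aref b)%g = N (w * aref b * aref a)%g * A.
  by rewrite -N_simple ?aref_mulK // lb lwa.
have p1 : N (w * aref a)%g * (A * Z) = 1 by rewrite mulrA -Nw.
have p2 : A * Z * N (w * aref a)%g = 1.
  have -> : N (w * aref a)%g = N w * A' by rewrite Nw -mulrA AA' mulr1.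
  by rewrite mulrA -[A * Z * _]mulrA e2 mulr1.
(* The element in question is the one for [w s_a] conjugated by the simple generator [A], so it
   inherits the quadratic relation with the same [c]. *)
have := hc _ p1 p2; rewrite wr Nwr; set V := N (w * aref b * aref a)%g.
have -> : Z * (V * A) = A' * (A * Z * V) * A by rewrite !mulrA A'A mul1r.
set M := A * Z * V => hV.
have -> : A' * M * A * (A' * M * A) = A' * (M * M) * A.
  by rewrite -!mulrA [A * (A' * _)]mulrA AA' mul1r.
by rewrite hV mulrDr mulrDl mulr1 A'A -(scalerAr c) -(scalerAl c).
Qed.

Variable theta : X -> H.
Hypothesis htheta : is_theta theta.

Lemma theta0 : theta 0 = 1. Proof. by case: htheta. Qed.
Lemma thetaD x y : theta (x + y) = theta x * theta y. Proof. by case: htheta. Qed.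
Lemma theta_dom x : dominant x -> theta x = N (transl x).
Proof. by case: htheta => _ _; apply. Qed.
Lemma theta_comm x y : theta x * theta y = theta y * theta x.
Proof. by rewrite -!thetaD addrC. Qed.
Lemma thetaV x : theta x * theta (- x) = 1.
Proof. by rewrite -thetaD subrr theta0. Qed.
Lemma thetaVr x : theta (- x) * theta x = 1.
Proof. by rewrite -thetaD addNr theta0. Qed.

Lemma comm_inv (z a a' : H) : a * a' = 1 -> a' * a = 1 -> z * a = a * z -> z * a' = a' * z.
Proof.
move=> e1 e2 za; rewrite -[LHS]mul1r -e2 -mulrA [a * _]mulrA -za.
by rewrite -[z * a * a']mulrA e1 mulr1.
Qed.

Lemma comm_thetaN (z : H) x : z * theta x = theta x * z -> z * theta (- x) = theta (- x) * z.
Proof. by apply: comm_inv; rewrite ?thetaV ?thetaVr. Qed.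

Section Simple.
Variable a : X.
Hypothesis aF : a \in F0.
Let aR := simple_root aF.
Local Notation s := (aref (a, 0%R)).
Local Notation A := (N s).
Local Notation A' := (Ninv H (a, 0)).
Let sa : asimple (a, 0) := asimple_fin aF.
Let AA' : A * A' = 1. Proof. exact: N_mulV. Qed.
Let A'A : A' * A = 1. Proof. exact: N_Vmul. Qed.

Lemma comm_theta_dom0 x : dominant x -> <<x, co a>> = 0 -> A * theta x = theta x * A.
Proof.
move=> dx x0; rewrite theta_dom // NM; last by rewrite len_simple_transl // len_aref // add1n.
by rewrite NM ?simple_transl_comm // len_transl_simple_add // len_aref // addn1.
Qed.

Lemma comm_theta0 x : <<x, co a>> = 0 -> A * theta x = theta x * A.
Proof.
move=> x0; have [|k dk] := dominant_shift aF (x := x); first by rewrite x0.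
have u0 : <<(rho2 D - a) *+ k, co a>> = 0 by rewrite pairMnl rho2B_self // mul0r.
have e1 := comm_theta_dom0 dk; rewrite rd_pairDl x0 u0 addr0 in e1.
have e2 := comm_theta_dom0 (dominantMn k (dominant_rho2B aF)) u0.
rewrite -[x](addrK ((rho2 D - a) *+ k)) thetaD mulrA e1 // -mulrA comm_thetaN //.
by rewrite mulrA.
Qed.

(** With [v = t_x s_a], [theta x] is [N v * A] and [N v] squares to [theta x * theta (refl a x)];
    eliminating [N v] gives the relation. *)
Lemma theta_refl_dom1 x : dominant x -> <<x, co a>> = 1 ->
  theta x * A' = A * theta (refl a x).
Proof.
move=> dx x1; have [l e] := len_transl_refl_sqr aF dx x1.
have d2 : dominant (x + refl a x).
  apply/dominantP => g gF; rewrite rd_pairDl pairBl x1 mulr1z.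
  have [->|ga] := eqVneq g a; first by rewrite x1 rd_pair2.
  have gR := simple_root gF; have := dominant_pair dx gR (rpos_simple gF).
  have := simple_obtuse aF gF; rewrite eq_sym => /(_ ga).
  by set m := <<a, _>>; set n := <<x, _>>; lia.
have x0 : 0 < <<x, co a>> by rewrite x1.
have lx := len_transl_simple_sub aF x0.
have e1 : theta x = N (transl x * s)%g * A.
  by rewrite theta_dom // -N_simple ?aref_mulK.
have e2 : theta x * theta (refl a x) = N (transl x * s)%g * N (transl x * s)%g.
  rewrite NM; last by rewrite l mul2n addnn.
  by rewrite e -thetaD (theta_dom d2).
have e3 : N (transl x * s)%g = theta x * A' by rewrite e1 -mulrA AA' mulr1.
have e4 : theta (refl a x) = A' * (theta x * A').
  rewrite -[LHS]mul1r -(thetaVr x) -mulrA e2 e3 -!mulrA mulrA thetaVr mul1r.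
  by rewrite !mulrA.
by rewrite e4 mulrA AA' mul1r.
Qed.

Lemma theta_refl1 x : <<x, co a>> = 1 -> theta x * A' = A * theta (refl a x).
Proof.
move=> x1; have [|k dk] := dominant_shift aF (x := x); first by rewrite x1.
set u := (rho2 D - a) *+ k in dk.
have u0 : <<u, co a>> = 0 by rewrite pairMnl rho2B_self // mul0r.
have Nu0 : <<- u, co a>> = 0 by rewrite rd_pairNl u0 oppr0.
have e1 : theta (x + u) * A' = A * theta (refl a (x + u)).
  by apply: theta_refl_dom1 => //; rewrite rd_pairDl x1 u0.
have ru : refl a u = u by rewrite /refl u0 mulr0z subr0.
rewrite reflD ru (thetaD x u) (thetaD (refl a x) u) in e1.
rewrite -[x in LHS](addrK u) addrC thetaD (thetaD x) -mulrA e1 !mulrA -(comm_theta0 Nu0) -!mulrA.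
by congr (_ * _); rewrite (theta_comm (refl a x)) mulrA thetaVr mul1r.
Qed.

(** Invariant elements of [A] are combinations of these, so their commutation with the simple
    generator replaces Bernstein's relation and its quotient. *)
Definition theta_sym x : H := theta x + theta (refl a x).

Lemma comm_theta_sym1 x : <<x, co a>> = 1 -> A * theta_sym x = theta_sym x * A.
Proof.
move=> x1; have e := theta_refl1 x1.
have e1 : theta x * A - theta x * (qdiff q s)%:A = A * theta (refl a x) by rewrite -e mulrBr.
have e2 : A * theta x - (qdiff q s)%:A * theta x = theta (refl a x) * A.
  have -> : theta (refl a x) = A' * theta x * A' by rewrite -mulrA e mulrA A'A mul1r.
  by rewrite -mulrBl -[RHS]mulrA A'A mulr1.
rewrite /theta_sym mulrDr mulrDl -e1 -e2 -(scalerAr (qdiff q s)) -(scalerAl (qdiff q s)) mulr1 mul1r.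
by rewrite addrCA.
Qed.

(** The pairing-2 case, the only nonzero start available when every weight has even pairing with the
    coroot. There [theta a * A'] comes from an affine reflection that raises the length by 1, so
    [N_refl_quad] gives it a quadratic relation, whose parameter [c] may differ from that of [A]. *)
Lemma comm_theta_sym_root : A * theta_sym a = theta_sym a * A.
Proof.
set u := rho2 D - a; have du : dominant u by exact: dominant_rho2B.
have u0 : <<u, co a>> = 0 by exact: rho2B_self.
have lr := len_transl_affine_refl aF; rewrite -/u in lr.
have bR : is_aroot (- a, 1) by exact: opp_root.
have [c hc] := N_refl_quad bR isT lr.
have Nu : N (transl u) = theta u by rewrite theta_dom.
have := hc (theta (- u)); rewrite Nu thetaV thetaVr => /(_ erefl erefl).
have x0 : 0 < <<rho2 D, co a>> by rewrite rho2_simple.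
have lx := len_transl_simple_sub aF x0.
have e1 : theta (rho2 D) = N (transl u * aref (- a, 1%R))%g * A.
  rewrite -transl_affine_refl // (theta_dom (dominant_rho2 (D := D))).
  by rewrite -[in LHS](aref_mulK (transl (rho2 D)) sa) N_simple // aref_mulK.
have {}e1 : theta (- u) * N (transl u * aref (- a, 1%R))%g = theta a * A'.
  have -> : N (transl u * aref (- a, 1%R))%g = theta (rho2 D) * A' by rewrite e1 -mulrA AA' mulr1.
  by rewrite mulrA -thetaD /u opprB subrK.
rewrite e1 => hq2.
(* The inverse of [theta a * A'] is [A * theta (- a)], so the quadratic relation divided by that
   element is linear. *)
have q2 : theta a * A' = c%:A + A * theta (- a).
  have inv : (theta a * A') * (A * theta (- a)) = 1.
    by rewrite mulrA -[theta a * _ * A]mulrA A'A mulr1 thetaV.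
  have := congr1 (fun h => h * (A * theta (- a))) hq2.
  by rewrite /= -[LHS]mulrA inv mulr1 mulrDl -scalerAl inv mul1r.
have rs : refl a a = - a by exact: refl_self.
have e2 : theta a * A - theta a * (qdiff q s)%:A = c%:A + A * theta (- a).
  by rewrite -q2 mulrBr.
have e3 : A * theta a - (qdiff q s)%:A * theta a = c%:A + theta (- a) * A.
  have h : A * theta (- a) = theta a * A' - c%:A by rewrite q2 addrC addKr.
  have h2 : theta (- a) = A' * (theta a * A' - c%:A) by rewrite -h mulrA A'A mul1r.
  have -> : A * theta a - (qdiff q s)%:A * theta a = A' * theta a by rewrite -mulrBl.
  rewrite h2 (mulrBr A') (mulrBl A) -!mulrA A'A mulr1 -(scalerAl c) mul1r -(scalerAr c) A'A.
  by rewrite addrC subrK.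
rewrite /theta_sym rs mulrDr mulrDl.
have -> : A * theta a = c%:A + theta (- a) * A + (qdiff q s)%:A * theta a by rewrite -e3 subrK.
have -> : theta a * A = c%:A + A * theta (- a) + theta a * (qdiff q s)%:A by rewrite -e2 subrK.
rewrite -(scalerAr (qdiff q s)) -(scalerAl (qdiff q s)) mulr1 mul1r addrAC [RHS]addrAC.
by congr (_ + _); exact: addrAC.
Qed.

Lemma theta_sym_refl x : theta_sym (refl a x) = theta_sym x.
Proof. by rewrite /theta_sym reflK // addrC. Qed.

Lemma pair_refl_self x : <<refl a x, co a>> = - <<x, co a>>.
Proof. by rewrite pair_refl corefl_self // pairNr. Qed.

(** Induction on the absolute value of the pairing, through the Chebyshev-like identity [theta_sym x
    = theta_sym (x - a) * theta_sym a - theta_sym (x - 2a)]. At pairing 2, [x - a] is orthogonal to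
    the coroot and the identity collapses to one product. *)
Lemma comm_theta_sym x : A * theta_sym x = theta_sym x * A.
Proof.
have [n hn] : exists n : nat, `|<<x, co a>>|%N = n by eexists.
elim/ltn_ind: n x hn => n IH x hn.
wlog x0 : x hn / 0 <= <<x, co a>>.
  move=> h; have [x0|x0] := leP 0 <<x, co a>>; first exact: h.
  rewrite -theta_sym_refl; apply: h; rewrite pair_refl_self ?abszN //.
  by rewrite oppr_ge0 ltW.
have [e0|n0] := eqVneq <<x, co a>> 0.
  have -> : theta_sym x = theta x + theta x by rewrite /theta_sym /refl e0 mulr0z subr0.
  by rewrite mulrDr mulrDl comm_theta0.
have [e1|n1] := eqVneq <<x, co a>> 1; first exact: comm_theta_sym1.
have r1 : refl a (x - a) = refl a x + a by rewrite reflD reflN refl_self // opprK.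
have [e2|n2] := eqVneq <<x, co a>> 2.
  have -> : theta_sym x = theta (x - a) * theta_sym a.
    rewrite /theta_sym mulrDr -!thetaD subrK refl_self //; congr (_ + theta _).
    by rewrite /refl e2 -pmulrn mulr2n opprD addrA.
  rewrite mulrA comm_theta0 ?pairBl ?e2 ?rd_pair2 ?subrr //.
  by rewrite -!mulrA comm_theta_sym_root.
have sE : theta_sym x = theta_sym (x - a) * theta_sym a - theta_sym (x - a *+ 2).
  have r2 : refl a (x - a *+ 2) = refl a x + a *+ 2.
    by rewrite mulr2n !(reflD, reflN, refl_self) // !opprD !opprK.
  rewrite /theta_sym r1 r2 refl_self // mulrDr !mulrDl -!thetaD subrK addrK.
  have -> : x - a - a = x - a *+ 2 by rewrite mulr2n opprD addrA.
  have -> : refl a x + a + a = refl a x + a *+ 2 by rewrite mulr2n addrA.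
  have perm (u v p r : H) : u + v = u + r + (p + v) - (p + r).
    by rewrite [p + v]addrC addrACA [r + p]addrC addrK.
  exact: perm.
have IH1 : A * theta_sym (x - a) = theta_sym (x - a) * A.
  apply: (IH _ _ _ erefl); move: hn x0 n0 n1 n2; rewrite pairBl rd_pair2 //.
  by set m := <<_, _>>; lia.
have IH2 : A * theta_sym (x - a *+ 2) = theta_sym (x - a *+ 2) * A.
  apply: (IH _ _ _ erefl); move: hn x0 n0 n1 n2; rewrite pairBl pairMnl rd_pair2 //.
  by set m := <<_, _>>; lia.
by rewrite sE (mulrBr A) (mulrBl A) mulrA IH1 IH2 -!mulrA comm_theta_sym_root.
Qed.

End Simple.

Local Notation bern := (bernstein theta).

Lemma finsupp_weyl (p : laurent R D) (u : weyl D) x : laurent_inv p ->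
  (u x \in finsupp p) = (x \in finsupp p).
Proof. by move=> pI; rewrite !mem_finsupp pI. Qed.

Lemma sum_weyl (V : nmodType) (p : laurent R D) (u : weyl D) (F : X -> V) :
  laurent_inv p -> \sum_(x <- finsupp p) F (u x) = \sum_(x <- finsupp p) F x.
Proof.
move=> pI; rewrite -(big_map (weyl_fun u) predT F) /=; apply: perm_big.
have inj : injective (weyl_fun u) by apply: (can_inj (g := weyl_fun u^-1%g)) => x; exact: weylKV.
apply: uniq_perm; rewrite ?map_inj_uniq ?fset_uniq //.
apply: (uniq_min_size _ _ _).2; rewrite ?map_inj_uniq ?fset_uniq ?size_map //.
by move=> _ /mapP [x xp ->]; rewrite finsupp_weyl.
Qed.

Lemma bern_comm_theta (p : laurent R D) x : theta x * bern p = bern p * theta x.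
Proof.
rewrite /bernstein mulr_sumr mulr_suml; apply: eq_bigr => y _.
by rewrite -scalerAr -scalerAl theta_comm.
Qed.

(** Doubling the sum groups [x] with its reflection without choosing representatives of the
    orbits. *)
Lemma bern_comm_simple (p : laurent R D) a : laurent_inv p -> a \in F0 ->
  N (aref (a, 0)) * bern p = bern p * N (aref (a, 0)).
Proof.
move=> pI aF; have aR := simple_root aF.
have e : bern p + bern p = \sum_(x <- finsupp p) p x *: theta_sym a x.
  rewrite /bernstein -{2}(sum_weyl (wref a) (fun x => p x *: theta x) pI) -big_split.
  by apply: eq_bigr => x _; rewrite pI wrefE // /theta_sym scalerDr.
have c2 : N (aref (a, 0)) * (bern p + bern p) = (bern p + bern p) * N (aref (a, 0)).
  rewrite e mulr_sumr mulr_suml; apply: eq_bigr => x _.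
  by rewrite -(scalerAr (p x)) -(scalerAl (p x)) comm_theta_sym.
have b2 : bern p = 2^-1 *: (bern p + bern p).
  by rewrite -mulr2n -(scaler_nat 2 (bern p)) scalerA mulVf ?scale1r // pnatr_eq0.
by rewrite b2 -(scalerAr (2^-1)) -(scalerAl (2^-1)) c2.
Qed.

(** An element of length 0 preserves positive roots, hence dominance, and lengths add with any
    translation; differences of dominant weights give the rest. *)
Lemma len0_theta (u : weyl D) x : len (wlin u) = 0%N ->
  T (wlin u) * theta x = theta (u x) * T (wlin u).
Proof.
move=> u0.
have domu z : dominant z -> dominant (u z).
  move=> dz a /pos_rootP [aR pa]; rewrite -[a](weylVK u).
  set b := weyl_fun _ a; have bR : b \in rd_roots D by rewrite -(weyl_root u) weylVK.
  rewrite weyl_coroot //; apply: dominant_pair => //.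
  have := @invs0 _ (wlin u)^-1%g (a, 0); rewrite lenV => /(_ u0 aR).
  by rewrite wlinV aact_wlin /apos /= pa; apply.
have dom z : dominant z -> T (wlin u) * theta z = theta (u z) * T (wlin u).
  move=> dz; rewrite (theta_dom dz) (theta_dom (domu _ dz)) -(N_len0 u0) !NM ?wlin_transl //.
    by rewrite len0Mr // u0 addn0.
  by rewrite -wlin_transl len0Ml // u0.
have [y [z [dy dz ->]]] := dominant_diff x.
have e : theta (u z) * (T (wlin u) * theta (- z)) = T (wlin u).
  by rewrite mulrA -dom // -mulrA thetaV mulr1.
have {}e : T (wlin u) * theta (- z) = theta (- u z) * T (wlin u).
  by rewrite -[in RHS]e mulrA thetaVr mul1r.
by rewrite weylB !thetaD mulrA dom // -mulrA e mulrA.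
Qed.

Lemma bern_comm_weyl (p : laurent R D) (u : weyl D) : laurent_inv p ->
  T (wlin u) * bern p = bern p * T (wlin u).
Proof.
move=> pI; move: {2}(len (wlin u)) (erefl (len (wlin u))) => n.
elim: n u => [|n IH] u un.
  rewrite {2}/bernstein -(sum_weyl u (fun x => p x *: theta x) pI) /bernstein.
  rewrite mulr_sumr mulr_suml; apply: eq_bigr => x _.
  by rewrite -(scalerAr (p x)) -(scalerAl (p (u x))) pI len0_theta.
have [|a aF na] := weyl_not_pos (u := u); first by rewrite un.
have := len_wlin_simple u aF; rewrite (negPf na) un => -[l].
have sa := asimple_fin aF.
have e : (wlin u = wlin (u * wref a) * aref (a, 0%R))%g.
  by rewrite -wlin_mul -aref_wlin aref_mulK.
rewrite e -(@TM _ _ _ H); last by rewrite -e un len_aref // addn1 l.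
have cs : T (aref (a, 0)) * bern p = bern p * T (aref (a, 0)).
  by rewrite (T_N hqq hq) -scalerAl -scalerAr bern_comm_simple.
by rewrite -mulrA cs mulrA IH // mulrA.
Qed.

(** For generators [t] accessible only through a product [t * t'] with [t'] invertible. *)
Lemma comm_cancel (z t t' : H) : invertible t' -> t * t' * z = z * (t * t') -> t' * z = z * t' ->
  t * z = z * t.
Proof.
move=> [i [e1 e2]] c1 c2; rewrite -[LHS]mulr1 -e1 mulrA -[t * z * t']mulrA -c2.
by rewrite [t * _]mulrA c1 -!mulrA e1 mulr1.
Qed.

Lemma T_invertible w : invertible (T w).
Proof.
have [i [e1 e2]] := N_invertible w; set r := (Num.sqrt (q w))%:C.
have r0 : r != 0 by rewrite (fmorph_eq0 (real_complex R)) (sqrtq_neq0 hqq hq).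
exists (r^-1 *: i); rewrite (T_N hqq hq) -/r.
by rewrite -!(scalerAl r) -!(scalerAr r^-1) -(scalerAl r^-1) -(scalerAr r) e1 e2 !scalerA mulfV ?mulVf // !scale1r.
Qed.

Lemma bern_comm_dom (p : laurent R D) x : dominant x ->
  T (transl x) * bern p = bern p * T (transl x).
Proof.
move=> dx; rewrite (T_N hqq hq) -theta_dom // -scalerAl -scalerAr.
by rewrite bern_comm_theta.
Qed.

(** On generators. Those of length 0 and the affine simple ones become, after multiplication by a
    basis element of W_0, the basis element of a dominant translation, which is a multiple of some
    [theta x]. *)
Theorem bern_central (p : laurent R D) h : laurent_inv p -> h * bern p = bern p * h.
Proof.
move=> pI; move: h; apply: (hecke_gen (P := fun h => h * bern p = bern p * h)) => [c h h' IH IH'|h h' IH IH'|w w0|b sb].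
- by rewrite mulrDl mulrDr -(scalerAl c) -(scalerAr c) IH IH'.
- by rewrite -mulrA IH' !mulrA IH.
- have [dx [e l]] := len0_dominant w0.
  apply: (@comm_cancel _ _ (T (wlin (aw_lin w)^-1%g))); first exact: T_invertible.
    by rewrite (@TM _ _ _ H) // e bern_comm_dom.
  exact: bern_comm_weyl.
- case: b sb => a k [] /= [h ->].
    by rewrite aref_wlin bern_comm_weyl.
  have [l [e dx]] := len_minimal_refl h.
  apply: (@comm_cancel _ _ (T (wlin (wref a)))); first exact: T_invertible.
    by rewrite (@TM _ _ _ H) // e bern_comm_dom.
  exact: bern_comm_weyl.
Qed.

End Bernstein.

(** * Laurent polynomials and the involution on the center *)

Section Laurent.
Variables (R : realType) (D : root_datum).
Local Notation X := (rd_X D).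
Local Notation C := R[i].
Implicit Types (p r : laurent R D) (x y z : X) (c : C).

Definition lcomb c p r : laurent R D :=
  [fsfun x in (finsupp p `|` finsupp r)%fset => c * p x + r x].

Definition lmulp p r : laurent R D :=
  [fsfun z in [fset (x + y)%R | x in finsupp p, y in finsupp r]%fset =>
    \sum_(x <- finsupp p) p x * r (z - x)].

Definition lstar p : laurent R D :=
  [fsfun x in [fset (- x)%R | x in finsupp p]%fset => conjc (p (- x))].

Definition lmono x : laurent R D := [fsfun y in [fset x]%fset => 1].

Lemma lcombE c p r x : lcomb c p r x = c * p x + r x.
Proof.
rewrite fsfunE in_fsetU; case: ifP => // /negbT; rewrite negb_or !mem_finsupp !negbK.
by move=> /andP [/eqP -> /eqP ->]; rewrite mulr0 addr0.
Qed.

Lemma lmulpE p r z : lmulp p r z = \sum_(x <- finsupp p) p x * r (z - x).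
Proof.
rewrite fsfunE; case: ifPn => // zn; rewrite big_seq big1 // => x xp.
have [|e] := boolP (z - x \in finsupp r).
  move=> zr; case/negP: zn; apply/imfset2P; exists x => //; exists (z - x) => //.
  by rewrite addrC subrK.
by move: e; rewrite mem_finsupp negbK => /eqP ->; rewrite mulr0.
Qed.

Lemma lstarE p x : lstar p x = conjc (p (- x)).
Proof.
rewrite fsfunE; case: ifPn => // xn; have [xp|] := boolP (- x \in finsupp p).
  by case/negP: xn; apply/imfsetP; exists (- x); rewrite ?opprK.
by rewrite mem_finsupp negbK => /eqP ->; rewrite conjc0.
Qed.

Lemma lmonoE x y : lmono x y = (y == x)%:R.
Proof. by rewrite fsfunE in_fset1; case: eqP. Qed.

Section Sums.
Variable V : lmodType C.
Variable F : X -> V.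

(** Both [bernstein] and [laurent_eval] are instances, so the rules for sums and products are proved
    once. *)
Definition lsum p : V := \sum_(x <- finsupp p) p x *: F x.

Lemma lsum_sub p (S : {fset X}) : (finsupp p `<=` S)%fset ->
  lsum p = \sum_(x <- S) p x *: F x.
Proof.
move=> sub; apply: big_fset_incl => // x _.
by rewrite mem_finsupp negbK => /eqP ->; rewrite scale0r.
Qed.

Lemma lsum_comb c p r : lsum (lcomb c p r) = c *: lsum p + lsum r.
Proof.
set S := (finsupp p `|` finsupp r)%fset.
rewrite (@lsum_sub _ S); last first.
  apply/fsubsetP => x; rewrite in_fsetU !mem_finsupp lcombE.
  by apply: contraNT; rewrite negb_or !negbK => /andP [/eqP -> /eqP ->]; rewrite mulr0 addr0.
rewrite (@lsum_sub p S) ?fsubsetUl // (@lsum_sub r S) ?fsubsetUr // scaler_sumr -big_split.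
by apply: eq_bigr => x _; rewrite lcombE scalerDl scalerA.
Qed.

Lemma lsum_mono x : lsum (lmono x) = F x.
Proof.
rewrite (@lsum_sub _ [fset x]%fset) ?big_seq_fset1 ?lmonoE ?eqxx ?scale1r //.
apply/fsubsetP => y; rewrite mem_finsupp lmonoE in_fset1.
by case: (y == x); rewrite ?eqxx.
Qed.

Lemma lsum_mul p r : lsum (lmulp p r) =
  \sum_(x <- finsupp p) \sum_(y <- finsupp r) (p x * r y) *: F (x + y).
Proof.
set S := [fset (x + y)%R | x in finsupp p, y in finsupp r]%fset.
rewrite (@lsum_sub _ S); last first.
  apply/fsubsetP => z; rewrite mem_finsupp; apply: contraNT => zn.
  by rewrite fsfunE (negPf zn).
under eq_bigr => z _ do rewrite lmulpE scaler_suml.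
rewrite exchange_big /= big_seq [RHS]big_seq; apply: eq_bigr => x xp.
have inj : {in finsupp r &, injective (fun y => x + y)} by move=> y y' _ _ /addrI.
under [RHS]eq_bigr => y _ do rewrite -[X in r X](addrK x) [y + x]addrC.
have := big_imfset +%R imfset_key (fun z => (p x * r (z - x)) *: F z) inj; rewrite /= => <-.
apply/esym/big_fset_incl.
  apply/fsubsetP => _ /imfsetP [y yr ->]; apply/imfset2P.
  by exists x => //; exists y.
move=> z _ zn; have [zr|] := boolP (z - x \in finsupp r).
  by case/negP: zn; apply/imfsetP; exists (z - x) => //=; rewrite addrC subrK.
by rewrite mem_finsupp negbK => /eqP ->; rewrite mulr0 scale0r.
Qed.

End Sums.

Lemma lcomb_inv c p r : laurent_inv p -> laurent_inv r -> laurent_inv (lcomb c p r).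
Proof. by move=> pI rI w x; rewrite !lcombE pI rI. Qed.

Lemma lmulp_inv p r : laurent_inv p -> laurent_inv r -> laurent_inv (lmulp p r).
Proof.
move=> pI rI w z; rewrite !lmulpE -(sum_weyl w _ pI).
by apply: eq_bigr => x _; rewrite pI -weylB rI.
Qed.

Lemma lstar_inv p : laurent_inv p -> laurent_inv (lstar p).
Proof. by move=> pI w x; rewrite !lstarE -weylN pI. Qed.

Lemma laurent_eval_lsum p (t : torus R D) :
  laurent_eval p t = lsum (fun x => (t x : C^o)) p.
Proof. by []. Qed.

Lemma torus0 (t : torus R D) : t 0 = 1.
Proof.
have [t0 tD] := torus_funP t; have := tD 0 0; rewrite addr0 -[LHS]mulr1 => /(mulfI (t0 0)).
by [].
Qed.

Lemma torusD (t : torus R D) x y : t (x + y) = t x * t y.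
Proof. by have [_ ->] := torus_funP t. Qed.

Lemma eval_comb c p r (t : torus R D) :
  laurent_eval (lcomb c p r) t = c * laurent_eval p t + laurent_eval r t.
Proof. exact: lsum_comb. Qed.

Lemma eval_mul p r (t : torus R D) :
  laurent_eval (lmulp p r) t = laurent_eval p t * laurent_eval r t.
Proof.
rewrite [LHS]lsum_mul /laurent_eval mulr_suml; apply: eq_bigr => x _.
rewrite mulr_sumr; apply: eq_bigr => y _; rewrite torusD.
by rewrite -[LHS]/(p x * r y * (t x * t y)); ring.
Qed.

Lemma eval_mono x (t : torus R D) : laurent_eval (lmono x) t = t x.
Proof. exact: lsum_mono. Qed.

Lemma lmono0_inv : laurent_inv (lmono 0).
Proof.
move=> w x; rewrite !lmonoE; congr (_ %:R); congr nat_of_bool.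
by apply/eqP/eqP => [e|->]; [rewrite -[x](weylKV w) e weyl0|rewrite weyl0].
Qed.

Definition weyl_seq : seq (weyl D) := enum_fset (fset_set [set: weyl D]).

Lemma mem_weyl_seq (w : weyl D) : w \in weyl_seq.
Proof. by rewrite in_fset_set ?inE //; exact: weyl_finite. Qed.

Lemma weyl_seq_uniq : uniq weyl_seq.
Proof. exact: fset_uniq. Qed.

Lemma sum_weyl_seq (V : nmodType) (G : weyl D -> V) (u : weyl D) :
  \sum_(w <- weyl_seq) G (w * u)%g = \sum_(w <- weyl_seq) G w.
Proof.
rewrite -(big_map (fun w => w * u)%g predT G) /=; apply: perm_big.
have inj : injective (fun w : weyl D => (w * u)%g) by apply: mulIg.
apply: uniq_perm; rewrite ?map_inj_uniq ?weyl_seq_uniq // => w.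
rewrite mem_weyl_seq; apply/mapP; exists (w * u^-1)%g; first exact: mem_weyl_seq.
by rewrite -mulgA mulVg mulg1.
Qed.

(** Orbit points are counted with the order of the stabilizer, so that evaluation is the plain sum
    over W_0 ([eval_orbit]). *)
Definition lorbit x : laurent R D :=
  [fsfun y in [fset (weyl_fun w x) | w in weyl_seq]%fset =>
    \sum_(w <- weyl_seq) (w x == y)%:R].

Lemma lorbitE x y : lorbit x y = \sum_(w <- weyl_seq) (w x == y)%:R.
Proof.
rewrite fsfunE; case: ifPn => // yn; rewrite big1 // => w _.
case: eqP => // e; case/negP: yn; apply/imfsetP; exists w => //.
exact: mem_weyl_seq.
Qed.

Lemma lorbit_inv x : laurent_inv (lorbit x).
Proof.
move=> u y; rewrite !lorbitE -[RHS](sum_weyl_seq _ 1%g).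
have inj : injective (weyl_fun u) by apply: (can_inj (g := weyl_fun u^-1%g)) => z; exact: weylKV.
pose G (w : weyl D) : C := (w x == u y)%:R.
have -> : \sum_(w <- weyl_seq) (w x == u y)%:R = \sum_(w <- weyl_seq) G (u * w)%g.
  rewrite -(big_map (fun w => u * w)%g predT G) /=; apply: perm_big.
  apply: uniq_perm; rewrite ?map_inj_uniq ?weyl_seq_uniq //; first exact: mulgI.
  move=> w. rewrite mem_weyl_seq; apply/esym/mapP; exists (u^-1 * w)%g; first exact: mem_weyl_seq.
  by rewrite mulgA mulgV mul1g.
by apply: eq_bigr => w _; rewrite /G mulg1 (inj_eq inj).
Qed.

Lemma eval_orbit x (t : torus R D) :
  laurent_eval (lorbit x) t = \sum_(w <- weyl_seq) t (w x).
Proof.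
rewrite laurent_eval_lsum (lsum_sub _ (S := [fset (weyl_fun w x) | w in weyl_seq]%fset)).
  under eq_bigr => y _ do rewrite lorbitE scaler_suml.
  rewrite exchange_big /=; apply: eq_bigr => w _.
  rewrite (big_fsetD1 (w x)) /=; last by apply/imfsetP; exists w => //; exact: mem_weyl_seq.
  rewrite eqxx scale1r [X in _ + X]big1_fset ?addr0 // => y.
  by rewrite in_fsetD1 eq_sym => /andP [/negPf -> _] _; rewrite scale0r.
apply/fsubsetP => y; rewrite mem_finsupp; apply: contraNT => yn.
by rewrite fsfunE (negPf yn).
Qed.

End Laurent.

(** * The star on Bernstein's center *)

Section StarCenter.
Variables (R : realType) (D : root_datum) (qq : R) (f q : affweyl D -> R).
Hypotheses (hqq : 1 < qq) (hq : is_weight qq f q).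
Variable H : hecke_algebra q.
Local Notation X := (rd_X D).
Local Notation W := (affweyl D).
Local Notation N := (@hecke_N R D q H).
Local Notation star := (@hecke_star R D q H).
Variable theta : X -> H.
Hypothesis htheta : is_theta theta.
Local Notation bern := (bernstein theta).
Implicit Types (p r : laurent R D) (x y : X).
Let NM := @NM R D qq f q hqq hq H.

Lemma bern_comb c p r : bern (lcomb c p r) = c *: bern p + bern r.
Proof. exact: lsum_comb. Qed.

Lemma bern_mul p r : bern (lmulp p r) = bern p * bern r.
Proof.
rewrite [LHS]lsum_mul [in RHS]/bernstein mulr_suml; apply: eq_bigr => x _.
rewrite mulr_sumr; apply: eq_bigr => y _; rewrite (thetaD htheta).
by rewrite -(scalerAl (p x)) -(scalerAr (r y)) scalerA.
Qed.

Lemma bern_mono x : bern (lmono R x) = theta x.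
Proof. exact: lsum_mono. Qed.

Lemma star_N w : star (N w) = N w^-1%g.
Proof. by rewrite /hecke_N starZ hecke_starT conjc_real (qV hq). Qed.

Lemma translV x : (transl x)^-1%g = transl (- x) :> W.
Proof.
have h : (transl x * transl (- x))%g = 1%g :> W by rewrite transl_mul subrr.
by rewrite -[LHS]mulg1 -h mulgA mulVg mul1g.
Qed.

Section Longest.
Variable u : weyl D.
Hypothesis hu : forall a, a \in rd_roots D -> rpos (u a) = ~~ rpos a.
Let V := N (wlin u^-1%g).

(** For dominant weights both sides are the normalized basis element of one group element; a general
    weight is a difference of dominant ones, and inverses follow. *)
Lemma star_theta x : star (theta x) * V = V * theta (- u x).
Proof.
have dom y : dominant y -> star (theta y) * V = V * theta (- u y).
  move=> dy; have [l1 l2] := len_transl_longest hu dy.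
  rewrite (theta_dom htheta dy) (theta_dom htheta (dominant_longest hu dy)).
  by rewrite star_N translV /V !NM // transl_longest.
have [y [z [dy dz ->]]] := dominant_diff x.
have e1 : star (theta (- z)) * star (theta z) = 1.
  by rewrite -hecke_starM (thetaV htheta) star1.
have e : star (theta (- z)) * V = V * theta (u z).
  by rewrite -[V in LHS]mulr1 -(thetaVr htheta (u z)) [V * _]mulrA -dom // !mulrA e1 mul1r.
rewrite (thetaD htheta) hecke_starM -mulrA.
have -> : theta (- u (y - z)) = theta (u z) * theta (- u y).
  by rewrite -(thetaD htheta) weylB opprB.
by rewrite dom // mulrA e mulrA.
Qed.

End Longest.

(** Up to conjugation by the invertible [V], the star sends [theta x] to [theta (- u x)]. Invariance
    of the coefficients absorbs [u], and centrality of the result removes [V]. *)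
Theorem star_bern p : laurent_inv p -> star (bern p) = bern (lstar p).
Proof.
move=> pI; have [u hu] := longest_weyl D; set V := N (wlin u^-1%g).
have [V' [VV' _]] := N_invertible hqq hq H (wlin u^-1%g); rewrite -/V in VV'.
suff h : star (bern p) * V = bern (lstar p) * V.
  by rewrite -[LHS]mulr1 -VV' mulrA h -mulrA VV' mulr1.
rewrite -(bern_central hqq hq htheta V (lstar_inv pI)).
rewrite {1}/bernstein star_sum mulr_suml.
have -> : bern (lstar p) = \sum_(x <- finsupp p) conjc (p x) *: theta (- x).
  have injN : {in finsupp p &, injective (fun x : X => - x)} by move=> x y _ _ /oppr_inj.
  have := big_imfset +%R imfset_key (fun x => lstar p x *: theta x) injN => /= e.
  under [RHS]eq_bigr => x _ do rewrite -[x in conjc (p x)]opprK -lstarE.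
  rewrite -e; apply: lsum_sub; apply/fsubsetP => x; rewrite mem_finsupp lstarE => h.
  apply/imfsetP; exists (- x); rewrite ?opprK //= mem_finsupp.
  by apply: contraNN h => /eqP ->; rewrite conjc0.
rewrite -(sum_weyl u (fun x => conjc (p x) *: theta (- x)) pI) mulr_sumr.
apply: eq_bigr => x _; rewrite pI starZ -(scalerAl (conjc (p x))) -(scalerAr (conjc (p x))).
by rewrite star_theta.
Qed.

End StarCenter.

(** * Operators on the Hilbert completion *)

Section CauchySchwarz.
Variable K : rcfType.
Local Notation C := K[i].

Lemma ReCD (x y : C) : complex.Re (x + y) = complex.Re x + complex.Re y.
Proof. by case: x y => [? ?] [? ?]. Qed.
Lemma ImCD (x y : C) : complex.Im (x + y) = complex.Im x + complex.Im y.
Proof. by case: x y => [? ?] [? ?]. Qed.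
Lemma ReCN (x : C) : complex.Re (- x) = - complex.Re x.
Proof. by case: x. Qed.
Lemma ImCN (x : C) : complex.Im (- x) = - complex.Im x.
Proof. by case: x. Qed.
Lemma ReCM (x y : C) : complex.Re (x * y) =
  complex.Re x * complex.Re y - complex.Im x * complex.Im y.
Proof. by case: x y => [? ?] [? ?]. Qed.
Lemma ImCM (x y : C) : complex.Im (x * y) =
  complex.Re x * complex.Im y + complex.Im x * complex.Re y.
Proof. by case: x y => [? ?] [? ?]. Qed.
Lemma ReCJ (x : C) : complex.Re (conjc x) = complex.Re x.
Proof. by case: x. Qed.
Lemma ImCJ (x : C) : complex.Im (conjc x) = - complex.Im x.
Proof. by case: x. Qed.

Lemma complex_ext (x y : C) :
  complex.Re x = complex.Re y -> complex.Im x = complex.Im y -> x = y.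
Proof. by case: x y => [? ?] [? ?] /= -> ->. Qed.

Lemma ge0_complexE (x : C) : (0 <= x) = (complex.Im x == 0) && (0 <= complex.Re x).
Proof. by rewrite lecE. Qed.

Lemma ge0_ReC (x : C) : 0 <= x -> x = (complex.Re x)%:C.
Proof. by rewrite ge0_complexE => /andP [/eqP i0 _]; apply: complex_ext. Qed.

Variables (V : lmodType C) (B : V -> V -> C).
Hypothesis BD : forall (c : C) u v w, B u (c *: v + w) = c * B u v + B u w.
Hypothesis BC : forall u v, B u v = conjc (B v u).
Hypothesis B0 : forall u, 0 <= B u u.

Lemma cauchy_schwarz u v : `|B u v| ^+ 2 <= B u u * B v v.
Proof.
set a := complex.Re (B u u); set d := complex.Re (B v v); set b := B u v.
have aE : B u u = a%:C := ge0_ReC (B0 u).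
have dE : B v v = d%:C := ge0_ReC (B0 v).
have a0 : 0 <= a by have := B0 u; rewrite aE ler0c.
have d0 : 0 <= d by have := B0 v; rewrite dE ler0c.
have nb : `|b| ^+ 2 = (complex.Re b ^+ 2 + complex.Im b ^+ 2)%:C by rewrite add_Re2_Im2.
set m := complex.Re b ^+ 2 + complex.Im b ^+ 2 in nb.
have m0 : 0 <= m by rewrite addr_ge0 ?sqr_ge0.
(* Only the multiples [- k B(u,v)] of [u] are tried, with [k] real, so one real quadratic polynomial
   carries the inequality. *)
have key (k : K) : 0 <= k ^+ 2 * m * a - 2 * k * m + d.
  pose c : C := - k%:C * b.
  have := B0 (c *: u + v).
  rewrite BD (BC (c *: u + v) u) (BC (c *: u + v) v) !BD aE dE (BC v u) -/b.
  rewrite ge0_complexE => /andP [_]; congr (0 <= _).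
  rewrite /c !(ReCD, ImCD, ReCM, ImCM, ReCN, ImCN, ReCJ, ImCJ) /= /m.
  by ring.
rewrite nb aE dE -rmorphM lecR.
have [e|a1] := eqVneq a 0.
  (* With no quadratic term, this [k] makes the polynomial equal to -1 unless [m] is 0. *)
  rewrite e mul0r; have := key ((d + 1) / (2 * m)).
  have [->//|mn0] := eqVneq m 0.
  rewrite e mulr0 add0r; have -> : 2 * ((d + 1) / (2 * m)) * m = d + 1 by field.
  by lra.
have {a0 a1} a0 : 0 < a by rewrite lt_neqAle eq_sym a1.
have := key a^-1; have -> : a^-1 ^+ 2 * m * a - 2 * a^-1 * m + d = (a * d - m) / a.
  by field; rewrite gt_eqF.
by rewrite pmulr_lge0 ?invr_gt0 // subr_ge0.
Qed.

End CauchySchwarz.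

Section RealNorm.
Variables (R : realType).
Local Notation C := R[i].

(** Norms over [R[i]] take values in [R[i]]; their real part allows ordinary real estimates. *)
Definition nr (V : normedModType C) (u : V) : R := complex.Re `|u|.

Variable V : normedModType C.
Implicit Types u v : V.

Lemma nrE u : `|u| = (nr u)%:C.
Proof. exact/ge0_ReC. Qed.

Lemma nr_ge0 u : 0 <= nr u.
Proof. by rewrite -ler0c -nrE. Qed.

Lemma nrD u v : nr (u + v) <= nr u + nr v.
Proof. by rewrite -lecR rmorphD /= -!nrE; exact: ler_normD. Qed.

Lemma nr0 : nr (0 : V) = 0.
Proof. by rewrite /nr normr0. Qed.

Lemma nr0_eq0 u : nr u = 0 -> u = 0.
Proof. by move=> u0; apply/eqP; rewrite -normr_eq0 nrE u0. Qed.

Lemma nrN u : nr (- u) = nr u.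
Proof. by rewrite /nr normrN. Qed.

Lemma nrB u v : nr (u - v) = nr (v - u).
Proof. by rewrite -nrN opprB. Qed.

Lemma nr_tri u v w : nr (u - w) <= nr (u - v) + nr (v - w).
Proof. by rewrite (le_trans _ (nrD _ _)) // addrA subrK. Qed.

Lemma nrZ (c : C) u : nr (c *: u) = complex.Re `|c| * nr u.
Proof.
apply: complexI; rewrite rmorphM /= -!nrE normrZ; congr (_ * _).
Qed.

Lemma nr_small u : (forall e : R, 0 < e -> nr u <= e) -> u = 0.
Proof.
move=> h; apply: nr0_eq0; apply/eqP; rewrite eq_le nr_ge0 andbT.
by apply/ler_addgt0Pr => e e0; rewrite add0r h.
Qed.

End RealNorm.

(** Completeness with a rate: the limit inherits the bound of the Cauchy estimate. *)
Lemma seq_lim (R : realType) (V : completeNormedModType R[i]) (s : nat -> V) (e : nat -> R) :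
  (forall d, 0 < d -> exists n, e n < d) ->
  (forall n m, (n <= m)%N -> nr (s m - s n) <= e n) ->
  exists v, forall n, nr (v - s n) <= e n.
Proof.
move=> e0 se.
have : cvg (s @ \oo).
  suff : cauchy_ex (s @ \oo) by move=> /cauchy_exP; exact: cauchy_cvg.
  move=> d d0; have [|n en] := e0 (complex.Re d); first by move: d0; rewrite ltcE => /andP [].
  have dE : d = (complex.Re d)%:C by apply/ge0_ReC/ltW.
  exists (s n), n => // m /= nm; rewrite -ball_normE /= nrE dE ltcR nrB.
  by apply: le_lt_trans en; exact: se.
rewrite cvg_ex => -[v sv]; exists v => n; apply/ler_addgt0Pr => d d0.
move/cvgrPdist_le: sv => /(_ d%:C); rewrite ltcR => /(_ d0) [N _ /(_ (maxn N n))].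
rewrite /= leq_maxl nrE lecR => /(_ isT) h.
by apply: le_trans (nr_tri _ (s (maxn N n)) _) _; rewrite addrC lerD // se // leq_maxr.
Qed.

Section Operators.
Variables (R : realType) (D : root_datum) (qq : R) (f q : affweyl D -> R).
Hypotheses (hqq : 1 < qq) (hq : is_weight qq f q).
Variable H : hecke_algebra q.
Variable E : hilbert_completion H.
Local Notation C := R[i].
Local Notation emb := (@hilb_emb R D q H E).
Local Notation dot := (@hilb_dot R D q H E).
Local Notation star := (@hecke_star R D q H).
Local Notation tau := (hecke_tau H).
Implicit Types (u v w : E) (x y h : H) (A B : E -> E).

Lemma dotP (c : C) u v w : dot u (c *: v + w) = c * dot u v + dot u w.
Proof. exact: hilb_dotP. Qed.
Lemma dotC u v : dot u v = conjc (dot v u).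
Proof. exact: hilb_dotC. Qed.
Lemma dot_nr u : dot u u = (nr u ^+ 2)%:C.
Proof. by rewrite -hilb_norm nrE rmorphXn. Qed.
Lemma dot_emb x y : dot (emb x) (emb y) = tau (star x * y).
Proof. exact: hilb_embE. Qed.
Lemma dot_cs u v : complex.Re `|dot u v| <= nr u * nr v.
Proof.
have d0 w : 0 <= dot w w by rewrite dot_nr ler0c sqr_ge0.
have := cauchy_schwarz dotP dotC d0 u v; rewrite !dot_nr -rmorphM /= -exprMn.
have -> : `|dot u v| = (complex.Re `|dot u v|)%:C by exact/ge0_ReC.
rewrite -rmorphXn lecR ler_sqr ?nnegrE //; last by rewrite mulr_ge0 ?nr_ge0.
by have := normr_ge0 (dot u v); rewrite ge0_complexE => /andP [].
Qed.

Lemma emb_dense u (e : R) : 0 < e -> exists x, nr (u - emb x) < e.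
Proof.
move=> e0; have : closure (range emb) u by rewrite hilb_dense.
move=> /(_ (ball u e%:C)) [|v [[x _ <-]]].
  by apply: nbhsx_ballx; rewrite ltcR.
by rewrite -ball_normE /= nrE ltcR => h; exists x.
Qed.

Definition linop A := forall (c : C) u v, A (c *: u + v) = c *: A u + A v.

Lemma linop0 A : linop A -> A 0 = 0.
Proof. by move=> lA; have := lA (- 1) 0 0; rewrite scaler0 addr0 scaleN1r addNr. Qed.
Lemma linopB A u v : linop A -> A (u - v) = A u - A v.
Proof. by move=> lA; rewrite addrC -scaleN1r lA scaleN1r addrC. Qed.
Lemma linopZ A (c : C) u : linop A -> A (c *: u) = c *: A u.
Proof. by move=> lA; rewrite -[c *: u]addr0 lA linop0 // addr0. Qed.

Lemma inv_small (M d : R) : 0 <= M -> 0 < d -> exists n : nat, M / n.+1%:R < d.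
Proof.
move=> M0 d0; exists (Num.truncn (M / d)); rewrite ltr_pdivrMr // mulrC -ltr_pdivrMr //.
exact: truncnS_gt.
Qed.

(** The value at [u] is pinned down by an inequality against [f0 x] for every [x]. Linearity and the
    bound then follow by approximating, without comparing sequences. *)
Lemma extension (f0 : H -> E) (M : R) : 0 <= M ->
  (forall c x y, f0 (c *: x + y) = c *: f0 x + f0 y) ->
  (forall x, nr (f0 x) <= M * nr (emb x)) ->
  exists A, [/\ linop A, forall u, nr (A u) <= M * nr u & forall x, A (emb x) = f0 x].
Proof.
move=> M0 lf bf.
have fB x y : f0 (x - y) = f0 x - f0 y by rewrite addrC -scaleN1r lf scaleN1r addrC.
have lip x y : nr (f0 x - f0 y) <= M * nr (emb x - emb y) by rewrite -fB -linearB.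
have ex u : exists v, forall x, nr (v - f0 x) <= M * nr (u - emb x).
  have /choice [s hs] : forall n : nat, exists x, nr (u - emb x) < n.+1%:R^-1.
    by move=> n; apply: emb_dense; rewrite invr_gt0 ltr0n.
  have [d d0|n m nm|v hv] := @seq_lim _ E (f0 \o s) (fun n => M * 2 / n.+1%:R).
  - by apply: inv_small => //; rewrite mulr_ge0.
  - apply: le_trans (lip _ _) _; rewrite -mulrA; apply: ler_wpM2l => //.
    apply: le_trans (nr_tri _ u _) _; rewrite nrB mulr2n mulrDl mul1r.
    apply: lerD; last exact/ltW/hs.
    by apply: le_trans (ltW (hs m)) _; rewrite lef_pV2 ?posrE ?ltr0n // ler_nat.
  exists v => x; apply/ler_addgt0Pr => d d0.
  have [|n hn] := @inv_small (M * 3) d _ d0; first by rewrite mulr_ge0.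
  apply: le_trans (nr_tri _ (f0 (s n)) _) _.
  have h1 := hv n; have h2 := lip (s n) x.
  have h3 : nr (emb (s n) - emb x) <= n.+1%:R^-1 + nr (u - emb x).
    by apply: le_trans (nr_tri _ u _) _; rewrite lerD2r nrB; exact/ltW/hs.
  have h4 := ler_wpM2l M0 h3; rewrite mulrDr in h4.
  rewrite /= in h1; move: h1 h2 h4 hn; set t := n.+1%:R^-1; lra.
have [A hA] := choice ex.
have Ae x : A (emb x) = f0 x.
  apply/eqP; rewrite -subr_eq0; apply/eqP/nr0_eq0/eqP; rewrite eq_le nr_ge0 andbT.
  by have := hA (emb x) x; rewrite subrr nr0 mulr0.
have f00 : f0 0 = 0 by have := fB 0 0; rewrite !subrr.
exists A; split => // [c u v|u]; last first.
  have := hA u 0; rewrite f00 (linear0 emb : emb 0 = 0 :> E) (subr0 (u : E)) (subr0 (A u : E)); exact.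
apply/eqP; rewrite -subr_eq0; apply/eqP/nr_small => d d0.
set k := complex.Re `|c|; have k0 : 0 <= k.
  by have := normr_ge0 c; rewrite ge0_complexE => /andP [].
(* The errors add up to [2 M (k + 1) e]; the added 1 keeps the denominator positive when [M] is
   0. *)
pose e := d / (2 * (M * (k + 1)) + 1).
have p0 : 0 < 2 * (M * (k + 1)) + 1.
  by rewrite ltr_wpDl // mulr_ge0 // mulr_ge0 // addr_ge0.
have e0 : 0 < e by rewrite divr_gt0.
have [x hx] := emb_dense u e0; have [y hy] := emb_dense v e0.
have -> : A (c *: u + v) - (c *: A u + A v) =
    (A (c *: u + v) - f0 (c *: x + y)) + (c *: (f0 x - A u) + (f0 y - A v)).
  by rewrite lf scalerBr [X in _ = _ + X]addrACA -opprD addrA subrK.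
have h1 : nr (A (c *: u + v) - f0 (c *: x + y)) <= M * (k * e + e).
  apply: le_trans (hA _ _) _; apply: ler_wpM2l => //.
  rewrite linearP opprD addrACA -scalerBr; apply: le_trans (nrD _ _) _.
  by rewrite nrZ -/k lerD ?(ltW hy) // ler_wpM2l // ltW.
have h2 : nr (f0 x - A u) <= M * e.
  by rewrite nrB; apply: le_trans (hA _ _) _; rewrite ler_wpM2l // ltW.
have h3 : nr (f0 y - A v) <= M * e.
  by rewrite nrB; apply: le_trans (hA _ _) _; rewrite ler_wpM2l // ltW.
apply: le_trans (nrD _ _) _; apply: le_trans (lerD h1 (nrD _ _)) _.
rewrite nrZ -/k; have h4 := ler_wpM2l k0 h2.
have : e * (2 * (M * (k + 1)) + 1) = d by rewrite /e divfK // gt_eqF.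
move: h3 h4 e0 p0; set a1 := k * nr _; set a2 := nr (f0 y - _) => h3 h4 e0 p0 ed.
by rewrite -ed; nra.
Qed.

Lemma bounded_opP A : bounded_op A <-> linop A /\ exists2 M, 0 <= M & forall u, nr (A u) <= M * nr u.
Proof.
split=> [[lA cA]|[lA [M M0 bA]]]; split => //.
  have /cvgrPdist_le := cA 0; rewrite (linop0 lA) => /(_ 1 ltr01).
  move=> /nbhs_ballP [d /= d0 hd].
  have d0' : 0 < complex.Re d by move: d0; rewrite ltcE => /andP [].
  have dE : d = (complex.Re d)%:C by apply/ge0_ReC/ltW.
  set r := complex.Re d in dE d0'.
  exists (2 / r); first by rewrite divr_ge0 // ltW.
  move=> u; have [u0|un0] := eqVneq (nr u) 0.
    by rewrite (nr0_eq0 u0) linop0 // nr0 mulr0.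
  have u0 : 0 < nr u by rewrite lt_neqAle eq_sym un0 nr_ge0.
  set s := r / (2 * nr u); have s0 : 0 < s by rewrite divr_gt0 // mulr_gt0.
  have ns : complex.Re `|s%:C| = s.
    by rewrite normc_def /= expr0n /= addr0 sqrtr_sqr gtr0_norm.
  have := hd (s%:C *: u); rewrite -ball_normE /= sub0r normrN dE nrE ltcR nrZ ns.
  have -> : s * nr u = r / 2 by rewrite /s; field.
  rewrite ltr_pdivrMr // ltr_pMr // ltr1n => /(_ isT).
  rewrite sub0r normrN nrE -[1]/(1%:C) lecR linopZ // nrZ ns.
  by rewrite /s mulrAC ler_pdivrMr ?mulr_gt0 // mul1r => h; rewrite mulrAC ler_pdivlMr // mulrC.
move=> u; apply/cvgrPdist_le => e e0.
have e0' : 0 < complex.Re e by move: e0; rewrite ltcE => /andP [].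
have eE : e = (complex.Re e)%:C by apply/ge0_ReC/ltW.
apply/nbhs_ballP; exists (complex.Re e / (M + 1))%:C; first by rewrite /= ltcR divr_gt0 // ltr_wpDl.
move=> v; rewrite -ball_normE /= nrE ltcR eE => h; rewrite nrE lecR -linopB //.
apply: le_trans (bA _) _; move: h; rewrite ltr_pdivlMr ?ltr_wpDl // => h.
by have := nr_ge0 (u - v); nra.
Qed.

End Operators.

(** * Left multiplication as a bounded operator *)

Section LeftMultiplication.
Variables (R : realType) (D : root_datum) (qq : R) (f q : affweyl D -> R).
Hypotheses (hqq : 1 < qq) (hq : is_weight qq f q).
Variable H : hecke_algebra q.
Variable E : hilbert_completion H.
Local Notation C := R[i].
Local Notation T := (@hecke_T R D q H).
Local Notation emb := (@hilb_emb R D q H E).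
Local Notation dot := (@hilb_dot R D q H E).
Local Notation star := (@hecke_star R D q H).
Local Notation tau := (hecke_tau H).
Local Notation L := (@lmul R D q H E).
Implicit Types (u v w : E) (x y h : H) (A B : E -> E).

Lemma opnorm_has_sup A : bounded_op A ->
  has_sup [set complex.Re `|A u| | u in [set u : E | `|u| <= 1]].
Proof.
move=> /bounded_opP [lA [M M0 bA]]; split.
  by exists (nr (A 0)), 0 => //=; rewrite normr0.
exists M => _ [u /= u1 <-]; apply: le_trans (bA u) _.
by rewrite -[leRHS]mulr1 ler_wpM2l // -lecR -nrE.
Qed.

Lemma opnorm_ub A u : bounded_op A -> nr (A u) <= opnorm A * nr u.
Proof.
move=> bA; have hs := opnorm_has_sup bA; have /bounded_opP [lA _] := bA.
have [u0|un0] := eqVneq (nr u) 0.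
  by rewrite (nr0_eq0 u0) linop0 // nr0 mulr0.
have u0 : 0 < nr u by rewrite lt_neqAle eq_sym un0 nr_ge0.
set s := (nr u)^-1; have s0 : 0 < s by rewrite invr_gt0.
have ns : complex.Re `|s%:C| = s.
  by rewrite normc_def /= expr0n /= addr0 sqrtr_sqr gtr0_norm.
have : nr (A (s%:C *: u)) <= opnorm A.
  apply: (ub_le_sup hs.2); exists (s%:C *: u) => //=.
  by rewrite nrE lecR nrZ ns mulVf.
by rewrite linopZ // nrZ ns /s mulrC ler_pdivrMr.
Qed.

Lemma opnorm_le A M : 0 <= M -> (forall u, nr (A u) <= M * nr u) -> opnorm A <= M.
Proof.
move=> M0 bA; apply: ge_sup; first by exists (nr (A 0)), 0 => //=; rewrite normr0.
move=> _ [u /= u1 <-]; apply: le_trans (bA u) _.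
by rewrite -[leRHS]mulr1 ler_wpM2l // -lecR -nrE.
Qed.

Lemma opnorm_ge0 A : bounded_op A -> 0 <= opnorm A.
Proof.
move=> bA; have hs := opnorm_has_sup bA.
apply: le_trans (ub_le_sup hs.2 _); first exact: (nr_ge0 (A 0)).
by exists 0 => //=; rewrite normr0.
Qed.

Lemma bounded_op_comb (c : C) A B : bounded_op A -> bounded_op B ->
  bounded_op (fun u => c *: A u + B u).
Proof.
move=> /bounded_opP [lA [M M0 bA]] /bounded_opP [lB [N N0 bB]].
have k0 : 0 <= complex.Re `|c| by have := normr_ge0 c; rewrite ge0_complexE => /andP [].
apply/bounded_opP; split=> [d u v|].
  rewrite lA lB !scalerDr addrACA !scalerA; congr (_ + _).
  by rewrite mulrC.
exists (complex.Re `|c| * M + N); first by rewrite addr_ge0 // mulr_ge0.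
move=> u; apply: le_trans (nrD _ _) _; rewrite mulrDl nrZ -mulrA.
by apply: lerD => //; apply: ler_wpM2l.
Qed.

Lemma bounded_op_sub A B : bounded_op A -> bounded_op B -> bounded_op (A \- B).
Proof.
move=> bA bB; have := bounded_op_comb (- 1) bB bA.
congr (bounded_op _); apply/funext => u; rewrite scaleN1r addrC.
by [].
Qed.

Lemma bounded_op_comp A B : bounded_op A -> bounded_op B -> bounded_op (A \o B).
Proof.
move=> /bounded_opP [lA [M M0 bA]] /bounded_opP [lB [N N0 bB]].
apply/bounded_opP; split=> [c u v|] /=; first by rewrite lB lA.
exists (M * N); first by rewrite mulr_ge0.
move=> u; apply: le_trans (bA _) _; rewrite -mulrA.
exact: ler_wpM2l.
Qed.

Lemma bounded_op_id : bounded_op (id : E -> E).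
Proof. by apply/bounded_opP; split=> //; exists 1 => // u; rewrite mul1r. Qed.

Lemma dense_eq A B : bounded_op A -> bounded_op B ->
  (forall x, A (emb x) = B (emb x)) -> A = B.
Proof.
move=> bA bB e; apply/funext => u; apply/eqP; rewrite -subr_eq0; apply/eqP/nr_small => d d0.
have bAB := bounded_op_sub bA bB; have /bounded_opP [lAB [M M0 hM]] := bAB.
have [|x hx] := @emb_dense R D q H E u (d / (M + 1)); first by rewrite divr_gt0 // ltr_wpDl.
have -> : A u - B u = (A \- B) (u - emb x).
  have e0 : (A \- B) (emb x) = 0 by rewrite /= e subrr.
  by rewrite (linopB _ _ lAB) e0 subr0.
apply: le_trans (hM _) _; move: hx; rewrite ltr_pdivlMr ?ltr_wpDl // => hx.
by have := nr_ge0 (u - emb x); nra.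
Qed.

Lemma nr_emb2 x : (nr (emb x) ^+ 2)%:C = tau (star x * x).
Proof. by rewrite -dot_nr dot_emb. Qed.

Lemma nr_isometry a x : star a * a = 1 -> nr (emb (a * x)) = nr (emb x).
Proof.
move=> aa; apply/eqP; rewrite -(eqrXn2 (n := 2)) ?nr_ge0 //; apply/eqP/complexI.
by rewrite !nr_emb2 hecke_starM mulrA -[star x * star a * a]mulrA aa mulr1.
Qed.

Definition left_bounded h := exists2 M, 0 <= M & forall x, nr (emb (h * x)) <= M * nr (emb x).

Lemma left_bounded_isometry a : star a * a = 1 -> left_bounded a.
Proof. by move=> aa; exists 1 => // x; rewrite nr_isometry // mul1r. Qed.

Lemma left_bounded_comb (c : C) h h' : left_bounded h -> left_bounded h' ->
  left_bounded (c *: h + h').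
Proof.
move=> [M M0 hM] [N N0 hN].
have k0 : 0 <= complex.Re `|c| by have := normr_ge0 c; rewrite ge0_complexE => /andP [].
exists (complex.Re `|c| * M + N); first by rewrite addr_ge0 // mulr_ge0.
move=> x; rewrite mulrDl -(scalerAl c) linearP; apply: le_trans (nrD _ _) _.
by rewrite mulrDl nrZ -mulrA; apply: lerD => //; apply: ler_wpM2l.
Qed.

Lemma sqr_affine (K : comNzRingType) (A : algType K) (a b : K) (t : A) :
  (a *: t + b%:A) * (a *: t + b%:A) = (a * a) *: (t * t) + (2 * (a * b)) *: t + (b * b)%:A.
Proof.
rewrite mulrDl !mulrDr -!scalerAl -!scalerAr !mulr1 !mul1r !scalerA -!addrA; congr (_ + _).
by rewrite addrA -scalerDl; congr (_ *: _ + _); ring.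
Qed.

(* [U = (2 T_s - (q - 1)) / (q + 1)] is a self-adjoint unitary. *)
Lemma left_bounded_all h : left_bounded h.
Proof.
have b1 : left_bounded 1 by apply: left_bounded_isometry; rewrite star1 mulr1.
move: h; apply: (hecke_gen (P := left_bounded)) => [||w w0|b sb].
- exact: left_bounded_comb.
- move=> h h' [M M0 hM] [N N0 hN]; exists (M * N); first by rewrite mulr_ge0.
  move=> x; rewrite -!mulrA; apply: le_trans (hM _) _; exact: ler_wpM2l.
- by apply: left_bounded_isometry; rewrite hecke_starT TM mulVg ?T1 // len1 lenV w0.
set t := T (aref b); set Q := q (aref b).
have Q0 : 0 < Q by exact: (q_gt0 hqq hq).
have tt : t * t = (Q - 1)%:C *: t + Q%:C%:A by exact: T_quad.
have st : star t = t by rewrite hecke_starT arefV ?asimple_root.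
pose U : H := (2 / (Q + 1))%:C *: t + ((1 - Q) / (Q + 1))%:C%:A.
have sU : star U = U by rewrite /U starD !starZ st star1 !conjc_real.
have UU : star U * U = 1.
  have n0 : Q + 1 != 0 by rewrite gt_eqF // addr_gt0.
  rewrite sU /U sqr_affine tt scalerDr !scalerA -addrA addrACA -!scalerDl.
  set a := 2 / (Q + 1); set c := (1 - Q) / (Q + 1).
  rewrite -(rmorph_nat (real_complex R) 2) -!rmorphM -!rmorphD.
  have -> : a * a * (Q - 1) + 2%:R * (a * c) = 0 by rewrite /a /c; field.
  have -> : a * a * Q + c * c = 1 by rewrite /a /c; field.
  by rewrite rmorph0 rmorph1 scale0r add0r scale1r.
have -> : t = ((Q + 1) / 2)%:C *: U + ((Q - 1) / 2)%:C *: 1.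
  have n0 : Q + 1 != 0 by rewrite gt_eqF // addr_gt0.
  rewrite /U scalerDr !scalerA -addrA -scalerDl -!rmorphM -!rmorphD.
  have -> : (Q + 1) / 2 * (2 / (Q + 1)) = 1 by field.
  have -> : (Q + 1) / 2 * ((1 - Q) / (Q + 1)) + (Q - 1) / 2 = 0 by field.
  by rewrite rmorph0 rmorph1 scale0r addr0 scale1r.
apply: left_bounded_comb; first exact: left_bounded_isometry.
rewrite -[_ *: 1]addr0; apply: left_bounded_comb => //.
by exists 0 => // x; rewrite mul0r linear0 nr0 mul0r.
Qed.

(** Existence of the extension, so that the default of [xget] in [lmul] is never taken. *)
Lemma lmulP h : bounded_op (L h) /\ forall x, L h (emb x) = emb (h * x).
Proof.
have [M M0 hM] := left_bounded_all h.
have [||A [lA bA eA]] := @extension R D q H E (fun x => emb (h * x)) M M0.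
- by move=> c x y; rewrite mulrDr -(scalerAr c) linearP.
- exact: hM.
pose P := [set A : E -> E | bounded_op A /\ forall x, A (emb x) = emb (h * x)].
have PA : P A by split => //; apply/bounded_opP; split => //; exists M.
exact: (xgetPex (fun=> 0) (ex_intro P A PA)).
Qed.

Lemma lmul_bounded h : bounded_op (L h). Proof. by have [] := lmulP h. Qed.
Lemma lmul_emb h x : L h (emb x) = emb (h * x). Proof. by have [_ ->] := lmulP h. Qed.

Lemma lmul_comb (c : C) h h' : L (c *: h + h') = fun u => c *: L h u + L h' u.
Proof.
apply: dense_eq; [exact: lmul_bounded|apply: bounded_op_comb; exact: lmul_bounded|].
by move=> x; rewrite !lmul_emb mulrDl -(scalerAl c) linearP.
Qed.

Lemma lmulM h h' : L (h * h') = L h \o L h'.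
Proof.
apply: dense_eq; [exact: lmul_bounded|apply: bounded_op_comp; exact: lmul_bounded|].
by move=> x; rewrite /= !lmul_emb mulrA.
Qed.

Lemma lmul1 : L 1 = id.
Proof.
apply: dense_eq; [exact: lmul_bounded|exact: bounded_op_id|].
by move=> x; rewrite lmul_emb mul1r.
Qed.

Lemma lmulB h h' : L (h - h') = L h \- L h'.
Proof.
rewrite addrC -scaleN1r lmul_comb; apply/funext => u /=.
by rewrite scaleN1r addrC.
Qed.

Lemma dotCl (c : C) u v w : dot (c *: u + v) w = conjc c * dot u w + dot v w.
Proof. by rewrite dotC dotP conjcD conjcM -!dotC. Qed.

Lemma dotBr u v w : dot u (v - w) = dot u v - dot u w.
Proof. by rewrite addrC -scaleN1r dotP mulN1r addrC. Qed.

Lemma dotBl u v w : dot (u - v) w = dot u w - dot v w.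
Proof. by rewrite dotC dotBr rmorphB /= -!dotC. Qed.

Lemma Re_norm_ge0 (c : C) : 0 <= complex.Re `|c|.
Proof. by have := normr_ge0 c; rewrite ge0_complexE => /andP []. Qed.

Lemma Re_normD (a b : C) : complex.Re `|a + b| <= complex.Re `|a| + complex.Re `|b|.
Proof. by have := ler_normD a b; rewrite lecE => /andP [_]; rewrite ReCD. Qed.

Lemma norm_small (a : C) : (forall e : R, 0 < e -> complex.Re `|a| <= e) -> a = 0.
Proof.
move=> h; apply/eqP; rewrite -normr_eq0 (ge0_ReC (normr_ge0 a)).
have -> : complex.Re `|a| = 0.
  apply/eqP; rewrite eq_le Re_norm_ge0 andbT.
  by apply/ler_addgt0Pr => e e0; rewrite add0r h.
by [].
Qed.

Lemma lmul_adjoint h : adjoint (L h) (L (star h)).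
Proof.
move=> u v; apply/eqP; rewrite -subr_eq0; apply/eqP/norm_small => e e0.
have /bounded_opP [lA [M M0 hM]] := lmul_bounded h.
have /bounded_opP [lB [N N0 hN]] := lmul_bounded (star h).
pose F u v := dot (L h u) v - dot u (L (star h) v).
have Fe x y : F (emb x) (emb y) = 0.
  by rewrite /F !lmul_emb !dot_emb hecke_starM mulrA subrr.
have bF u' v' : complex.Re `|F u' v'| <= (M + N) * nr u' * nr v'.
  apply: le_trans (Re_normD _ _) _; rewrite normrN.
  have h1 := dot_cs (L h u') v'; have h2 := dot_cs u' (L (star h) v').
  have h3 := hM u'; have h4 := hN v'.
  have := ler_wpM2r (nr_ge0 v') h3; have := ler_wpM2l (nr_ge0 u') h4.
  set a1 := complex.Re _ in h1 *; set a2 := complex.Re _ in h2 *; nra.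
set K := (M + N) * (nr u + nr v + 1).
have K0 : 0 <= K by rewrite mulr_ge0 ?addr_ge0 ?nr_ge0.
(* The cap 1 bounds the norm of [emb x] by [nr u + 1]; the total error is then at most [d * K]. *)
pose d := Num.min 1 (e / (K + 1)).
have d0 : 0 < d by rewrite lt_min ltr01 divr_gt0 // ltr_wpDl.
have d1 : d <= 1 by rewrite ge_min lexx.
have dK : d * K <= e.
  have : d <= e / (K + 1) by rewrite ge_min lexx orbT.
  by rewrite ler_pdivlMr ?ltr_wpDl // => ?; nra.
have [x hx] := @emb_dense R D q H E u d d0; have [y hy] := @emb_dense R D q H E v d d0.
have -> : dot (L h u) v - dot u (L (star h) v) = F (u - emb x) v + F (emb x) (v - emb y).
  have -> : F (emb x) (v - emb y) = F (emb x) v.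
    rewrite -[RHS]subr0 -(Fe x y) /F (linopB _ _ lB) !dotBr.
    by rewrite !opprB addrACA [RHS]addrAC; ring.
  by rewrite /F (linopB _ _ lA) !dotBl; ring.
apply: le_trans (Re_normD _ _) _; apply: le_trans (lerD (bF _ _) (bF _ _)) _.
have nx : nr (emb x) <= nr u + d.
  rewrite -[emb x](subKr u); apply: le_trans (nrD _ _) _; rewrite nrN lerD2l.
  exact: ltW.
have := nr_ge0 u; have := nr_ge0 v; have := nr_ge0 (u - emb x); have := nr_ge0 (v - emb y).
have := nr_ge0 (emb x); move: hx hy nx dK; rewrite /K.
set a1 := nr (u - _); set a2 := nr (v - _); set a3 := nr (emb x); set a4 := nr u; set a5 := nr v.
move=> hx hy nx dK p1 p2 p3 p4 p5; apply: le_trans dK.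
have MN : 0 <= M + N by rewrite addr_ge0.
have q1 : a1 * a5 <= d * a5 by rewrite ler_wpM2r // ltW.
have q2 : a3 * a2 <= (a4 + 1) * d by apply: ler_pM => //; [lra|exact: ltW].
have : (M + N) * (a1 * a5 + a3 * a2) <= (M + N) * (d * a5 + (a4 + 1) * d).
  by apply: ler_wpM2l => //; lra.
by lra.
Qed.

End LeftMultiplication.

(** * Characters of the closure of the center *)

Section Spectrum.
Variables (R : realType) (D : root_datum) (qq : R) (f q : affweyl D -> R).
Hypotheses (hqq : 1 < qq) (hq : is_weight qq f q).
Variable H : hecke_algebra q.
Variable theta : rd_X D -> H.
Hypothesis htheta : is_theta theta.
Variable E : hilbert_completion H.
Local Notation C := R[i].
Local Notation emb := (@hilb_emb R D q H E).
Local Notation dot := (@hilb_dot R D q H E).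
Local Notation star := (@hecke_star R D q H).
Local Notation L := (@lmul R D q H E).
Local Notation bern := (bernstein theta).
Local Notation Z := (hecke_Z theta).
Local Notation P := (op_closure E Z).
Implicit Types (u v w : E) (x y h z : H) (A B : E -> E).
Let lmul_bounded := @lmul_bounded R D qq f q hqq hq H E.
Let lmul_comb := @lmul_comb R D qq f q hqq hq H E.
Let lmulM := @lmulM R D qq f q hqq hq H E.
Let lmul1 := @lmul1 R D qq f q hqq hq H E.
Let lmulB := @lmulB R D qq f q hqq hq H E.

Lemma Z_comb (c : C) z z' : Z z -> Z z' -> Z (c *: z + z').
Proof.
move=> [p pI <-] [r rI <-]; exists (lcomb c p r); first exact: lcomb_inv.
by rewrite bern_comb.
Qed.

Lemma Z_mul z z' : Z z -> Z z' -> Z (z * z').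
Proof.
move=> [p pI <-] [r rI <-]; exists (lmulp p r); first exact: lmulp_inv.
by rewrite bern_mul.
Qed.

Lemma Z_1 : Z 1.
Proof.
by exists (lmono R 0); rewrite ?bern_mono ?(theta0 htheta) //; exact: lmono0_inv.
Qed.

Lemma Z_0 : Z 0.
Proof. by rewrite -(addNr 1) -scaleN1r; apply: Z_comb; exact: Z_1. Qed.

Lemma lmul_in_closure (S : set H) h : S h -> op_closure E S (L h).
Proof.
move=> Sh; split=> // e e0; exists h => //; apply: le_lt_trans e0.
apply: opnorm_le => // u; rewrite mul0r.
have -> : (L h \- L h) u = 0 by rewrite /= subrr.
by rewrite nr0.
Qed.

Lemma lmul_le h u : nr (L h u) <= opnorm (L h) * nr u.
Proof. exact: opnorm_ub. Qed.

Lemma expr_small (r K d : R) : 0 <= r < 1 -> 0 <= K -> 0 < d -> exists n, r ^+ n * K < d.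
Proof.
move=> /andP [r0 r1] K0 d0.
have : (fun n => r ^+ n) @ \oo --> 0 by apply: cvg_expr; rewrite ger0_norm.
move=> /cvgrPdist_lt /(_ (d / (K + 1))) [|n _ /(_ n) h].
  by rewrite divr_gt0 // ltr_wpDl.
exists n; move: (h (leqnn n)); rewrite sub0r normrN ger0_norm ?exprn_ge0 //.
rewrite ltr_pdivlMr ?ltr_wpDl // => {}h; apply: le_lt_trans h.
by rewrite ler_wpM2l ?exprn_ge0 // lerDl.
Qed.

Section Neumann.
Variable z : H.
Hypothesis Zz : Z z.
Hypothesis z1 : opnorm (L z) < 1.
Let r := opnorm (L z).
Let r0 : 0 <= r := opnorm_ge0 (lmul_bounded z).
Let s1r : 0 < 1 - r. Proof. by rewrite subr_gt0. Qed.
Let S n : H := \sum_(k < n) z ^+ k.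

Lemma neumann_exp n u : nr (L (z ^+ n) u) <= r ^+ n * nr u.
Proof.
elim: n u => [|n IH] u; first by rewrite expr0 lmul1 mul1r.
rewrite exprS lmulM /=; apply: le_trans (lmul_le _ _) _.
by rewrite exprS -mulrA ler_wpM2l.
Qed.

(** A bound uniform in [n]; applied to the tails given by [neumann_split] it yields a geometric
    Cauchy rate. *)
Lemma neumann_sum n u : (1 - r) * nr (L (S n) u) <= nr u.
Proof.
suff : (1 - r) * nr (L (S n) u) <= (1 - r ^+ n) * nr u.
  move/le_trans; apply; rewrite -[leRHS]mul1r ler_wpM2r ?nr_ge0 //.
  by rewrite lerBlDr lerDl exprn_ge0.
elim: n => [|n IH].
  rewrite /S big_ord0 expr0 subrr mul0r -(subrr 1) lmulB lmul1 /= subrr.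
  by rewrite nr0 mulr0.
rewrite /S big_ord_recr /= -[X in L (X + _)]scale1r lmul_comb scale1r.
have h1 := nrD (L (S n) u) (L (z ^+ n) u); have h2 := neumann_exp n u.
have := ler_wpM2l (ltW s1r) h1; have := ler_wpM2l (ltW s1r) h2.
rewrite -/(S n) exprS; set a := nr (_ + _); set b := nr (L (S n) u) in h1 IH *.
set c := nr (L (z ^+ n) u); set t := r ^+ n in IH *; set d := nr u in IH *.
by rewrite mulrDr => e1 e2; apply: le_trans e2 _; lra.
Qed.

Lemma neumann_split n k : S (n + k) = S n + z ^+ n * S k.
Proof.
elim: k => [|k IH]; first by rewrite addn0 /S big_ord0 mulr0 addr0.
rewrite addnS {1}/S big_ord_recr /= -/(S (n + k)) IH /S big_ord_recr /=.
by rewrite mulrDr -exprD addrA.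
Qed.

Lemma neumann_tele n : S n * (1 - z) = 1 - z ^+ n.
Proof.
elim: n => [|n IH]; first by rewrite /S big_ord0 mul0r expr0 subrr.
rewrite /S big_ord_recr /= mulrDl -/(S n) IH mulrBr mulr1 -exprSr.
by rewrite addrA subrK.
Qed.

Lemma neumann_Z n : Z (S n).
Proof.
rewrite /S; elim: n => [|n IH]; first by rewrite big_ord0; exact: Z_0.
rewrite big_ord_recr /= -[X in X + _]scale1r; apply: Z_comb => //.
by elim: n {IH} => [|n IH]; [rewrite expr0; exact: Z_1|rewrite exprS; exact: Z_mul].
Qed.

(** The partial sums lie in [Z] and converge in operator norm, so the inverse lies in the closure of
    [Z], where a character can be evaluated. *)
Lemma neumann : exists2 B, P B & B \o L (1 - z) = id.
Proof.
have rI : 0 <= r < 1 by rewrite r0.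
have ex u : exists v, forall n, nr (v - L (S n) u) <= r ^+ n * (nr u / (1 - r)).
  apply: (@seq_lim _ E (fun n => L (S n) u)) => [d d0|n m nm].
    by apply: expr_small => //; rewrite divr_ge0 ?nr_ge0 // ltW.
  rewrite -(subnKC nm) neumann_split.
  have -> : L (S n + z ^+ n * S (m - n)) u - L (S n) u = L (z ^+ n) (L (S (m - n)) u).
    by rewrite -[X in L (X + _)]scale1r lmul_comb scale1r lmulM /= addrC addKr.
  apply: le_trans (neumann_exp _ _) _; apply: ler_wpM2l; first exact: exprn_ge0.
  by rewrite ler_pdivlMr // mulrC neumann_sum.
have [B hB] := choice ex.
have bB u : nr (B u) <= (1 - r)^-1 * nr u.
  have := hB u 0%N; rewrite expr0 mul1r mulrC.
  have -> : L (S 0) u = 0 by rewrite /S big_ord0 -(subrr 1) lmulB /= subrr.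
  by rewrite subr0.
have lB : linop B.
  move=> c u v; apply/eqP; rewrite -subr_eq0; apply/eqP/nr_small => d d0.
  set k := complex.Re `|c|; have k0 : 0 <= k by exact: Re_norm_ge0.
  set K := (nr (c *: u + v) + k * nr u + nr v) / (1 - r).
  have K0 : 0 <= K by rewrite divr_ge0 ?(ltW s1r) // !addr_ge0 ?mulr_ge0 ?nr_ge0.
  have [n hn] := expr_small rI K0 d0.
  have /bounded_opP [lS _] := lmul_bounded (S n).
  have -> : B (c *: u + v) - (c *: B u + B v) =
    (B (c *: u + v) - L (S n) (c *: u + v)) + (c *: (L (S n) u - B u) + (L (S n) v - B v)).
    by rewrite lS scalerBr [X in _ = _ + X]addrACA -opprD addrA subrK.
  apply: le_trans (ltW hn); apply: le_trans (nrD _ _) _.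
  have h1 := hB (c *: u + v) n; have h2 := hB u n; have h3 := hB v n.
  have h4 := nrD (c *: (L (S n) u - B u)) (L (S n) v - B v).
  rewrite nrZ -/k nrB (nrB _ (B v)) in h4; have := ler_wpM2l k0 h2; move: h1 h3 h4.
  rewrite /K; set i := (1 - r)^-1; set t := r ^+ n.
  set a1 := nr (_ - _); set a2 := nr (_ + _); set a3 := nr (_ - _); set a4 := nr (_ - _).
  by move=> h1 h3 h4 h5; lra.
have bdB : bounded_op B.
  by apply/bounded_opP; split=> //; exists (1 - r)^-1 => //; rewrite invr_ge0 ltW.
exists B.
  split=> // e e0; have i0 : 0 <= (1 - r)^-1 by rewrite invr_ge0 ltW.
  have [n hn] := expr_small rI i0 e0; exists (S n); first exact: neumann_Z.
  apply: le_lt_trans hn; apply: opnorm_le => [|u]; first by rewrite mulr_ge0 // exprn_ge0.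
  by apply: le_trans (hB u n) _; rewrite mulrA mulrAC.
apply/funext => u /=; apply/eqP; rewrite -subr_eq0; apply/eqP/nr_small => d d0.
set w := L (1 - z) u; set K := nr w / (1 - r) + nr u.
have K0 : 0 <= K by rewrite addr_ge0 ?nr_ge0 // divr_ge0 ?nr_ge0 // ltW.
have [n hn] := expr_small rI K0 d0; apply: le_trans (ltW hn).
have -> : B w - u = (B w - L (S n) w) - L (z ^+ n) u.
  have -> : L (S n) w = u - L (z ^+ n) u.
    by rewrite /w -[L (S n) _]/((L (S n) \o L (1 - z)) u) -lmulM neumann_tele lmulB lmul1.
  by rewrite opprB addrA addrAC addrK.
apply: le_trans (nrD _ _) _; rewrite nrN /K mulrDr; apply: lerD; first exact: hB.
exact: neumann_exp.
Qed.

End Neumann.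

Section Character.
Variable phi : (E -> E) -> C.
Hypothesis hphi : character_on P phi.

Lemma char_comb (c : C) z z' : Z z -> Z z' -> phi (L (c *: z + z')) = c * phi (L z) + phi (L z').
Proof. by case: hphi => lin _ _ Zz Zz'; rewrite lmul_comb lin //; exact: lmul_in_closure. Qed.

Lemma char1 : phi (L 1) = 1.
Proof. by rewrite lmul1; case: hphi. Qed.

(** If the value [l] exceeded the norm, [1 - z / l] would be invertible within the closure of [Z],
    although the character sends it to 0. *)
Lemma char_bound z : Z z -> complex.Re `|phi (L z)| <= opnorm (L z).
Proof.
move=> Zz; rewrite leNgt; apply/negP => lt.
set l := phi (L z) in lt; set k := complex.Re `|l| in lt.
have r0 := opnorm_ge0 (lmul_bounded z); have k0 : 0 < k by exact: le_lt_trans lt.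
have l0 : l != 0.
  by apply/eqP => e; move: k0; rewrite /k e normr0 ltxx.
have kV : complex.Re `|l^-1| = k^-1.
  by rewrite normrV ?unitfE // (ge0_ReC (normr_ge0 l)) -/k -(fmorphV (real_complex R)).
have Zw : Z (l^-1 *: z) by rewrite -[_ *: _]addr0; apply: Z_comb => //; exact: Z_0.
have lZ u : L (l^-1 *: z) u = l^-1 *: L z u.
  rewrite -[_ *: z]addr0 lmul_comb.
  by have -> : L 0 u = 0; [rewrite -(subrr 1) lmulB /= subrr|rewrite addr0].
have w1 : opnorm (L (l^-1 *: z)) < 1.
  apply: (@le_lt_trans _ _ (k^-1 * opnorm (L z))).
    apply: opnorm_le => [|u]; first by rewrite mulr_ge0 // invr_ge0 ltW.
    by rewrite lZ nrZ kV -mulrA ler_wpM2l ?invr_ge0 ?(ltW k0) // lmul_le.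
  by rewrite mulrC ltr_pdivrMr // mul1r.
have [B PB Be] := neumann Zw w1.
have Z1w : Z (1 - l^-1 *: z) by rewrite addrC -scaleN1r; apply: Z_comb => //; exact: Z_1.
have [_ mul one] := hphi.
have := mul B (L (1 - l^-1 *: z)) PB (lmul_in_closure Z1w); rewrite Be one.
rewrite addrC -scaleN1r char_comb //; last exact: Z_1.
rewrite -[X in L X]addr0 char_comb //; last exact: Z_0.
have -> : phi (L 0) = 0.
  by rewrite -(addNr 1) -scaleN1r char_comb ?char1 ?mulr1 ?addNr //; exact: Z_1.
rewrite -/l char1 mulVf // addr0 mulr1 addNr mulr0 => /eqP.
by rewrite oner_eq0.
Qed.

(** Self-adjointness gives the norm bound [n ^ 2 + s ^ 2] on the square of [y + i s]. By
    [char_bound], the term [2 b s] must then stay bounded for all real [s]. *)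
Lemma char_selfadj y : Z y -> star y = y -> complex.Im (phi (L y)) = 0.
Proof.
move=> Zy sy; set a := complex.Re (phi (L y)); set b := complex.Im (phi (L y)).
set n := opnorm (L y); have n0 : 0 <= n := opnorm_ge0 (lmul_bounded y).
have key (s : R) : a ^+ 2 + (b + s) ^+ 2 <= n ^+ 2 + s ^+ 2.
  set c : C := 0 +i* s; set y' := c *: 1 + y.
  have Zy' : Z y' by apply: Z_comb => //; exact: Z_1.
  have e : phi (L y') = a +i* (b + s).
    rewrite char_comb ?char1 ?mulr1 //; last exact: Z_1.
    by apply: complex_ext; rewrite !(ReCD, ImCD) /= ?add0r // addrC.
  have Q0 : 0 <= n ^+ 2 + s ^+ 2 by rewrite addr_ge0 ?sqr_ge0.
  have le1 : opnorm (L y') <= Num.sqrt (n ^+ 2 + s ^+ 2).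
    apply: opnorm_le => [|u]; first exact: sqrtr_ge0.
    rewrite -ler_sqr ?nnegrE ?mulr_ge0 ?nr_ge0 ?sqrtr_ge0 // exprMn sqr_sqrtr //.
    have ad := @lmul_adjoint R D qq f q hqq hq H E y u u; rewrite sy in ad.
    have -> : nr (L y' u) ^+ 2 = s ^+ 2 * nr u ^+ 2 + nr (L y u) ^+ 2.
      apply: complexI; rewrite -dot_nr lmul_comb lmul1 rmorphD rmorphM /= -!dot_nr.
      rewrite dotP !dotCl ad; set d := dot u u; set d2 := dot u (L y u).
      have -> : conjc c = - c by rewrite /c /conjc; apply: complex_ext; rewrite ?ReCN ?ImCN /= ?oppr0.
      have cc : (s ^+ 2)%:C = - (c * c).
        by apply: complex_ext; rewrite ?ReCN ?ImCN ?ReCM ?ImCM /=; ring.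
      by rewrite cc; ring.
    have h := lmul_le y u; rewrite -/n in h.
    have : nr (L y u) ^+ 2 <= (n * nr u) ^+ 2 by rewrite ler_sqr ?nnegrE ?mulr_ge0 ?nr_ge0.
    by rewrite exprMn mulrDl; lra.
  have := le_trans (char_bound Zy') le1; rewrite e normc_def /=.
  by rewrite ler_sqrt.
apply/eqP; apply: contraT => b0.
(* This [s] makes [2 b s] equal to [n ^ 2 + 1], one more than the inequality allows. *)
have := key ((n ^+ 2 + 1) / (2 * b)); set s := _ / _.
have : 2 * b * s = n ^+ 2 + 1 by rewrite /s; field.
by have := sqr_ge0 a; have := sqr_ge0 b; nra.
Qed.

(** Real-valuedness on the sum of [z] and its star, and on the sum of [i z] and its star, determines
    both parts. *)
Lemma char_star p : laurent_inv p ->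
  phi (L (bern (lstar p))) = conjc (phi (L (bern p))).
Proof.
move=> pI; set z := bern p; set z' := bern (lstar p).
have Zz : Z z by exists p. 
have Zz' : Z z' by exists (lstar p) => //; exact: lstar_inv.
have sz : star z = z' by exact: (star_bern hqq hq htheta).
have sz' : star z' = z by rewrite -sz hecke_starK.
have h1 : complex.Im (phi (L (1 *: z + z'))) = 0.
  apply: char_selfadj; first exact: Z_comb.
  by rewrite scale1r starD sz sz' addrC.
have Ziz : Z ((0 +i* 1) *: z) by rewrite -[_ *: _]addr0; apply: Z_comb => //; exact: Z_0.
have h2 : complex.Im (phi (L ((0 -i* 1) *: z' + ((0 +i* 1) *: z)))) = 0.
  apply: char_selfadj; first exact: Z_comb.
  rewrite starD !starZ sz sz' addrC; congr (_ *: _ + _ *: _); last by rewrite /= opprK.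
rewrite char_comb // in h1; rewrite char_comb // in h2.
rewrite -[(0 +i* 1) *: z]addr0 char_comb // in h2; last exact: Z_0.
have p0 : phi (L 0) = 0.
  by rewrite -(addNr 1) -scaleN1r char_comb ?char1 ?mulr1 ?addNr //; exact: Z_1.
move: h1 h2; rewrite p0 addr0 !(ImCD, ImCM) /= => h1 h2.
apply: complex_ext; rewrite ?ReCJ ?ImCJ. all: lra.
Qed.

End Character.

Lemma spectrum_bound (t : torus R D) p : spectrum E theta t -> laurent_inv p ->
  complex.Re `|laurent_eval p t| <= opnorm (L (bern p)).
Proof. by move=> [phi cphi e] pI; rewrite -e // char_bound //; exists p. Qed.

Lemma spectrum_star (t : torus R D) p : spectrum E theta t -> laurent_inv p ->
  laurent_eval (lstar p) t = conjc (laurent_eval p t).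
Proof.
move=> [phi cphi e] pI; rewrite -!e ?char_star //.
exact: lstar_inv.
Qed.

End Spectrum.

(** * L2 closure of a function algebra *)

Section Linfty.
Context (d : measure_display) (T : measurableType d) (R : realType).
Variable mu : probability T R.
Implicit Types f g h : T -> R.
Local Notation I f := (\int[mu]_(t in setT) f t)%R.

(** The bound is only almost everywhere, since elements of the center are bounded on the spectrum
    and not on the whole torus. *)
Definition linf f : Prop :=
  measurable_fun setT f /\ exists M : R, {ae mu, forall t, `|f t| <= M}.

Lemma linf_integrable f : linf f -> mu.-integrable setT (EFin \o f).
Proof.
move=> [mf [M fM]]; apply/integrableP; split; first exact/measurable_EFinP.
have mf' : measurable_fun setT (fun t => `|(f t)%:E|%E).
  by apply: measurableT_comp => //; exact/measurable_EFinP.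
apply: (@le_lt_trans _ _ (\int[mu]_(t in setT) (cst (`|M|)%:E t))%E).
  apply: ae_ge0_le_integral => //; first by move=> t _; rewrite lee_fin.
  by apply: filterS fM => t h _ /=; rewrite lee_fin (le_trans h) // ler_norm.
rewrite integral_cst // lte_mul_pinfty ?lee_fin //.
by apply: (@le_lt_trans _ _ 1%E); [exact: probability_le1|exact: ltry].
Qed.

Lemma linf_bounded f : measurable_fun setT f -> (exists M : R, forall t, `|f t| <= M) -> linf f.
Proof. by move=> mf [M h]; split=> //; exists M; exact: aeW. Qed.

Lemma linf_cst c : linf (fun=> c).
Proof. by apply: linf_bounded => //; exists `|c|. Qed.

Lemma linfD f g : linf f -> linf g -> linf (fun t => f t + g t).
Proof.
move=> [mf [M fM]] [mg [N gN]]; split; first exact: measurable_funD.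
exists (M + N); apply: filterS2 fM gN => t h1 h2.
by rewrite (le_trans (ler_normD _ _)) // lerD.
Qed.

Lemma linfM f g : linf f -> linf g -> linf (fun t => f t * g t).
Proof.
move=> [mf [M fM]] [mg [N gN]]; split; first exact: measurable_funM.
exists (M * N); apply: filterS2 fM gN => t h1 h2.
by rewrite normrM ler_pM.
Qed.

Lemma linfZ c f : linf f -> linf (fun t => c * f t).
Proof. by apply: linfM; exact: linf_cst. Qed.

Lemma linfN f : linf f -> linf (fun t => - f t).
Proof. by move=> /(linfZ (- 1)) h; under eq_fun do rewrite -mulN1r. Qed.

Lemma linfB f g : linf f -> linf g -> linf (fun t => f t - g t).
Proof. by move=> hf /linfN; exact: linfD. Qed.

Lemma linfX f n : linf f -> linf (fun t => f t ^+ n).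
Proof.
move=> hf; elim: n => [|n IH]; first exact: linf_cst.
by under eq_fun do rewrite exprS; exact: linfM.
Qed.

Lemma linf_I_D f g : linf f -> linf g -> I (fun t => f t + g t) = I f + I g.
Proof. by move=> hf hg; apply: RintegralD => //; exact: linf_integrable. Qed.

Lemma linf_I_Z c f : linf f -> I (fun t => c * f t) = c * I f.
Proof. by move=> hf; apply: RintegralZl => //; exact: linf_integrable. Qed.

Lemma linf_I_B f g : linf f -> linf g -> I (fun t => f t - g t) = I f - I g.
Proof. by move=> hf hg; apply: RintegralB => //; exact: linf_integrable. Qed.

Lemma linf_I_ae f g : measurable_fun setT f -> measurable_fun setT g ->
  {ae mu, forall t, f t = g t} -> I f = I g.
Proof.
move=> mf mg fg; congr fine; apply: ae_eq_integral => //; try exact/measurable_EFinP.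
by apply: filterS fg => t h _ /=; rewrite h.
Qed.

Lemma linf_I_le f g : linf f -> linf g -> {ae mu, forall t, f t <= g t} -> I f <= I g.
Proof.
move=> hf hg fg; rewrite -subr_ge0 -linf_I_B //.
have [m _] := linfB hg hf.
(* [Rintegral_ge0] asks for nonnegativity at every point, so the difference is replaced by its
   absolute value. *)
rewrite (linf_I_ae (g := fun t => `|g t - f t|)) //; first exact: Rintegral_ge0.
- exact: measurableT_comp.
- by apply: filterS fg => t h; rewrite ger0_norm // subr_ge0.
Qed.

Lemma linf_I_ge0 f : linf f -> {ae mu, forall t, 0 <= f t} -> 0 <= I f.
Proof.
move=> hf f0; have := linf_I_le (linf_cst 0) hf f0.
by rewrite Rintegral_cst // mul0r.
Qed.

Lemma linf_I_cst c : I (fun=> c) = c.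
Proof.
have m1 : mu setT = 1%E by exact: probability_setT.
rewrite Rintegral_cst //.
have e : fine (mu setT) = 1 by rewrite m1.
by rewrite (_ : fine _ = 1) ?mulr1.
Qed.

Lemma linf_I_lim (s : nat -> T -> R) f M :
  (forall n, measurable_fun setT (s n)) -> measurable_fun setT f ->
  (forall n t, `|s n t| <= M) -> (forall t, s n t @[n --> \oo] --> f t) ->
  I (s n) @[n --> \oo] --> I f.
Proof.
move=> ms mf sM sf.
have [|||||i1 _ cv] := @dominated_convergence _ T R mu setT measurableT
  (fun n t => (s n t)%:E) (EFin \o f) (cst M%:E).
- by move=> n; exact/measurable_EFinP.
- exact/measurable_EFinP.
- by apply: aeW => t _; apply: cvg_EFin; [exact: nearW|exact: sf].
- exact: finite_measure_integrable_cst.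
- by apply: aeW => t n _ /=; rewrite lee_fin.
apply: fine_cvg; rewrite fineK //.
exact: (integrable_fin_num measurableT i1).
Qed.

End Linfty.

(** * Polynomial approximation of a step function *)

Section CubicIteration.
Variable R : realType.
Implicit Types x y : R.

(* Iterating [cubic] pushes [0, 1/2[ to 0 and ]1/2, 1] to 1, which turns
   elements of a function algebra into indicators of superlevel sets. *)
Definition cubic x : R := x * x * (3 - 2 * x).

Lemma cubic_itv x : 0 <= x <= 1 -> 0 <= cubic x <= 1.
Proof.
move=> /andP [x0 x1]; rewrite /cubic; apply/andP; split.
  by rewrite !mulr_ge0 //; lra.
have : 0 <= (1 - x) ^+ 2 * (1 + 2 * x) by rewrite mulr_ge0 ?sqr_ge0 //; lra.
by lra.
Qed.

Lemma cubic1B x : cubic (1 - x) = 1 - cubic x.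
Proof. by rewrite /cubic; ring. Qed.

Lemma iter_cubic_itv n x : 0 <= x <= 1 -> 0 <= iter n cubic x <= 1.
Proof. by move=> h; elim: n => [|n IH] //=; exact: cubic_itv. Qed.

Lemma iter_cubic1B n x : iter n cubic (1 - x) = 1 - iter n cubic x.
Proof. by elim: n => [|n IH] //=; rewrite IH cubic1B. Qed.

Definition cubic_lim x : R := if x < 2^-1 then 0 else if x == 2^-1 then 2^-1 else 1.

Lemma iter_cubic_cvg0 x : 0 <= x -> x < 2^-1 -> iter n cubic x @[n --> \oo] --> 0.
Proof.
(* The factor [y * (3 - 2 y)] of [cubic y] increases up to 3/4, so [r] dominates the contraction on
   the whole interval from 0 to [x]; it is below 1 exactly because [x] is below 1/2. *)
move=> x0 x1; pose r := x * (3 - 2 * x).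
have r0 : 0 <= r by rewrite /r; nra.
have r1 : r < 1 by rewrite /r; nra.
have bd n : 0 <= iter n cubic x <= x * r ^+ n /\ iter n cubic x <= x.
  elim: n => [|n [/andP [h1 h2] h3]]; first by rewrite expr0 mulr1 /= x0 !lexx.
  have h4 : cubic (iter n cubic x) <= iter n cubic x * r.
    by rewrite /cubic -mulrA; apply: ler_wpM2l => //; rewrite /r; nra.
  have h5 : 0 <= cubic (iter n cubic x) by rewrite /cubic; nra.
  rewrite /= h5 exprSr mulrA; split; last first.
    by apply: le_trans h4 _; nra.
  by apply: le_trans h4 _; rewrite ler_wpM2r.
apply: (@squeeze_cvgr _ _ _ _ (fun=> 0) (fun n => x * r ^+ n)).
- by apply: nearW => n; have [] := bd n.
- exact: cvg_cst.
- rewrite -[X in _ --> X](mulr0 x); apply: cvgMr; apply: cvg_expr.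
  by rewrite ger0_norm.
Qed.

Lemma iter_cubic_cvg x : 0 <= x <= 1 -> iter n cubic x @[n --> \oo] --> cubic_lim x.
Proof.
move=> /andP [x0 x1]; rewrite /cubic_lim; case: ltP => [h|h]; first exact: iter_cubic_cvg0.
case: eqP => [->|/eqP n].
  have -> : (fun n => iter n cubic (2^-1 : R)) = (fun=> 2^-1).
    by apply/funext; elim=> [|k IH] //=; rewrite IH /cubic; field.
  exact: cvg_cst.
have -> : (fun n => iter n cubic x) = (fun n => 1 - iter n cubic (1 - x)).
  by apply/funext => k; rewrite -iter_cubic1B; congr iter; ring.
rewrite -[X in _ --> X]subr0; apply: cvgB; first exact: cvg_cst.
apply: iter_cubic_cvg0; first by lra.
have : 2^-1 < x by rewrite lt_neqAle eq_sym n.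
by lra.
Qed.

End CubicIteration.

Arguments cubic {R} x.
Arguments cubic_lim {R} x.

(** * Indicators in the L2 closure of a function algebra *)

Section L2closure.
Context (d : measure_display) (T : measurableType d) (R : realType).
Variable mu : probability T R.
Implicit Types f g u v : T -> R.
Local Notation I f := (\int[mu]_(t in setT) f t)%R.

Variable A : set (T -> R).
Hypothesis A_linf : forall u, A u -> linf mu u.
Hypothesis A_comb : forall c u v, A u -> A v -> A (fun t => c * u t + v t).
Hypothesis A_mul : forall u v, A u -> A v -> A (fun t => u t * v t).
Hypothesis A_1 : A (fun=> 1).

(** The bound holds everywhere here: products stay in the class and dominated convergence applies to
    sequences with a common bound. *)
Definition l2closed f : Prop :=
  [/\ measurable_fun setT f, exists M, forall t, `|f t| <= M &
      forall e, 0 < e -> exists2 u, A u & I (fun t => (f t - u t) ^+ 2) < e].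

Lemma l2_linf f : l2closed f -> linf mu f.
Proof. by move=> [mf [M hM] _]; apply: linf_bounded => //; exists M. Qed.

Let sq f g : T -> R := fun t => (f t - g t) ^+ 2.

Lemma sq_linf f g : linf mu f -> linf mu g -> linf mu (sq f g).
Proof. by move=> hf hg; apply: linfX; exact: linfB. Qed.

Lemma l2_ae f u : A u -> measurable_fun setT f -> (exists M, forall t, `|f t| <= M) ->
  {ae mu, forall t, f t = u t} -> l2closed f.
Proof.
move=> Au mf bf fu; split=> // e e0; exists u => //.
have hf : linf mu f by exact: linf_bounded.
have [m1 _] := sq_linf hf (A_linf Au).
rewrite (@linf_I_ae _ _ _ mu _ (fun=> 0)) ?linf_I_cst //.
by apply: filterS fu => t ->; rewrite subrr expr0n.
Qed.

Lemma l2_cst c : l2closed (fun=> c).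
Proof.
have h : A (fun=> c).
  have := A_comb (c - 1) A_1 A_1; congr (A _); apply/funext => t.
  by rewrite mulr1 subrK.
by apply: (l2_ae h) => //; [by exists `|c|; move=> _|exact: aeW].
Qed.

Lemma l2_comb c f g : l2closed f -> l2closed g -> l2closed (fun t => c * f t + g t).
Proof.
move=> hf hg; have lf := l2_linf hf; have lg := l2_linf hg.
case: hf hg => mf [M fM] af [mg [N gN] ag]; split.
- by apply: measurable_funD => //; apply: measurable_funM.
- exists (`|c| * M + N) => t; rewrite (le_trans (ler_normD _ _)) // normrM.
  by rewrite lerD // ler_wpM2l.
(* The square of a sum is at most twice the sum of the squares, so each half may use up [e / 2]. *)
move=> e e0; have k0 : 0 < 4 * (c ^+ 2 + 1) by rewrite mulr_gt0 // ltr_wpDl // sqr_ge0.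
have [u Au hu] := af (e / (4 * (c ^+ 2 + 1))) (divr_gt0 e0 k0).
have [v Av hv] := ag (e / 4) (divr_gt0 e0 (ltr0n _ 4)).
exists (fun t => c * u t + v t); first exact: A_comb.
have l1 := sq_linf lf (A_linf Au); have l2 := sq_linf lg (A_linf Av).
apply: (@le_lt_trans _ _ (I (fun t => (2 * c ^+ 2) * sq f u t + 2 * sq g v t))).
  apply: linf_I_le.
  - apply: sq_linf; first by apply: linfD => //; exact: linfZ.
    by apply: A_linf; exact: A_comb.
  - by apply: linfD; exact: linfZ.
  - apply: aeW => t; rewrite /sq.
    have := sqr_ge0 (c * (f t - u t) - (g t - v t)); set a := f t; set b := u t; set a' := g t.
    by set b' := v t; nra.
rewrite linf_I_D ?linf_I_Z //; try exact: linfZ.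
have : 0 <= I (sq f u) by apply: linf_I_ge0 => //; apply: aeW => t; exact: sqr_ge0.
have c0 := sqr_ge0 c; move: hu hv; rewrite ltr_pdivlMr // ltr_pdivlMr //.
rewrite -/(sq f u) -/(sq g v); set a := I (sq f u); set b := I (sq g v); set cc := c ^+ 2 in c0 *.
by move=> h1 h2 h3; nra.
Qed.

Lemma l2_mul f g : l2closed f -> l2closed g -> l2closed (fun t => f t * g t).
Proof.
move=> hf hg; have lf := l2_linf hf; have lg := l2_linf hg.
case: hf hg => mf [M fM] af [mg [N gN] ag]; split.
- exact: measurable_funM.
- by exists (M * N) => t; rewrite normrM ler_pM.
move=> e e0; have kM : 0 < 4 * (M ^+ 2 + 1) by rewrite mulr_gt0 // ltr_wpDl // sqr_ge0.
have [v Av hv] := ag (e / (4 * (M ^+ 2 + 1))) (divr_gt0 e0 kM).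
(* The error is split as [f (g - v) + v (f - u)]. The bound [K] depends on [v], so [v] is fixed
   before [u] is chosen. *)
have [mv [K vK]] := A_linf Av.
have kK : 0 < 4 * (K ^+ 2 + 1) by rewrite mulr_gt0 // ltr_wpDl // sqr_ge0.
have [u Au hu] := af (e / (4 * (K ^+ 2 + 1))) (divr_gt0 e0 kK).
exists (fun t => u t * v t); first exact: A_mul.
have l1 := sq_linf lf (A_linf Au); have l2 := sq_linf lg (A_linf Av).
apply: (@le_lt_trans _ _ (I (fun t => (2 * M ^+ 2) * sq g v t + (2 * K ^+ 2) * sq f u t))).
  apply: linf_I_le.
  - apply: sq_linf; first exact: linfM.
    by apply: A_linf; exact: A_mul.
  - by apply: linfD; exact: linfZ.
  - apply: filterS vK => t hK; rewrite /sq.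
    have h1 : f t ^+ 2 <= M ^+ 2.
      by rewrite -[leLHS]real_normK ?num_real // ler_sqr ?nnegrE // (le_trans _ (fM t)).
    have h2 : v t ^+ 2 <= K ^+ 2.
      by rewrite -[leLHS]real_normK ?num_real // ler_sqr ?nnegrE // (le_trans _ hK).
    have := sqr_ge0 (f t * (g t - v t) - v t * (f t - u t)).
    have h3 := ler_wpM2r (sqr_ge0 (g t - v t)) h1.
    have h4 := ler_wpM2r (sqr_ge0 (f t - u t)) h2.
    have -> : f t * g t - u t * v t = f t * (g t - v t) + v t * (f t - u t) by ring.
    move: h3 h4; set p := g t - v t; set r := f t - u t; set x := f t; set y := v t.
    by move=> h3 h4 h5; lra.
rewrite linf_I_D ?linf_I_Z //; try exact: linfZ.
have : 0 <= I (sq f u) by apply: linf_I_ge0 => //; apply: aeW => t; exact: sqr_ge0.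
have : 0 <= I (sq g v) by apply: linf_I_ge0 => //; apply: aeW => t; exact: sqr_ge0.
have c0 := sqr_ge0 M; have c1 := sqr_ge0 K; move: hu hv; rewrite ltr_pdivlMr // ltr_pdivlMr //.
rewrite -/(sq f u) -/(sq g v); set a := I (sq f u); set b := I (sq g v); set cc := M ^+ 2 in c0 *.
by set cd := K ^+ 2 in c1 *; move=> h1 h2 h3 h4; nra.
Qed.

Lemma l2_lim (s : nat -> T -> R) f M : (forall n, l2closed (s n)) ->
  (forall n t, `|s n t| <= M) -> (forall t, s n t @[n --> \oo] --> f t) -> l2closed f.
Proof.
move=> hs sM sf.
have ms n : measurable_fun setT (s n) by case: (hs n).
have mf : measurable_fun setT f.
  by apply: (@measurable_fun_cvg _ _ _ setT s) => // t _; exact: sf.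
have fM t : `|f t| <= M.
  have c : `|s n t| @[n --> \oo] --> `|f t| by apply: cvg_norm; exact: sf.
  by rewrite -(cvg_lim _ c) //; apply: limr_le; [apply/cvg_ex; eexists; exact: c|exact: nearW].
split=> //; first by exists M.
move=> e e0.
have lf : linf mu f by apply: linf_bounded => //; exists M.
have : I (sq f (s n)) @[n --> \oo] --> I (fun=> 0).
  apply: (@linf_I_lim _ _ _ mu (fun n => sq f (s n)) _ ((M + M) ^+ 2)) => //.
  - by move=> n; have [] := sq_linf lf (l2_linf (hs n)).
  - move=> n t; rewrite /sq ger0_norm ?sqr_ge0 // -real_normK ?num_real //.
    have h : `|f t - s n t| <= M + M.
      by rewrite (le_trans (ler_normD _ _)) // normrN lerD.
    by rewrite ler_sqr ?nnegrE // (le_trans _ h).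
  - move=> t; rewrite -[X in _ --> X](expr0n R 2) -(subrr (f t)) /sq.
    apply: (@cvg_comp _ _ _ (fun n => f t - s n t) (fun x => x ^+ 2)); last exact: exprn_continuous.
    by apply: cvgB; [exact: cvg_cst|exact: sf].
rewrite linf_I_cst => /cvgrPdist_lt /(_ (e / 4)) [|n _ /(_ n (leqnn n))]; first by rewrite divr_gt0.
rewrite sub0r normrN; set a := I (sq f (s n)) => ha.
have {}ha : a < e / 4 := le_lt_trans (ler_norm _) ha.
have [_ _ /(_ (e / 4))] := hs n; rewrite divr_gt0 // => /(_ isT) [u Au hu].
exists u => //; have lu := A_linf Au; have ls := l2_linf (hs n).
have l1 := sq_linf lf ls; have l2 := sq_linf ls lu.
apply: (@le_lt_trans _ _ (I (fun t => 2 * sq f (s n) t + 2 * sq (s n) u t))).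
  apply: linf_I_le; [exact: sq_linf|by apply: linfD; exact: linfZ|].
  apply: aeW => t; rewrite /sq; have := sqr_ge0 ((f t - s n t) - (s n t - u t)).
  by set x := f t; set y := s n t; set z := u t; lra.
rewrite linf_I_D ?linf_I_Z //; try exact: linfZ.
by move: hu ha; rewrite -/(sq (s n) u) /a; set b := I (sq (s n) u); set b' := I (sq f (s n)); lra.
Qed.

Definition l2set (S : set T) : Prop := measurable S /\ l2closed (\1_S).

Lemma l2setC S : l2set S -> l2set (~` S).
Proof.
move=> [mS hS]; split; first exact: measurableC.
have := l2_comb (- 1) hS (l2_cst 1); congr (l2closed _); apply/funext => t.
rewrite !indicE in_setC; case: (t \in S) => /=; first by rewrite mulr1 addNr.
by rewrite mulr0 add0r.
Qed.

Lemma l2setI S S' : l2set S -> l2set S' -> l2set (S `&` S').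
Proof.
move=> [mS hS] [mS' hS']; split; first exact: measurableI.
by have := l2_mul hS hS'; congr (l2closed _); rewrite indicI.
Qed.

Lemma l2setU S S' : l2set S -> l2set S' -> l2set (S `|` S').
Proof.
by move=> /l2setC hS /l2setC hS'; rewrite -[_ `|` _]setCK setCU; apply/l2setC/l2setI.
Qed.

Lemma l2setT : l2set setT.
Proof. by split=> //; have := l2_cst 1; congr (l2closed _); rewrite indicT. Qed.

Lemma l2set0 : l2set set0.
Proof. by rewrite -setCT; exact/l2setC/l2setT. Qed.

Lemma l2set_bigcup (F : nat -> set T) : (forall n, l2set (F n)) -> l2set (\bigcup_n F n).
Proof.
move=> hF; split; first by apply: bigcup_measurable => n _; case: (hF n).
pose U n := \big[setU/set0]_(k < n) F k.
have hU n : l2set (U n).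
  rewrite /U; elim: n => [|n IH]; first by rewrite big_ord0; exact: l2set0.
  by rewrite big_ord_recr /=; exact: l2setU.
apply: (@l2_lim (fun n => \1_(U n)) _ 1).
- by move=> n; case: (hU n).
- by move=> n t; rewrite indicE ger0_norm // lern1; case: (_ \in _).
move=> t; rewrite indicE; have [tF|tF] := boolP (t \in \bigcup_n F n).
  have [n _ Fn] := set_mem tF.
  apply: cvg_near_cst; near=> m; rewrite indicE mem_set //.
  rewrite /U -bigcup_mkord; exists n => //=; near: m; exact: nbhs_infty_gt.
apply: cvg_near_cst; apply: nearW => m; rewrite indicE memNset //.
rewrite /U -bigcup_mkord => -[n _ Fn]; case/negP: tF; apply/mem_set.
by exists n.
Unshelve. all: by end_near. Qed.

Lemma l2set_bigcap (F : nat -> set T) : (forall n, l2set (F n)) -> l2set (\bigcap_n F n).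
Proof.
move=> hF; rewrite -[\bigcap_n _]setCK setC_bigcap; apply/l2setC/l2set_bigcup => n.
exact: l2setC.
Qed.

Lemma l2_iter_cubic v n : l2closed v -> l2closed (fun t => iter n cubic (v t)).
Proof.
move=> hv; elim: n => [|n IH] //=.
have := l2_mul (l2_mul IH IH) (l2_comb (- 2) IH (l2_cst 3)).
by congr (l2closed _); apply/funext => t; rewrite /cubic mulNr addrC.
Qed.

Lemma measurable_gt v c : measurable_fun setT v -> measurable [set t | c < v t].
Proof.
move=> mv; have := mv measurableT `]c, +oo[%classic (measurable_itv _).
by rewrite setTI; congr measurable; apply/seteqP; split=> t /=; rewrite in_itv /= andbT.
Qed.

Lemma l2set_half v : l2closed v -> (forall t, 0 <= v t <= 1) -> l2set [set t | 2^-1 < v t].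
Proof.
move=> hv v01; have [mv _ _] := hv; split; first exact: measurable_gt.
have h : l2closed (fun t => cubic_lim (v t)).
  apply: (@l2_lim (fun n t => iter n cubic (v t)) _ 1) => [n|n t|t].
  - exact: l2_iter_cubic.
  - by have /andP [h0 h1] := iter_cubic_itv n (v01 t); rewrite ger0_norm.
  - exact: iter_cubic_cvg.
(* On the values 0, 1/2 and 1 of [cubic_lim], the polynomial [y (2 y - 1)] takes 0, 0 and 1. *)
have := l2_mul h (l2_comb 2 h (l2_cst (- 1))); congr (l2closed _); apply/funext => t.
rewrite indicE /cubic_lim; case: (ltgtP (v t) 2^-1) => e.
- by rewrite memNset ?mul0r //= => /lt_trans /(_ e); rewrite ltxx.
- by rewrite mem_set //=; ring.
- rewrite memNset /= ?e ?ltxx //.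
  by rewrite mulfV // addrN mulr0.
Qed.

Lemma l2set_gt u c : A u -> l2set [set t | c < u t].
Proof.
move=> Au; have [mu' [M uM]] := A_linf Au.
(* [w] is the affine rescaling of [u] that sends [c] to 1/2, with [L] so large that its values lie
   in the unit interval almost everywhere; [v] truncates it so that they do everywhere. *)
pose L := 2 * (`|M| + `|c| + 1).
have L0 : 0 < L by rewrite mulr_gt0 // ltr_wpDl // addr_ge0.
pose w t := L^-1 * u t + (2^-1 - c / L).
pose v t := Num.max 0 (Num.min 1 (w t)).
have Aw : A w.
  have A0 : A (fun=> 2^-1 - c / L).
    have := A_comb (2^-1 - c / L - 1) A_1 A_1; congr (A _); apply/funext => t.
    by rewrite mulr1 subrK.
  exact: A_comb.
have [mw _] := A_linf Aw.
have v01 t : 0 <= v t <= 1.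
  by rewrite /v le_max lexx ge_max ler01 ge_min lexx.
have hv : l2closed v.
  apply: (l2_ae Aw).
  - by apply: measurable_maxr => //; apply: measurable_minr.
  - by exists 1 => t; have /andP [h0 h1] := v01 t; rewrite ger0_norm.
  apply: filterS uM => t ut; rewrite /v /w.
  have hM : `|u t| <= `|M| by rewrite (le_trans ut) // ler_norm.
  have e : L^-1 * u t + (2^-1 - c / L) = (u t - c + L / 2) / L by field; rewrite gt_eqF.
  have hc := ler_norm c; have hc' := ler_norm (- c); rewrite normrN in hc'.
  have /andP [h1 h2] : - `|M| <= u t <= `|M| by rewrite -ler_norml.
  have w1 : (u t - c + L / 2) / L <= 1 by rewrite ler_pdivrMr // mul1r /L; lra.
  have w0 : 0 <= (u t - c + L / 2) / L by rewrite divr_ge0 ?(ltW L0) // /L; lra.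
  by rewrite e (min_r w1) (max_r w0).
have := l2set_half hv v01; congr (l2set _); apply/seteqP; split=> t /=.
  rewrite /v lt_max => /orP [h|]; first by lra.
  rewrite lt_min => /andP [_]; rewrite /w => h.
  have : 0 < (u t - c) / L by move: h; rewrite mulrBl [L^-1 * _]mulrC; lra.
  by rewrite pmulr_lgt0 ?invr_gt0 // subr_gt0.
move=> cu; rewrite /v lt_max lt_min; apply/orP; right; apply/andP; split; first by lra.
have : 0 < (u t - c) / L by rewrite divr_gt0 // subr_gt0.
by rewrite /w mulrBl [L^-1 * _]mulrC; lra.
Qed.

Lemma l2set_dist u c e : A u -> l2set [set t | `|u t - c| < e].
Proof.
move=> Au; have Nu : A (fun t => - 1 * u t + 0).
  have A0 : A (fun=> 0).
    by have := A_comb (- 1) A_1 A_1; congr (A _); apply/funext => t; rewrite mulr1 addNr.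
  exact: A_comb.
have := l2setI (l2set_gt (c - e) Au) (l2set_gt (- c - e) Nu).
congr (l2set _); apply/seteqP; split=> t /=.
  by move=> [h1 h2]; rewrite ltr_norml; lra.
by rewrite ltr_norml => /andP [h1 h2]; split; lra.
Qed.

(* Cells with rational centres make the neighbourhoods of [K] countable unions. *)
Lemma l2set_separated (K : set T) (u : nat -> T -> R) : (forall n, A (u n)) ->
  (forall t, (forall n, exists2 s, K s & forall i, (i < n)%N -> `|u i t - u i s| < 2 / n.+1%:R) -> K t) ->
  l2set K.
Proof.
move=> Au hK.
pose cell n (r : seq rat) : set T :=
  \bigcap_i (if (i < n)%N then [set t | `|u i t - ratr (nth 0 r i)| < n.+1%:R^-1] else setT).
have hcell n r : l2set (cell n r).
  by apply: l2set_bigcap => i; case: ifP => _; [exact: l2set_dist|exact: l2setT].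
pose W n r := if `[< cell n r `&` K !=set0 >] then cell n r else set0.
pose V n : set T := \bigcup_(k in [set: nat]) W n (odflt [::] (choice.unpickle k)).
have hV n : l2set (V n).
  rewrite /V; apply: l2set_bigcup => k; rewrite /W.
  by case: asboolP => _; [exact: hcell|exact: l2set0].
have -> : K = \bigcap_n V n; last exact: l2set_bigcap.
apply/seteqP; split=> t.
  move=> Kt n _; have /choice [r hr] : forall i, exists r : rat, `|u i t - ratr r| < n.+1%:R^-1.
    move=> i; have [|r] := @rat_in_itvoo R (u i t - n.+1%:R^-1) (u i t + n.+1%:R^-1).
      by rewrite ltrD2l gtrN // invr_gt0 ltr0n.
    rewrite in_itv /= => /andP [h1 h2]; exists r.
    by rewrite ltr_distl; apply/andP; split; [rewrite ltrBlDr|rewrite -ltrBlDr].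
  have tc : cell n (mkseq r n) t.
    by move=> i _; case: ifP => // lin /=; rewrite nth_mkseq.
  exists (choice.pickle (mkseq r n)) => //; rewrite choice.pickleK /W asboolT //.
  by exists t.
move=> Vt; apply: hK => n; have [k _] := Vt n Logic.I.
set r := odflt _ _; rewrite /W; case: asboolP => // -[s [rs Ks]] rt; exists s => // i lin.
have := rs i Logic.I; have := rt i Logic.I; rewrite lin /= => h1 h2.
have -> : u i t - u i s = (u i t - ratr (nth 0 r i)) - (u i s - ratr (nth 0 r i)) by ring.
rewrite (le_lt_trans (ler_normB _ _)) //.
have -> : 2 / n.+1%:R = n.+1%:R^-1 + n.+1%:R^-1 :> R by rewrite mulr2n mulrDl mul1r.
exact: ltrD.
Qed.

End L2closure.

(** * The torus *)

Section ComplexLimits.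
Variables (R : realType) (T : Type) (F : set_system T).
Context {FF : Filter F}.
Local Notation C := (R[i] : numFieldType).
Implicit Types (g : T -> C) (z : C).

Lemma Re_norm_le z : `|complex.Re z| <= complex.Re `|z|.
Proof. by case: z => a b; rewrite normc_def /= -sqrtr_sqr ler_sqrt ?lerDl ?sqr_ge0 // addr_ge0 ?sqr_ge0. Qed.

Lemma Im_norm_le z : `|complex.Im z| <= complex.Re `|z|.
Proof. by case: z => a b; rewrite normc_def /= -sqrtr_sqr ler_sqrt ?lerDr ?sqr_ge0 // addr_ge0 ?sqr_ge0. Qed.

Lemma Re_norm_leD z : complex.Re `|z| <= `|complex.Re z| + `|complex.Im z|.
Proof.
case: z => a b; rewrite normc_def /= -[leRHS]ger0_norm ?addr_ge0 // -sqrtr_sqr ler_wsqrtr //.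
have := mulr_ge0 (normr_ge0 a) (normr_ge0 b).
by rewrite -(real_normK (num_real a)) -(real_normK (num_real b)); nra.
Qed.

Lemma cvgC_Re g z : g @ F --> z -> complex.Re (g t) @[t --> F] --> complex.Re z.
Proof.
move=> /cvgrPdist_lt gz; apply/cvgrPdist_lt => e e0.
have := gz e%:C; rewrite ltcR => /(_ e0); apply: filterS => t.
rewrite -ReCN -ReCD => h; rewrite (le_lt_trans (Re_norm_le _)) //.
by move: h; rewrite normc_def ltcR.
Qed.

Lemma cvgC_Im g z : g @ F --> z -> complex.Im (g t) @[t --> F] --> complex.Im z.
Proof.
move=> /cvgrPdist_lt gz; apply/cvgrPdist_lt => e e0.
have := gz e%:C; rewrite ltcR => /(_ e0); apply: filterS => t.
rewrite -ImCN -ImCD => h; rewrite (le_lt_trans (Im_norm_le _)) //.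
by move: h; rewrite normc_def ltcR.
Qed.

Lemma cvgC g z : complex.Re (g t) @[t --> F] --> complex.Re z ->
  complex.Im (g t) @[t --> F] --> complex.Im z -> g @ F --> z.
Proof.
move=> /cvgrPdist_lt hr /cvgrPdist_lt hi; apply/cvgrPdist_lt => e e0.
have ee : e = (complex.Re e)%:C by exact: ge0_ReC (ltW e0).
have r0 : 0 < complex.Re e / 2 by rewrite divr_gt0 // -ltcR -ee.
apply: filterS2 (hr _ r0) (hi _ r0) => t.
rewrite -ReCN -ImCN -ReCD -ImCD ee => h1 h2.
rewrite normc_def ltcR; have := Re_norm_leD (z - g t); rewrite normc_def /=.
by move/le_lt_trans; apply; lra.
Qed.

End ComplexLimits.

Lemma continuous_sum (R : realType) (T : topologicalType) (I : Type) (r : seq I) (g : I -> T -> R) :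
  (forall i, continuous (g i)) -> continuous (fun t => \sum_(i <- r) g i t).
Proof.
move=> cg; elim: r => [|i r IH].
  by under eq_fun do rewrite big_nil; move=> t; exact: cvg_cst.
by under eq_fun do rewrite big_cons; move=> t; apply: cvgD; [exact: cg|exact: IH].
Qed.

Lemma continuous_comb (R : realType) (T : topologicalType) (a b : R) (f g : T -> R) :
  continuous f -> continuous g -> continuous (fun t => a * f t + b * g t).
Proof. by move=> cf cg t; apply: cvgD; apply: cvgMr; [exact: cf|exact: cg]. Qed.

Section TorusTopology.
Variables (R : realType) (D : root_datum).
Local Notation C := (R[i] : numFieldType).
Local Notation X := (rd_X D).
Local Notation torus := (torus R D).

Lemma eval_continuous x : continuous (fun t : torus => (t x : C)).
Proof.
move=> t; apply: (@continuous_comp _ {ptws X -> C} C (set_val : torus -> {ptws X -> C}) (fun f => f x)).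
  exact: initial_continuous.
exact: (@proj_continuous X (fun=> C) x).
Qed.

Lemma cvg_torus (F : set_system torus) (t : torus) : Filter F ->
  (forall x, complex.Re (s x) @[s --> F] --> complex.Re (t x)) ->
  (forall x, complex.Im (s x) @[s --> F] --> complex.Im (t x)) -> F --> t.
Proof.
move=> FF hr hi U [B /= [[V oV <-] tV] VU].
apply: (@filterS _ F _ _ _ VU).
have : (set_val @ F : set_system {ptws X -> C}) --> (set_val t : {ptws X -> C}).
  apply/cvg_sup => x W [B' /= [[V' oV' <-] tV'] VW].
  apply: (@filterS _ F _ _ _ (fun s h => VW _ h)) => /=.
  have := @cvgC R torus F FF (fun s => s x) (t x) (hr x) (hi x).
  by apply; apply: open_nbhs_nbhs; split.
by apply; apply: open_nbhs_nbhs; split.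
Qed.

Lemma Re_eval_continuous x : continuous (fun t : torus => complex.Re (t x)).
Proof. by move=> t; apply: (@cvgC_Re R torus (nbhs t)); exact: eval_continuous. Qed.

Lemma Im_eval_continuous x : continuous (fun t : torus => complex.Im (t x)).
Proof. by move=> t; apply: (@cvgC_Im R torus (nbhs t)); exact: eval_continuous. Qed.

Lemma torus_actE w (t : torus) x : torus_act w t x = t (weyl_fun w^-1%g x).
Proof. by rewrite {1}/torus_fun set_valE. Qed.

Lemma torus_act_continuous w : continuous (torus_act w : torus -> torus).
Proof.
move=> t; have FF : Filter ((torus_act w : torus -> torus) @ nbhs t) by typeclasses eauto.
apply: (cvg_torus FF) => x U; rewrite torus_actE => nU.
  apply: (@filterS _ (nbhs t) _ _ _ _ (@Re_eval_continuous (weyl_fun w^-1%g x) t U nU)).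
  by move=> s /=; rewrite -torus_actE.
apply: (@filterS _ (nbhs t) _ _ _ _ (@Im_eval_continuous (weyl_fun w^-1%g x) t U nU)).
by move=> s /=; rewrite -torus_actE.
Qed.

Lemma laurent_eval_continuous p :
  continuous (fun t : torus => complex.Re (laurent_eval p t)) /\
  continuous (fun t : torus => complex.Im (laurent_eval p t)).
Proof.
have ReS (r : seq X) (G : X -> R[i]) : complex.Re (\sum_(x <- r) G x) = \sum_(x <- r) complex.Re (G x).
  by apply: (big_morph (@complex.Re R) (@ReCD R)).
have ImS (r : seq X) (G : X -> R[i]) : complex.Im (\sum_(x <- r) G x) = \sum_(x <- r) complex.Im (G x).
  by apply: (big_morph (@complex.Im R) (@ImCD R)).
split.
  have -> : (fun t : torus => complex.Re (laurent_eval p t)) = (fun t => \sum_(x <- finsupp p)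
      (complex.Re (p x) * complex.Re (t x) + - complex.Im (p x) * complex.Im (t x))).
    apply/funext => t; rewrite /laurent_eval ReS; apply: eq_bigr => x _.
    by rewrite ReCM mulNr.
  apply: continuous_sum => x.
  by apply: continuous_comb; [exact: Re_eval_continuous|exact: Im_eval_continuous].
have -> : (fun t : torus => complex.Im (laurent_eval p t)) = (fun t => \sum_(x <- finsupp p)
    (complex.Re (p x) * complex.Im (t x) + complex.Im (p x) * complex.Re (t x))).
  by apply/funext => t; rewrite /laurent_eval ImS; apply: eq_bigr => x _; rewrite ImCM.
apply: continuous_sum => x.
by apply: continuous_comb; [exact: Im_eval_continuous|exact: Re_eval_continuous].
Qed.

Lemma continuous_borel (g : torus -> R) : continuous g ->
  measurable_fun [set: torus_borel R D] (g : torus_borel R D -> R).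
Proof.
move=> /continuousP cg; apply: (measurability _ (RGenOpens.measurableE R)).
move=> _ [_ [a [b ->] <-]]; rewrite setTI; apply: sub_sigma_algebra.
by apply: cg; exact: interval_open.
Qed.

(** Along an ultrafilter each coordinate converges in a compact segment. The limit is multiplicative
    with value 1 at 0, hence nowhere zero: the bound at [- x] keeps the values at [x] away from
    0. *)
Lemma torus_compact (c : X -> R) :
  compact [set t : torus | forall x, complex.Re `|t x| <= c x].
Proof.
rewrite compact_ultra => F FU Fc; have FP : ProperFilter F by exact: ultra_proper.
have lim (g : torus -> R) (m : R) : (forall t : torus, (forall x, complex.Re `|t x| <= c x) -> `|g t| <= m) ->
    exists2 l, `|l| <= m & g @ F --> l.
  move=> gm; have Fg : F (g @^-1` `[- m, m]%classic).
    by apply: filterS Fc => t /gm; rewrite /= in_itv /= ler_norml.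
  have [l [/= lm gl]] := @segment_compact R (- m) m (g @ F) _ Fg.
  exists l; first by rewrite ler_norml; move: lm; rewrite in_itv.
  move=> U nU; have [//|nF] := in_ultra_setVsetC (g @^-1` U) FU.
  by have [r [/= h1 h2]] := gl (~` U) U nF nU.
have ea : forall x : X, exists a : R, (fun t : torus => complex.Re (t x)) @ F --> a.
  move=> x; have [|l _ hl] := lim (fun t => complex.Re (t x)) (c x); last by exists l.
  by move=> t /(_ x); apply: le_trans; exact: Re_norm_le.
have eb : forall x : X, exists b : R, (fun t : torus => complex.Im (t x)) @ F --> b.
  move=> x; have [|l _ hl] := lim (fun t => complex.Im (t x)) (c x); last by exists l.
  by move=> t /(_ x); apply: le_trans; exact: Im_norm_le.
have [a ha] := choice ea; have [b hb] := choice eb.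
have uniq (g : torus -> R) (k l : R) : g @ F --> k -> g @ F --> l -> k = l.
  by move=> h1 h2; apply: (cvg_unique _ h1 h2).
pose l x : R[i] := a x +i* b x.
have lD x y : l (x + y) = l x * l y.
  apply: complex_ext.
    rewrite ReCM /=; apply: (uniq (fun t => complex.Re (t (x + y)))) => //.
    under eq_fun do rewrite torusD ReCM.
    by apply: cvgB; apply: cvgM.
  rewrite ImCM /=; apply: (uniq (fun t => complex.Im (t (x + y)))) => //.
  under eq_fun do rewrite torusD ImCM.
  by apply: cvgD; apply: cvgM.
have l0 : l 0 = 1.
  apply: complex_ext => /=.
    apply: (uniq (fun t => complex.Re (t 0))) => //.
    by under eq_fun do rewrite torus0; exact: cvg_cst.
  apply: (uniq (fun t => complex.Im (t 0))) => //.
  by under eq_fun do rewrite torus0; exact: cvg_cst.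
have lC : is_char (l : {ptws X -> C}).
  split=> // x; apply/eqP => lx.
  have := lD x (- x); rewrite subrr l0 lx mul0r => /eqP.
  by rewrite oner_eq0.
pose t : torus := SigSub (mem_set lC).
have tE x : t x = l x by rewrite /torus_fun set_valE.
exists t; split; last by apply: cvg_torus => x; rewrite tE; [exact: ha|exact: hb].
move=> x; have [|k kc hk] := lim (fun t : torus => complex.Re `|t x|) (c x).
  by move=> s /(_ x); rewrite (ger0_norm (Re_norm_ge0 (s x))).
rewrite tE.
have -> : complex.Re `|l x| = k; last by move: kc; rewrite ler_norml => /andP [].
apply: (uniq (fun t : torus => complex.Re `|t x|)) => //.
have lx : (fun t : torus => (t x : C)) @ F --> (l x : C) by apply: cvgC.
exact: (@cvgC_Re R torus F _ (fun t => `|t x|) `|l x| (cvg_norm lx)).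
Qed.

End TorusTopology.

(** * Separation of W_0-orbits by invariant Laurent polynomials *)

Section OrbitSeparation.
Variables (R : realType) (D : root_datum).
Local Notation X := (rd_X D).
Local Notation torus := (torus R D).
Implicit Types (s t u : torus) (p : laurent R D).

Lemma torus_ext s t : (forall x, s x = t x) -> s = t.
Proof.
move=> st; apply: val_inj; have : torus_fun s = torus_fun t by apply/funext.
by rewrite /torus_fun !set_valE.
Qed.

Lemma torus_neq s t : s <> t -> exists x, s x != t x.
Proof.
move=> n; apply/not_existsP => h; apply: n; apply: torus_ext => x.
by have /negP := h x; rewrite negbK => /eqP.
Qed.

Lemma laurent_interpolation s (L : seq torus) : s \notin L ->
  exists p, laurent_eval p s = 1 /\ {in L, forall u, laurent_eval p u = 0}.
Proof.
elim: L => [|u L IH]; first by exists (lmono R 0); rewrite eval_mono torus0.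
rewrite inE negb_or => /andP [/eqP /torus_neq [x sux] /IH [p [ps pL]]].
pose c := (s x - u x)^-1.
(* The first factor evaluates to [(v x - u x) / (s x - u x)] at [v]; the inner [lcomb] is the
   constant [- u x * c]. *)
exists (lmulp (lcomb c (lmono R x) (lcomb (- u x * c - 1) (lmono R 0) (lmono R 0))) p).
have c0 : s x - u x != 0 by rewrite subr_eq0.
split; first by rewrite eval_mul ps !eval_comb !eval_mono torus0 /c; field.
move=> v; rewrite inE eval_mul => /orP [/eqP ->|/pL ->]; last by rewrite mulr0.
by rewrite !eval_comb !eval_mono torus0 /c; ring.
Qed.

(** Equal orbit sums of monomials give equal orbit sums of all Laurent polynomials. On disjoint
    orbits, one that is 1 at [s] and 0 at all other points of both orbits gives a positive count on
    one side and 0 on the other. *)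
Lemma orbit_separation s t :
  (forall x, laurent_eval (lorbit R x) s = laurent_eval (lorbit R x) t) ->
  exists w, s = torus_act w t.
Proof.
move=> st; apply/not_existsP => hn.
pose pt (u : torus) (w : weyl D) := torus_act w^-1%g u.
have ptE u w x : pt u w x = u (w x) by rewrite torus_actE invgK.
have sumE p : \sum_(w <- weyl_seq D) laurent_eval p (pt s w) =
    \sum_(w <- weyl_seq D) laurent_eval p (pt t w).
  rewrite !(exchange_big _ _ (finsupp p)) /=; apply: eq_bigr => x _.
  rewrite -!mulr_sumr; congr (_ * _); have := st x; rewrite !eval_orbit.
  by under eq_bigr do rewrite -ptE; under [in RHS]eq_bigr do rewrite -ptE.
pose L := [seq u <- [seq pt s w | w <- weyl_seq D] ++ [seq pt t w | w <- weyl_seq D] | u != s].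
have [p [ps pL]] : exists p, laurent_eval p s = 1 /\ {in L, forall u, laurent_eval p u = 0}.
  by apply: laurent_interpolation; rewrite mem_filter eqxx.
have := sumE p; rewrite [RHS]big1_seq; last first.
  move=> w /andP [_ wW]; apply: pL; rewrite mem_filter mem_cat (map_f (pt t)) // orbT andbT.
  by apply/eqP => e; apply: (hn w^-1%g).
have s1 : pt s 1%g = s by apply: torus_ext => x; rewrite ptE.
have -> : \sum_(w <- weyl_seq D) laurent_eval p (pt s w) =
    (\sum_(w <- weyl_seq D) (pt s w == s)%N)%:R.
  rewrite natr_sum; apply: eq_big_seq => w wW; have [->|n] := eqVneq (pt s w) s => //.
  by apply: pL; rewrite mem_filter n mem_cat (map_f (pt s)).
move/eqP; rewrite pnatr_eq0 sum_nat_seq_eq0 => /allP /(_ 1%g (mem_weyl_seq _)).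
by rewrite s1 eqxx.
Qed.

End OrbitSeparation.

Lemma lattice_enum (V : zmodType) : is_lattice V -> exists e : nat -> V, forall x, exists n, e n = x.
Proof.
move=> [n [b [g gK bK]]].
exists (fun k => \sum_(i < n) b i *~ (odflt [ffun=> 0] (choice.unpickle k) : {ffun 'I_n -> int}) i).
by move=> x; exists (choice.pickle (g x)); rewrite choice.pickleK /= -{2}(bK x).
Qed.

(** * Exhaustion of the torus by invariant compact sets *)

Section TorusExhaustion.
Variables (R : realType) (D : root_datum).
Local Notation X := (rd_X D).
Local Notation torus := (torus R D).
Implicit Types (t : torus) (v w : weyl D).

Lemma torus_actM v w t : torus_act v (torus_act w t) = torus_act (v * w)%g t.
Proof. by apply: torus_ext => x; rewrite !torus_actE invgM. Qed.

Lemma torus_act1 t : torus_act 1%g t = t.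
Proof. by apply: torus_ext => x; rewrite torus_actE invg1. Qed.

(** The exponent does not depend on [t], so the integer [m] alone indexes the exhaustion. *)
Lemma torus_growth : exists N : X -> nat, forall t, exists m : nat,
  (0 < m)%N /\ forall x, complex.Re `|t x| <= m%:R ^+ N x.
Proof.
have [n [b [g gK bK]]] := rd_latticeX D.
exists (fun x => \sum_(i < n) `|g x i|)%N => t.
pose r (x : X) : R := complex.Re `|t x|.
have rM x y : r (x + y) = r x * r y.
  rewrite /r torusD normrM; have := normr_ge0 (t x); have := normr_ge0 (t y).
  by move=> /ge0_ReC -> /ge0_ReC ->; rewrite ReCM /= mulr0 subr0.
have r0 : r 0 = 1 by rewrite /r torus0 normr1.
have r_ge0 x : 0 <= r x by exact: Re_norm_ge0.
(* Bounds the moduli at all basis vectors and their opposites and is at least 1; the exponent is the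
   l1 norm of the coordinates. *)
pose M := 1 + \sum_(i < n) (r (b i) + r (- b i)).
have s0 : 0 <= \sum_(i < n) (r (b i) + r (- b i)) by apply: sumr_ge0 => i _; rewrite addr_ge0.
have bM i : r (b i) <= M /\ r (- b i) <= M.
  rewrite /M (bigD1 i) //=.
  have h : 0 <= \sum_(j < n | j != i) (r (b j) + r (- b j)).
    by apply: sumr_ge0 => j _; rewrite addr_ge0.
  by have := r_ge0 (b i); have := r_ge0 (- b i); split; lra.
have rX x k : r (x *+ k) = r x ^+ k.
  by elim: k => [|k IH]; rewrite ?mulr0n ?r0 // mulrS rM IH exprS.
have rZ i z : r (b i *~ z) <= M ^+ `|z|%N.
  case: z => k /=; first by rewrite -pmulrn rX; apply: lerXn2r; rewrite ?nnegrE ?r_ge0 ?(bM i).1 // /M; lra.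
  rewrite NegzE mulrNz -mulNrz -pmulrn rX /=.
  by apply: lerXn2r; rewrite ?nnegrE ?r_ge0 ?(bM i).2 // /M; lra.
exists (Num.truncn M).+1; split=> // x.
have hM : M <= (Num.truncn M).+1%:R by apply/ltW/truncnS_gt.
have M0 : 0 <= M by rewrite /M; lra.
apply: (@le_trans _ _ (M ^+ (\sum_(i < n) `|g x i|)%N)); last first.
  by apply: lerXn2r; rewrite ?nnegrE.
rewrite -/(r x) -[in leLHS](bK x) /=.
elim/big_ind2 : _ => [|y k z l hy hz|i _]; first by rewrite r0 expr0.
  by rewrite rM exprD ler_pM.
exact: rZ.
Qed.

Definition torus_inv (P : set torus) : Prop := forall w t, P t -> P (torus_act w t).

Lemma torus_exhaustion : exists C : nat -> set torus,
  [/\ forall n, compact (C n), forall n, torus_inv (C n) & forall t, exists n, C n t].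
Proof.
have [N hN] := torus_growth.
(* Summing the exponent over W_0 makes the compact sets invariant; since [m] is at least 1,
   enlarging the exponent only weakens the bound. *)
pose N' x := (\sum_(w <- weyl_seq D) N (w x))%N.
have N'E w x : N' (weyl_fun w x) = N' x by rewrite /N' -(sum_weyl_seq (fun v : weyl D => N (v x)) w).
have NN' x : (N x <= N' x)%N.
  by rewrite /N' (big_rem 1%g) ?mem_weyl_seq //= leq_addr.
exists (fun n => [set t : torus | forall x, complex.Re `|t x| <= n%:R ^+ N' x]); split.
- by move=> n; exact: torus_compact.
- by move=> n w t /= h x; rewrite torus_actE -(N'E w^-1%g x).
- move=> t; have [m [m0 hm]] := hN t; exists m => x /=.
  by rewrite (le_trans (hm x)) // ler_weXn2l // ler1n.
Qed.

End TorusExhaustion.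

(** * Density of the center in the invariant functions of L2 *)

Section InvariantBorel.
Variables (R : realType) (D : root_datum) (nu : probability (torus_borel R D) R).
Local Notation X := (rd_X D).
Local Notation torus := (torus R D).
Local Notation B := (torus_borel R D).
Hypothesis eval_bounded : forall p : laurent R D, laurent_inv p ->
  exists M, {ae nu, forall t, complex.Re `|laurent_eval p t| <= M}.
Hypothesis eval_lstar : {ae nu, forall t, forall p : laurent R D, laurent_inv p ->
  laurent_eval (lstar p) t = conjc (laurent_eval p t)}.

Let aeF : Filter (almost_everywhere nu).
Proof. exact: ae_filter_ringOfSetsType. Qed.
Existing Instance aeF.

(** A Laurent polynomial of the center becomes real, or equals a real part, only on the spectrum;
    hence real functions that agree almost everywhere with an element of the center. *)
Definition realZ (u : B -> R) : Prop :=
  measurable_fun setT u /\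
  exists p, laurent_inv p /\ {ae nu, forall t, laurent_eval p t = (u t)%:C}.

Lemma realZ_linf u : realZ u -> linf nu u.
Proof.
move=> [mu [p [pI pu]]]; split=> //; have [M hM] := eval_bounded pI.
exists M; apply: filterS2 pu hM => t -> h.
exact: le_trans (Re_norm_le (u t)%:C) h.
Qed.

Lemma realZ_comb c u v : realZ u -> realZ v -> realZ (fun t => c * u t + v t).
Proof.
move=> [mu [p [pI pu]]] [mv [r [rI rv]]]; split.
  by apply: measurable_funD => //; apply: measurable_funM.
exists (lcomb c%:C p r); split; first exact: lcomb_inv.
apply: filterS2 pu rv => t e1 e2; rewrite eval_comb e1 e2.
by rewrite -[(_ * _ + _)%:C]/(real_complex R _) rmorphD rmorphM.
Qed.

Lemma realZ_mul u v : realZ u -> realZ v -> realZ (fun t => u t * v t).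
Proof.
move=> [mu [p [pI pu]]] [mv [r [rI rv]]]; split; first exact: measurable_funM.
exists (lmulp p r); split; first exact: lmulp_inv.
apply: filterS2 pu rv => t e1 e2; rewrite eval_mul e1 e2.
by rewrite -[(_ * _)%:C]/(real_complex R _) rmorphM.
Qed.

Lemma realZ_1 : realZ (fun=> 1).
Proof.
split=> //; exists (lmono R 0); split; first exact: lmono0_inv.
by apply: aeW => t; rewrite eval_mono torus0.
Qed.

Lemma realZ_Re p : laurent_inv p -> realZ (fun t => complex.Re (laurent_eval p t)).
Proof.
move=> pI; split; first by apply: continuous_borel; case: (laurent_eval_continuous p).
(* Half the sum of [p] and [lstar p]; the innermost [lcomb] is the zero polynomial closing the
   nested sum. *)
exists (lcomb 2^-1 p (lcomb 2^-1 (lstar p) (lcomb (- 1) p p))); split.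
  by repeat apply: lcomb_inv => //; exact: lstar_inv.
apply: filterS eval_lstar => t /(_ _ pI) e; rewrite !eval_comb e.
case: (laurent_eval p t) => a b; apply: complex_ext.
  by rewrite !(ReCD, ReCM) /=; field.
by rewrite !(ImCD, ImCM) /=; field.
Qed.

Lemma realZ_Im p : laurent_inv p -> realZ (fun t => complex.Im (laurent_eval p t)).
Proof.
move=> pI; split; first by apply: continuous_borel; case: (laurent_eval_continuous p).
(* The imaginary part of [z] is the real part of [- i z]. *)
have pI' : laurent_inv (lcomb (- 'i) p (lcomb (- 1) p p)) by apply: lcomb_inv => //; exact: lcomb_inv.
have [_ [r [rI hr]]] := realZ_Re pI'; exists r; split=> //.
apply: filterS hr => t ->; congr (_%:C); rewrite !eval_comb.
by case: (laurent_eval p t) => a b; rewrite !(ReCD, ReCM) /=; ring.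
Qed.

Local Notation l2set := (l2set nu realZ).
Local Notation l2closed := (l2closed nu realZ).

(** A point that orbit sums cannot tell apart from [K] up to any precision yields a sequence in [K];
    at a cluster point all orbit sums agree with those at [t], so [t] is in its orbit and hence in
    [K]. *)
Lemma l2set_compact (K : set torus) : compact K -> torus_inv K -> l2set K.
Proof.
move=> cK KI; have [e he] := lattice_enum (rd_latticeX D).
(* Even indices list the real parts and odd indices the imaginary parts of the orbit sums. *)
pose u n : B -> R := let p := lorbit R (e n./2) in
  if odd n then fun t => complex.Im (laurent_eval p t)
  else fun t => complex.Re (laurent_eval p t).
have ru n : realZ (u n).
  by rewrite /u; case: odd; [apply: realZ_Im|apply: realZ_Re]; exact: lorbit_inv.
have cu n : continuous (u n : torus -> R).
  by rewrite /u; case: odd; case: (laurent_eval_continuous (lorbit R (e n./2))).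
apply: (l2set_separated realZ_linf realZ_comb realZ_mul realZ_1 ru) => t ht.
have ex n : exists s, K s /\ forall i, (i < n)%N -> `|u i t - u i s| < 2 / n.+1%:R.
  by have [s Ks hs] := ht n; exists s.
have [s hs] := choice ex.
have [s0 [Ks0 cl]] : K `&` cluster (s @ \oo) !=set0.
  by apply: cK; exists 0%N => // n _ /=; case: (hs n).
have us i : u i s0 = u i t.
  apply/eqP; rewrite -subr_eq0 -normr_le0; apply/ler_addgt0Pr => r r0; rewrite add0r.
  have r2 : 0 < r / 2 by rewrite divr_gt0.
  have [n hn] := inv_small (ler0n R 2) r2.
  have h1 : (s @ \oo) (s @` [set m | (maxn n i < m)%N]).
    by exists (maxn n i).+1 => // m hm; exists m.
  have h2 : nbhs s0 [set t' | `|u i s0 - u i t'| < r / 2].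
    by have /cvgrPdist_lt := cu i s0; apply.
  have [_ [[m hm <-] /= h3]] := cl _ _ h1 h2.
  have [im nm] : (i < m)%N /\ (n <= m)%N.
    by move: hm => /=; rewrite gtn_max => /andP [/ltnW].
  have h4 := (hs m).2 i im.
  have h5 : 2 / m.+1%:R <= 2 / n.+1%:R :> R.
    by rewrite ler_wpM2l // lef_pV2 ?posrE ?ltr0n // ler_nat.
  have -> : u i s0 - u i t = (u i s0 - u i (s m)) - (u i t - u i (s m)) by ring.
  rewrite (le_trans (ler_normB _ _)) // [r]splitr lerD // ltW //.
  exact: lt_trans (lt_le_trans h4 h5) hn.
have [w e0] : exists w, t = torus_act w s0.
  apply: orbit_separation => x; have [n <-] := he x; apply: complex_ext.
    by have := us n.*2; rewrite /u odd_double doubleK.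
  by have := us n.*2.+1; rewrite /u /= odd_double /= uphalf_double.
by rewrite e0; exact: KI.
Qed.

Lemma l2set_closed (K : set torus) : closed K -> torus_inv K -> l2set K.
Proof.
move=> cK KI; have [C [Cc CI CT]] := torus_exhaustion R D.
have -> : K = \bigcup_n (C n `&` K).
  apply/seteqP; split=> [t Kt|t [n _ []] //].
  by have [n Cn] := CT t; exists n.
apply: (l2set_bigcup realZ_linf realZ_comb realZ_mul realZ_1) => n.
apply: l2set_compact; first exact: compact_closedI.
by move=> w t [h1 h2]; split; [exact: CI|exact: KI].
Qed.

Lemma l2_sum (I : Type) (r : seq I) (g : I -> B -> R) :
  (forall i, l2closed (g i)) -> l2closed (fun t => \sum_(i <- r) g i t).
Proof.
move=> hg; elim: r => [|i r IH].
  by under eq_fun do rewrite big_nil; exact: (l2_cst realZ_linf realZ_comb realZ_1).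
under eq_fun do rewrite big_cons -[g i _]mul1r.
exact: (l2_comb realZ_linf realZ_comb).
Qed.

(** The sum over W_0 makes an invariant function of any Borel set and is additive in it, so the
    Dynkin induction can run over all Borel sets instead of the invariant ones only. *)
Let cnt (P : set torus) (t : B) : R := \sum_(w <- weyl_seq D) \1_P (torus_act w t).

(** Layer by layer: the count is the sum of the indicators of the sets where it exceeds [m]. These
    are invariant, and closed because [K] is. *)
Lemma l2_cnt_closed (K : set torus) : closed K -> l2closed (cnt K).
Proof.
move=> cK; pose num (l : seq (weyl D)) (t : torus) := (\sum_(w <- l) (torus_act w t \in K))%N.
have numC l m : closed [set t | (m <= num l t)%N].
  elim: l m => [|w l IH] [|m]; first by rewrite (_ : mkset _ = setT) //; apply/seteqP; split.
  - rewrite (_ : mkset _ = set0); first exact: closed0.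
    by apply/seteqP; split=> t //=; rewrite /num big_nil.
  - by rewrite (_ : mkset _ = setT) ?closedT //; apply/seteqP; split.
  have -> : [set t | (m < num (w :: l) t)%N] =
      (torus_act w @^-1` K `&` [set t | (m <= num l t)%N]) `|` [set t | (m.+1 <= num l t)%N].
    apply/seteqP; split=> t /=; rewrite /num big_cons.
      case: (boolP (_ \in K)) => [/set_mem h|_]; last by right.
      by rewrite add1n ltnS; left.
    case=> [[/mem_set -> h]|h]; first by rewrite add1n ltnS.
    by rewrite (leq_trans h) // leq_addl.
  apply: closedU => //; apply: closedI => //.
  by apply: closed_comp => // t _; exact: torus_act_continuous.
pose E m := [set t : torus | (m < num (weyl_seq D) t)%N].
have hE m : l2set (E m).
  apply: l2set_closed; first exact: numC.
  move=> u t; rewrite /E /= /num -(sum_weyl_seq (fun w => _) u).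
  by under [in X in _ -> X]eq_bigr do rewrite torus_actM.
have sumlt n k : (k <= n)%N -> (\sum_(0 <= m < n) (m < k) = k)%N.
  elim: n k => [|n IH] k; first by rewrite leqn0 => /eqP ->; rewrite big_nil.
  rewrite leq_eqVlt ltnS => /predU1P [->|kn].
    rewrite big_nat_recr //= ltnS leqnn addn1; congr S; rewrite -[RHS](IH n) //.
    by apply: eq_big_nat => m /andP [_ mn]; rewrite mn ltnS ltnW.
  by rewrite big_nat_recr //= IH // ltnNge kn addn0.
have -> : cnt K = (fun t => \sum_(0 <= m < size (weyl_seq D)) \1_(E m) t).
  apply/funext => t.
  have -> : cnt K t = (num (weyl_seq D) t)%:R.
    by rewrite /cnt /num natr_sum; apply: eq_bigr => w _; rewrite indicE.
  rewrite -[in LHS](sumlt (size (weyl_seq D)) (num (weyl_seq D) t)); last first.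
    by rewrite /num -sum1_size; apply: leq_sum => w _; exact: leq_b1.
  rewrite natr_sum; apply: eq_bigr => m _; rewrite indicE; congr (nat_of_bool _)%:R.
  by apply/idP/idP => h; [rewrite inE|move: h; rewrite inE].
exact: l2_sum (fun m => (hE m).2).
Qed.

Let cntT t : cnt setT t = (size (weyl_seq D))%:R.
Proof.
rewrite /cnt -sum1_size natr_sum; apply: eq_bigr => w _.
by rewrite indicE in_setT.
Qed.

Let cntC P t : cnt (~` P) t = (size (weyl_seq D))%:R - cnt P t.
Proof.
apply/eqP; rewrite eq_sym subr_eq -(cntT t) -big_split /=; apply/eqP; apply: eq_bigr => w _.
by rewrite !indicE in_setC in_setT; case: (_ \in P); rewrite ?addr0 ?add0r.
Qed.

Lemma l2_cnt (P : set B) : measurable P -> l2closed (cnt P).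
Proof.
have l2C S : l2closed (cnt S) -> l2closed (cnt (~` S)).
  move=> h; have := l2_comb realZ_linf realZ_comb (- 1) h
    (l2_cst realZ_linf realZ_comb realZ_1 (size (weyl_seq D))%:R).
  by congr (l2closed _); apply/funext => t; rewrite cntC mulN1r addrC.
apply: (@dynkin_induction _ B (@open torus) (fun P => l2closed (cnt P))) => //.
- by move=> U V; exact: openI.
- have := l2_cst realZ_linf realZ_comb realZ_1 (size (weyl_seq D))%:R.
  by congr (l2closed _); apply/funext => t; rewrite cntT.
- move=> U oU; rewrite -[U]setCK; apply: l2C; apply: l2_cnt_closed.
  by rewrite closedC.
- by move=> S _; exact: l2C.
move=> F _ tF hF; pose U n := \big[setU/set0]_(k < n) F k.
have UE n t : \1_(U n) t = \sum_(k < n) \1_(F k) t :> R.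
  elim: n => [|n IH]; first by rewrite /U !big_ord0 indic0.
  rewrite /U !big_ord_recr /= -IH !indicE in_setU.
  case: (boolP (t \in F n)) => [/set_mem tn|]; last by rewrite orbF addr0.
  rewrite memNset ?add0r // => tU.
  move: tU; rewrite -bigcup_mkord => -[k /= kn Fk].
  have := tF k n I I; rewrite (_ : k = n) //; last by apply: tF => //; exists t.
  by move=> _; rewrite (_ : k = n) ?ltnn // in kn; apply: tF => //; exists t.
have hU n : l2closed (cnt (U n)).
  have := l2_sum (enum 'I_n) (fun k => hF k).
  congr (l2closed _); apply/funext => t; rewrite /cnt exchange_big /=; apply: eq_bigr => w _.
  by rewrite UE big_enum.
apply: (l2_lim realZ_linf (s := fun n => cnt (U n)) (M := (size (weyl_seq D))%:R)) => // [n t|t].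
  rewrite ger0_norm; last by apply: sumr_ge0 => w _; rewrite indicE.
  rewrite -(cntT t); apply: ler_sum => w _; rewrite !indicE in_setT.
  by case: (_ \in _).
have cU s : \1_(U n) s @[n --> \oo] --> (\1_(\bigcup_k F k) s : R).
  rewrite indicE; have [sF|sF] := boolP (s \in \bigcup_k F k).
    have [n _ Fn] := set_mem sF.
    apply: cvg_near_cst; exists n.+1 => // m nm; rewrite indicE mem_set //.
    by rewrite /U -bigcup_mkord; exists n.
  apply: cvg_near_cst; apply: nearW => m; rewrite indicE memNset //.
  rewrite /U -bigcup_mkord => -[n _ Fn]; case/negP: sF; apply/mem_set.
  by exists n.
rewrite /cnt; elim: (weyl_seq D) => [|w l IH].
  by under eq_fun do rewrite big_nil; rewrite big_nil; exact: cvg_cst.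
by under eq_fun do rewrite big_cons; rewrite big_cons; apply: cvgD.
Qed.

(* The indicator of an invariant set is [|W_0|^-1 cnt P]. *)
Lemma l2set_invariant (P : set B) : measurable P -> torus_inv P -> l2set P.
Proof.
move=> mP PI; split=> //.
have PE w t : \1_P (torus_act w t) = \1_P t :> R.
  rewrite !indicE; congr (nat_of_bool _)%:R; apply/idP/idP; rewrite !inE; last exact: PI.
  by move=> /(PI w^-1%g); rewrite torus_actM mulVg torus_act1.
have n0 : (size (weyl_seq D))%:R != 0 :> R.
  rewrite pnatr_eq0 -lt0n -has_predT; apply/hasP; exists 1%g => //; exact: mem_weyl_seq.
have := l2_comb realZ_linf realZ_comb (size (weyl_seq D))%:R^-1 (l2_cnt mP)
  (l2_cst realZ_linf realZ_comb realZ_1 0).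
congr (l2closed _); apply/funext => t; rewrite /cnt addr0.
under eq_bigr do rewrite PE; rewrite big_const_seq count_predT iter_addr_0.
by rewrite -[\1_P t *+ _]mulr_natl mulKf.
Qed.

Local Notation I f := (\int[nu]_(t in setT) f t)%R.

Lemma linf_I0 (f : B -> R) : linf nu f -> (forall t, 0 <= f t) -> I f = 0 ->
  {ae nu, forall t, f t = 0}.
Proof.
move=> hf f0 If; have mf : measurable_fun setT (EFin \o f) by apply/measurable_EFinP; case: hf.
have hi := linf_integrable hf.
have e : (\int[nu]_(t in setT) `|(EFin \o f) t| = 0)%E.
  under eq_integral do rewrite /= ger0_norm //.
  by rewrite -[LHS]fineK ?(integrable_fin_num measurableT hi) //; congr EFin.
have := (ae_eq_integral_abs nu measurableT mf).1 e.
by apply: filterS => t /(_ Logic.I) [].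
Qed.

(** Approximating the indicator of the set where [g] is negative by [u] in L2 makes the integral of
    [g] over that set nonnegative. Its integrand is nonpositive there, so it vanishes almost
    everywhere. *)
Lemma realZ_ge0 (g : B -> R) : linf nu g -> (forall w t, g (torus_act w t) = g t) ->
  (forall u, realZ u -> 0 <= I (fun t => u t ^+ 2 * g t)) ->
  {ae nu, forall t, 0 <= g t}.
Proof.
move=> hg gI hu; have [mg [M gM]] := hg.
pose P : set B := [set t | 0 < - g t].
have mP : measurable P by apply: measurable_gt; exact: measurableT_comp.
have [_ hP] : l2set P by apply: l2set_invariant => // w t; rewrite /P /= gI.
have lP := l2_linf hP.
have lPg := linfM lP hg.
have low : 0 <= I (fun t => \1_P t * g t).
  apply/ler_addgt0Pr => e e0; rewrite addrC -lerBlDr sub0r.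
  pose N := `|M| + 1; have N0 : 0 < N by rewrite ltr_wpDl.
  (* With [a] the distance of [u] from the indicator, the squares differ by at most [2 a + a ^ 2],
     hence by [r + k a ^ 2]. Weighted with the bound [N] on [g] and integrated, this stays within
     [2 N r], which is [e]. *)
  pose r := e / (2 * N); have r0 : 0 < r by rewrite divr_gt0 ?mulr_gt0.
  pose k := 1 + r^-1; have k0 : 0 < k by rewrite addr_gt0 // invr_gt0.
  have [_ _ /(_ (r / k))] := hP; rewrite divr_gt0 // => /(_ isT) [u Zu hu1].
  have lu := realZ_linf Zu.
  pose d t := (\1_P t - u t) ^+ 2; have ld : linf nu d by apply: linfX; exact: linfB.
  have lc := linf_cst nu (- (N * r)).
  have lug : linf nu (fun t => u t ^+ 2 * g t) by apply: linfM => //; exact: linfX.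
  have le1 : I (fun t => u t ^+ 2 * g t + (- (N * r) + - (N * k) * d t)) <= I (fun t => \1_P t * g t).
    apply: linf_I_le => //; first by apply: linfD => //; apply: linfD => //; exact: linfZ.
    apply: filterS gM => t gt.
    have gN : - N <= g t <= N by rewrite -ler_norml (le_trans gt) // (le_trans (ler_norm _)) // lerDl.
    have rk : r * r^-1 = 1 by rewrite mulfV // gt_eqF.
    have p2 : (\1_P t : R) ^+ 2 = \1_P t.
      by rewrite indicE; case: (_ \in _); rewrite ?expr1n ?expr0n.
    have p1 : `|\1_P t : R| <= 1 by rewrite indicE; case: (_ \in _); rewrite ?normr1 ?normr0 ?lexx.
    rewrite -[X in _ <= X * _]p2 /d /k; move: p1 gN; set p := \1_P t; set x := u t; set y := g t => p1 gN.
    pose a := `|p - x|; have a0 : 0 <= a by exact: normr_ge0.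
    have ea : (p - x) ^+ 2 = a ^+ 2 by rewrite /a real_normK ?num_real.
    have h2 : 2 * a <= r + a ^+ 2 * r^-1.
      have : 0 <= r^-1 * (a - r) ^+ 2 by rewrite mulr_ge0 ?sqr_ge0 // invr_ge0 ltW.
      have -> : r^-1 * (a - r) ^+ 2 = a ^+ 2 * r^-1 - 2 * a * (r * r^-1) + r * (r * r^-1) by ring.
      by rewrite rk; lra.
    have h3 : `|y * (2 * p * (p - x) - (p - x) ^+ 2)| <= N * (2 * a + a ^+ 2).
      rewrite normrM; apply: ler_pM => //; first by rewrite ler_norml.
      apply: le_trans (ler_normB _ _) _.
      rewrite ea (ger0_norm (sqr_ge0 a)) lerD2r !normrM ger0_norm // -/a.
      by rewrite ler_wpM2r // -[leRHS]mulr1 ler_wpM2l.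
    have h4 := ler_wpM2l (ltW N0) h2.
    have [h5 _] := andP (etrans (esym (ler_norml _ _)) h3).
    have : x ^+ 2 * y = p ^+ 2 * y - y * (2 * p * (p - x) - (p - x) ^+ 2) by ring.
    move: h5; set Y := y * _ => h5; rewrite ea => ->; move: h4 h5.
    by set ri := r^-1; set aa := a ^+ 2; lra.
  rewrite linf_I_D ?linf_I_D ?linf_I_Z ?linf_I_cst // in le1; try exact: linfZ; last first.
    by apply: linfD => //; exact: linfZ.
  have := hu u Zu; move: le1; rewrite -/(d) => le1 a0.
  have hd : N * k * I d <= N * r.
    move: hu1; rewrite -/d ltr_pdivlMr // => /ltW h.
    by rewrite -mulrA ler_wpM2l ?(ltW N0) // mulrC.
  have er : e = 2 * (N * r) by rewrite /r; field; rewrite gt_eqF.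
  move: le1 a0 hd; set a := Rintegral _ _ _; set b := Rintegral _ _ _; set c := Rintegral _ _ _.
  by move=> le1 a0 hd; lra.
have f0 t : 0 <= - 1 * (\1_P t * g t).
  rewrite indicE; case: (boolP (t \in P)) => [/set_mem|_]; last by rewrite mul0r mulr0.
  by rewrite /P /= mul1r mulN1r => /ltW.
have eq0 : I (fun t => - 1 * (\1_P t * g t)) = 0.
  apply/eqP; rewrite eq_le; apply/andP; split.
    by rewrite linf_I_Z // mulN1r oppr_le0.
  by apply: Rintegral_ge0 => t _; exact: f0.
have := linf_I0 (linfZ (- 1) lPg) f0 eq0; apply: filterS => t.
rewrite leNgt -[g t < 0]oppr_gt0 indicE; apply: contra_eqN => h.
by rewrite mem_set //= mul1r mulN1r gt_eqF.
Qed.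

(** Squares of elements of the center are again in it, so both [g] and [- g] satisfy the hypothesis
    of [realZ_ge0]. *)
Lemma realZ_separates (g : B -> R) : linf nu g -> (forall w t, g (torus_act w t) = g t) ->
  (forall u, realZ u -> I (fun t => u t * g t) = 0) -> {ae nu, forall t, g t = 0}.
Proof.
move=> hg gI hu.
have h1 : {ae nu, forall t, 0 <= g t}.
  apply: realZ_ge0 => // u Zu; rewrite (hu (fun t => u t ^+ 2)) //.
  by under eq_fun do rewrite expr2; exact: realZ_mul.
have h2 : {ae nu, forall t, 0 <= - 1 * g t}.
  apply: realZ_ge0 => [|w t|u Zu]; [exact: linfZ|by rewrite gI|].
  under eq_Rintegral do rewrite mulrCA.
  have Zu2 : realZ (fun t => u t ^+ 2) by under eq_fun do rewrite expr2; exact: realZ_mul.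
  rewrite linf_I_Z ?(hu _ Zu2) ?mulr0 //; apply: linfM => //; exact: realZ_linf.
apply: filterS2 h1 h2 => t h1 h2; apply/eqP; rewrite eq_le h1 andbT.
by rewrite mulN1r oppr_ge0 in h2.
Qed.

End InvariantBorel.

(** * Extension to the C*-algebra *)

Lemma ge0_approx (R : realType) (a : R[i]) :
  (forall e : R, 0 < e -> exists2 z, 0 <= z & complex.Re `|a - z| <= e) -> 0 <= a.
Proof.
move=> ha; rewrite ge0_complexE -normr_le0; apply/andP; split.
  apply/ler_addgt0Pr => e /ha [z]; rewrite ge0_complexE add0r => /andP [/eqP iz _].
  by apply: le_trans; apply: le_trans (Im_norm_le _); rewrite ImCD ImCN iz subr0.
apply/ler_addgt0Pr => e /ha [z]; rewrite ge0_complexE => /andP [_ rz] hz.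
have := le_trans (Re_norm_le _) hz.
by rewrite ReCD ReCN ler_norml => /andP []; lra.
Qed.

Section TracialState.
Variables (R : realType) (D : root_datum) (qq : R) (f q : affweyl D -> R).
Hypotheses (hqq : 1 < qq) (hq : is_weight qq f q).
Variable H : hecke_algebra q.
Variable E : hilbert_completion H.
Local Notation C := R[i].
Local Notation emb := (@hilb_emb R D q H E).
Local Notation star := (@hecke_star R D q H).
Local Notation tau := (hecke_tau H).
Local Notation L := (@lmul R D q H E).
Local Notation m c := (complex.Re `|c|).
Variable chi : {scalar H}.
Hypotheses (chi_pos : positive_functional chi) (chi_central : central_functional chi).
Hypothesis chi1 : chi 1 = 1.
Implicit Types (x y h k : H) (A B : E -> E).

Let bL h : bounded_op (L h).
Proof. exact: (lmul_bounded hqq hq E h). Qed.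

Let tau_sqr x : tau (star x * x) = (nr (emb x) ^+ 2)%:C.
Proof. by rewrite -(dot_emb E) dot_nr. Qed.

Let chiZ (c : C) h : chi (c *: h) = c * chi h.
Proof. exact: linearZ. Qed.

Let chiD h k : chi (h + k) = chi h + chi k.
Proof. exact: raddfD. Qed.

Lemma hecke_pos_sqr y : hecke_pos (star y * y).
Proof.
split; first by rewrite hecke_starM hecke_starK.
move=> x; rewrite /hecke_ip !hecke_starM hecke_starK.
have -> : star x * (star y * y) * x = star (y * x) * (y * x) by rewrite hecke_starM !mulrA.
by rewrite tau_sqr ler0c sqr_ge0.
Qed.

(** From reality on the squares of [h + 1] and [i h + 1]. *)
Lemma state_hermitian h : chi (star h) = conjc (chi h).
Proof.
have pos x : complex.Im (chi (star x * x)) = 0.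
  by have := chi_pos (hecke_pos_sqr x); rewrite ge0_complexE => /andP [/eqP].
have e1 : complex.Im (chi h) + complex.Im (chi (star h)) = 0.
  have := pos (h + 1); rewrite starD star1 mulrDl !mulrDr !mulr1 !mul1r !chiD !ImCD pos chi1 /=.
  by rewrite add0r addr0 addrC.
have e2 : complex.Re (chi h) - complex.Re (chi (star h)) = 0.
  have := pos ('i *: h + 1); rewrite starD star1 starZ mulrDl !mulrDr !mulr1 !mul1r !chiD !ImCD.
  rewrite -(scalerAl (conjc 'i)) -(scalerAr 'i) !chiZ !ImCM ?ReCM pos chi1 /=.
  by move=> e; rewrite -[RHS]e; ring.
by apply: complex_ext; rewrite ?ReCJ ?ImCJ; lra.
Qed.

(** [N ^ 2 - star h * h] belongs to the positive cone, and Cauchy-Schwarz against 1 bounds the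
    square of [chi h] by [chi (star h * h)]. *)
Lemma state_bound h : m (chi h) <= opnorm (L h).
Proof.
set N := opnorm (L h); have N0 : 0 <= N by apply: opnorm_ge0; exact: bL.
have hP : hecke_pos ((N ^+ 2)%:C *: 1 - star h * h).
  split; first by rewrite starD starN starZ star1 hecke_starM hecke_starK conjc_real.
  move=> x; rewrite /hecke_ip hecke_starM.
  have -> : star ((N ^+ 2)%:C *: 1 - star h * h) = (N ^+ 2)%:C *: 1 - star h * h.
    by rewrite starD starN starZ star1 hecke_starM hecke_starK conjc_real.
  rewrite -mulrA mulrBl mulrBr -(scalerAl (N ^+ 2)%:C) -(scalerAr (N ^+ 2)%:C) mul1r.
  have -> : star x * (star h * h * x) = star (h * x) * (h * x) by rewrite hecke_starM !mulrA.
  rewrite raddfB /= linearZ /= !tau_sqr -rmorphM -rmorphB ler0c subr_ge0 -exprMn.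
  rewrite ler_sqr ?nnegrE ?nr_ge0 ?mulr_ge0 ?nr_ge0 // -(lmul_emb hqq hq).
  by apply: opnorm_ub; exact: bL.
have h1 : complex.Re (chi (star h * h)) <= N ^+ 2.
  have := chi_pos hP; rewrite raddfB /= chiZ chi1 mulr1 ge0_complexE => /andP [_].
  by rewrite ReCD ReCN /= subr_ge0.
have h0 u : 0 <= chi (star u * u) by exact: chi_pos (hecke_pos_sqr u).
have BD (c : C) u v w : chi (star u * (c *: v + w)) = c * chi (star u * v) + chi (star u * w).
  by rewrite mulrDr -(scalerAr c) raddfD /= chiZ.
have BC u v : chi (star u * v) = conjc (chi (star v * u)).
  by rewrite -state_hermitian hecke_starM hecke_starK.
have := cauchy_schwarz BD BC h0 1 h; rewrite star1 !mul1r chi1 mul1r.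
have -> : `|chi h| = (m (chi h))%:C by exact/ge0_ReC.
rewrite (ge0_ReC (h0 h)) -rmorphXn lecR => h2.
by rewrite -ler_sqr ?nnegrE ?Re_norm_ge0 // (le_trans h2).
Qed.

Lemma opnorm_tri A B C' : bounded_op A -> bounded_op B -> bounded_op C' ->
  opnorm (A \- C') <= opnorm (A \- B) + opnorm (B \- C').
Proof.
move=> bA bB bC; have b1 := bounded_op_sub bA bB; have b2 := bounded_op_sub bB bC.
apply: opnorm_le => [|u]; first by rewrite addr_ge0 ?opnorm_ge0.
have -> : (A \- C') u = (A \- B) u + (B \- C') u by rewrite /= addrA subrK.
by rewrite (le_trans (nrD _ _)) // mulrDl lerD // opnorm_ub.
Qed.

Lemma opnorm_subC A B : opnorm (A \- B) = opnorm (B \- A).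
Proof.
by congr (sup _); apply/seteqP; split=> _ [u u1 <-]; exists u => //=; rewrite distrC.
Qed.

(* The only [c] whose real and imaginary parts are within [||A - lmul h||] of those
   of [chi h] for all [h]; a supremum of lower bounds needs no approximating sequence. *)
Definition state_ext A : C :=
  sup [set complex.Re (chi h) - opnorm (A \- L h) | h in setT] +i*
  sup [set complex.Im (chi h) - opnorm (A \- L h) | h in setT].

Let sup_near (g : H -> R) A : bounded_op A ->
  (forall h k, g h - g k <= opnorm (L (h - k))) -> forall h,
  `|sup [set g h - opnorm (A \- L h) | h in setT] - g h| <= opnorm (A \- L h).
Proof.
move=> bA hg h.
have ub k l : g k - opnorm (A \- L k) <= g l + opnorm (A \- L l).
  rewrite lerBlDr -addrA -lerBlDl (le_trans (hg k l)) // (lmulB hqq hq).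
  by rewrite addrC [opnorm (A \- L k)]opnorm_subC opnorm_tri.
rewrite ler_distl; apply/andP; split.
  by apply: ub_le_sup; [exists (g h + opnorm (A \- L h)) => _ [k _ <-]|exists h].
by apply: ge_sup; [exists (g h - opnorm (A \- L h)), h|move=> _ [k _ <-]].
Qed.

(** The factor 2 collects the errors of the real and the imaginary part. *)
Lemma state_ext_near A h : bounded_op A -> m (state_ext A - chi h) <= 2 * opnorm (A \- L h).
Proof.
move=> bA; have hb x y : m (chi x - chi y) <= opnorm (L (x - y)).
  by rewrite -raddfB; exact: state_bound.
have hr x y : complex.Re (chi x) - complex.Re (chi y) <= opnorm (L (x - y)).
  apply: le_trans (hb x y); rewrite -ReCN -ReCD (le_trans (ler_norm _)) //.
  exact: Re_norm_le.
have hi x y : complex.Im (chi x) - complex.Im (chi y) <= opnorm (L (x - y)).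
  apply: le_trans (hb x y); rewrite -ImCN -ImCD (le_trans (ler_norm _)) //.
  exact: Im_norm_le.
rewrite (le_trans (Re_norm_leD _)) // mulr_natl mulr2n lerD //.
  by rewrite ReCD ReCN; exact: (sup_near bA hr h).
by rewrite ImCD ImCN; exact: (sup_near bA hi h).
Qed.

Let cstar_approx A (d : R) : cstar A -> 0 < d -> exists h, opnorm (A \- L h) <= d.
Proof. by move=> [_ cA] /cA [h _ /ltW]; exists h. Qed.

Let m_tri (a b c : C) : m (a - c) <= m (a - b) + m (b - c).
Proof. by have -> : a - c = (a - b) + (b - c); [rewrite addrA subrK|exact: Re_normD]. Qed.

Let m_subC (a b : C) : m (a - b) = m (b - a).
Proof. by rewrite distrC. Qed.

Let mM (a b : C) : m (a * b) = m a * m b.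
Proof.
rewrite normrM (ge0_ReC (normr_ge0 a)) (ge0_ReC (normr_ge0 b)) ReCM /=.
by rewrite mulr0 subr0.
Qed.

Lemma state_ext_eq A (c : C) : bounded_op A ->
  (forall e : R, 0 < e -> exists h, opnorm (A \- L h) <= e /\ m (c - chi h) <= e) ->
  state_ext A = c.
Proof.
move=> bA hc; apply/eqP; rewrite -subr_eq0; apply/eqP/norm_small => e e0.
have [h [h1 h2]] := hc (e / 3) (divr_gt0 e0 (ltr0n _ 3)).
rewrite (le_trans (m_tri _ (chi h) _)) // [X in _ + X]m_subC.
by have := state_ext_near h bA; lra.
Qed.

Lemma state_ext_lmul h : state_ext (L h) = chi h.
Proof.
apply: state_ext_eq => // e e0; exists h; rewrite subrr normr0 /=; split; last exact: ltW.
by apply: opnorm_le => [|u]; rewrite ?(ltW e0) //= subrr nr0 mulr_ge0 ?nr_ge0 ?ltW.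
Qed.

Lemma state_ext_linear : linear_on (@cstar R D q H E) state_ext.
Proof.
move=> c A B cA cB; have [bA _] := cA; have [bB _] := cB.
apply: state_ext_eq => [|e e0]; first exact: bounded_op_comb.
have mc : 0 <= m c by exact: Re_norm_ge0.
pose d := e / (2 * (m c + 1)).
have d0 : 0 < d by rewrite divr_gt0 // mulr_gt0 // ltr_wpDl.
have de : 2 * (m c * d + d) = e by rewrite /d; field; rewrite gt_eqF // ltr_wpDl.
have [h hA] := cstar_approx cA d0; have [k kB] := cstar_approx cB d0.
exists (c *: h + k); split.
  rewrite (lmul_comb hqq hq); apply: (@le_trans _ _ (m c * d + d)); last first.
    have : 0 <= m c * d by rewrite mulr_ge0 // ltW.
    by lra.
  apply: opnorm_le => [|u]; first by have := mulr_ge0 mc (ltW d0); lra.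
  rewrite /= opprD addrACA -scalerBr (le_trans (nrD _ _)) // nrZ mulrDl -mulrA.
  have h1 := opnorm_ub u (bounded_op_sub bA (bL h)).
  have h2 := opnorm_ub u (bounded_op_sub bB (bL k)).
  apply: lerD; last by rewrite (le_trans h2) // ler_wpM2r ?nr_ge0.
  by apply: ler_wpM2l => //; rewrite (le_trans h1) // ler_wpM2r ?nr_ge0.
rewrite chiD chiZ opprD addrACA -mulrBr (le_trans (Re_normD _ _)) // mM -de mulrDr.
have h1 := state_ext_near h bA; have h2 := state_ext_near k bB.
rewrite lerD //; last by lra.
by rewrite mulrCA ler_wpM2l //; lra.
Qed.

Lemma state_ext_continuous : continuous_on (@cstar R D q H E) state_ext.
Proof.
(* With [h] within [e / 8] of [A], the two errors [2 (e / 4 + e / 8)] and [2 (e / 8)] add up to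
   [e]. *)
move=> A cA e e0; have [bA _] := cA; exists (e / 4); first by rewrite divr_gt0.
move=> B [bB _] BA; have [|h hA] := cstar_approx cA (d := e / 8); first by rewrite divr_gt0.
have -> : `|state_ext B - state_ext A| = (m (state_ext B - state_ext A))%:C by exact/ge0_ReC.
rewrite ltcR (le_lt_trans (m_tri _ (chi h) _)) // [X in _ + X]m_subC.
have h1 := state_ext_near h bA; have h2 := state_ext_near h bB.
by have := opnorm_tri bB bA (bL h); lra.
Qed.

(** Lets identities and inequalities for products in the Hecke algebra pass to the C*-algebra. *)
Let comp_near A B (e : R) : cstar A -> cstar B -> 0 < e ->
  exists2 d : R, 0 < d & forall h k, opnorm (A \- L h) <= d -> opnorm (B \- L k) <= d ->
    m (state_ext (A \o B) - chi (h * k)) <= e.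
Proof.
(* The product is approximated within [d * opnorm B + (opnorm A + d) * d]; doubled, and with [d] at
   most 1, this is at most [d * K]. *)
move=> [bA _] [bB _] e0; pose K := 2 * (opnorm A + opnorm B + 1).
have A0 := opnorm_ge0 bA; have B0 := opnorm_ge0 bB.
have K0 : 0 < K by rewrite /K; lra.
exists (Num.min 1 (e / K)) => [|h k]; first by rewrite lt_min ltr01 divr_gt0.
set d := Num.min _ _ => hA kB.
have d1 : d <= 1 by rewrite ge_min lexx.
have d0 : 0 <= d by rewrite le_min ler01 divr_ge0 // ltW.
have dK : d * K <= e by rewrite -ler_pdivlMr // ge_min lexx orbT.
apply: le_trans (state_ext_near (h * k) (bounded_op_comp bA bB)) _.
suff : opnorm (A \o B \- L (h * k)) <= d * opnorm B + (opnorm A + d) * d.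
  have : d * d <= d * 1 by rewrite ler_wpM2l.
  by move: dK; rewrite /K; lra.
have bAh := bounded_op_sub bA (bL h); have bBk := bounded_op_sub bB (bL k).
apply: opnorm_le => [|u]; first by rewrite addr_ge0 // mulr_ge0 // addr_ge0.
have /bounded_opP [lh _] := bL h.
have -> : (A \o B \- L (h * k)) u = (A \- L h) (B u) + L h ((B \- L k) u).
  by rewrite /= (lmulM hqq hq) (linopB _ _ lh) /= addrA subrK.
have Bu := opnorm_ub u bB; have Bk := opnorm_ub u bBk.
have h1 : nr ((A \- L h) (B u)) <= d * (opnorm B * nr u).
  rewrite (le_trans (opnorm_ub _ bAh)) // ler_pM ?opnorm_ge0 ?nr_ge0 //.
have Lh : opnorm (L h) <= opnorm A + d.
  apply: opnorm_le => [|v]; first by rewrite addr_ge0.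
  have -> : L h v = A v - (A \- L h) v by rewrite /= opprB addrC subrK.
  rewrite (le_trans (nrD _ _)) // nrN mulrDl lerD ?opnorm_ub //.
  by rewrite (le_trans (opnorm_ub _ bAh)) // ler_wpM2r ?nr_ge0.
have h2 : nr (L h ((B \- L k) u)) <= (opnorm A + d) * (d * nr u).
  rewrite (le_trans (opnorm_ub _ (bL h))) // ler_pM ?opnorm_ge0 ?nr_ge0 //.
  by rewrite (le_trans Bk) // ler_wpM2r ?nr_ge0.
by rewrite (le_trans (nrD _ _)) // mulrDl -!mulrA lerD.
Qed.

(** The difference [B - L (star h)] is the adjoint of [A - L h], and testing it against its own
    image [w] bounds its norm. *)
Let adjoint_approx A B h : bounded_op A -> bounded_op B -> adjoint A B ->
  opnorm (B \- L (star h)) <= opnorm (A \- L h).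
Proof.
move=> bA bB AB; have bAh := bounded_op_sub bA (bL h).
apply: opnorm_le => [|v]; first exact: opnorm_ge0.
set w := (B \- L (star h)) v.
have e1 : hilb_dot w w = hilb_dot ((A \- L h) w) v.
  symmetry; rewrite /= dotBl (AB w v) (@lmul_adjoint R D qq f q hqq hq H E h w v) -dotBr.
  by [].
have [->|w0] := eqVneq (nr w) 0; first by rewrite mulr_ge0 ?nr_ge0 ?opnorm_ge0.
have wp : 0 < nr w by rewrite lt_def w0 nr_ge0.
rewrite -(ler_pM2l wp) -expr2.
have -> : nr w ^+ 2 = m (hilb_dot w w).
  by rewrite dot_nr ger0_norm ?ler0c ?sqr_ge0.
rewrite e1 (le_trans (dot_cs _ _)) // mulrA [nr w * _]mulrC ler_wpM2r ?nr_ge0 //.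
exact: opnorm_ub.
Qed.

Lemma state_ext_tracial : tracial_state state_ext.
Proof.
split; [exact: state_ext_linear|exact: state_ext_continuous| | |].
- move=> A B cA cB AB; have [bA _] := cA; have [bB _] := cB.
  apply: ge0_approx => e e0; have [d d0 hd] := comp_near cB cA e0.
  have [h hA] := cstar_approx cA d0; exists (chi (star h * h)).
    exact: chi_pos (hecke_pos_sqr h).
  by apply: hd => //; exact: le_trans (adjoint_approx h bA bB AB) hA.
- by rewrite -(lmul1 hqq hq E) state_ext_lmul.
- move=> A B cA cB; apply/eqP; rewrite -subr_eq0; apply/eqP/norm_small => e e0.
  have e2 : 0 < e / 2 by rewrite divr_gt0.
  have [d d0 hd] := comp_near cA cB e2; have [d' d0' hd'] := comp_near cB cA e2.
  have dd : 0 < Num.min d d' by rewrite lt_min d0.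
  have [h hA] := cstar_approx cA dd; have [k kB] := cstar_approx cB dd.
  have hk : chi (h * k) = chi (k * h).
    by have /eqP := chi_central h k; rewrite raddfB subr_eq0 => /eqP.
  rewrite (le_trans (m_tri _ (chi (h * k)) _)) // [e]splitr lerD //.
    by apply: hd; [apply: le_trans hA _|apply: le_trans kB _]; rewrite ge_min lexx.
  rewrite m_subC hk; apply: hd'; [apply: le_trans kB _|apply: le_trans hA _];
  by rewrite ge_min lexx orbT.
Qed.

Lemma tracial_extension : exists2 phi, tracial_state phi & forall h, phi (L h) = chi h.
Proof. by exists state_ext; [exact: state_ext_tracial|exact: state_ext_lmul]. Qed.

End TracialState.

(** * Local traces *)

Section ComplexIntegral.
Variables (R : realType) (D : root_datum) (nu : probability (torus_borel R D) R).
Local Notation B := (torus_borel R D).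
Implicit Types g h : torus R D -> R[i].

Definition clinf g : Prop :=
  linf nu (fun t : B => complex.Re (g t)) /\ linf nu (fun t : B => complex.Im (g t)).

Lemma clinf_comb c g h : clinf g -> clinf h -> clinf (fun t => c * g t + h t).
Proof.
move=> [g1 g2] [h1 h2]; split.
  under eq_fun do rewrite ReCD ReCM.
  by apply: linfD => //; apply: linfB; exact: linfZ.
under eq_fun do rewrite ImCD ImCM.
by apply: linfD => //; apply: linfD; exact: linfZ.
Qed.

Lemma clinf_mul g h : clinf g -> clinf h -> clinf (fun t => g t * h t).
Proof.
move=> [g1 g2] [h1 h2]; split.
  by under eq_fun do rewrite ReCM; apply: linfB; exact: linfM.
by under eq_fun do rewrite ImCM; apply: linfD; exact: linfM.
Qed.

Lemma cintegral_B g h : clinf g -> clinf h ->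
  cintegral nu (fun t => g t - h t) = cintegral nu g - cintegral nu h.
Proof.
move=> [g1 g2] [h1 h2]; apply: complex_ext; rewrite ?ReCD ?ReCN ?ImCD ?ImCN /cintegral /=.
  by rewrite -linf_I_B //; congr Rintegral; apply/funext => t; rewrite ReCD ReCN.
by rewrite -linf_I_B //; congr Rintegral; apply/funext => t; rewrite ImCD ImCN.
Qed.

End ComplexIntegral.

Section LaurentInvariance.
Variables (R : realType) (D : root_datum).

Lemma eval_act (p : laurent R D) w t : laurent_inv p ->
  laurent_eval p (torus_act w t) = laurent_eval p t.
Proof.
move=> pI; rewrite /laurent_eval.
transitivity (\sum_(x <- [seq weyl_fun w^-1%g x | x <- finsupp p]) p x * t x).
  by rewrite big_map; apply: eq_bigr => x _; rewrite torus_actE pI.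
apply: perm_big; apply: uniq_perm; rewrite ?fset_uniq ?map_inj_uniq ?fset_uniq //.
  by apply: (can_inj (g := w)) => x; rewrite weylVK.
move=> x; apply/mapP/idP => [[y yp ->]|xp].
  by move: yp; rewrite !mem_finsupp pI.
by exists (w x); [move: xp; rewrite !mem_finsupp pI|rewrite weylKV].
Qed.

End LaurentInvariance.

Section LocalTraces.
Variables (R : realType) (D : root_datum) (qq : R) (f q : affweyl D -> R).
Hypotheses (hqq : 1 < qq) (hq : is_weight qq f q).
Variables (H : hecke_algebra q) (theta : rd_X D -> H).
Hypothesis htheta : is_theta theta.
Variables (E : hilbert_completion H) (nu : probability (torus_borel R D) R).
Hypothesis hnu : is_spectral_measure E theta nu.
Variable chi : torus R D -> {scalar H}.
Hypothesis hchi : is_local_trace theta nu chi.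
Local Notation B := (torus_borel R D).
Local Notation star := (@hecke_star R D q H).
Local Notation tau := (hecke_tau H).
Local Notation bern := (bernstein theta).
Local Notation cint := (cintegral nu).
Local Notation m c := (complex.Re `|c|).
Implicit Types (p r : laurent R D) (h k : H).

Let aeF : Filter (almost_everywhere nu).
Proof. exact: ae_filter_ringOfSetsType. Qed.
Existing Instance aeF.

Let ae_spectrum : {ae nu, forall t, spectrum E theta t}.
Proof. by case: hnu. Qed.

Lemma eval_bounded p : laurent_inv p ->
  exists M, {ae nu, forall t, m (laurent_eval p t) <= M}.
Proof.
move=> pI; exists (opnorm (lmul E (bern p))); apply: filterS ae_spectrum => t st.
exact: (spectrum_bound hqq hq htheta st pI).
Qed.

Lemma eval_lstar : {ae nu, forall t, forall p, laurent_inv p ->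
  laurent_eval (lstar p) t = conjc (laurent_eval p t)}.
Proof.
apply: filterS ae_spectrum => t st p pI.
exact: (spectrum_star hqq hq htheta st pI).
Qed.

Local Notation realZ := (realZ nu).

Lemma clinf_eval p : laurent_inv p -> clinf nu (laurent_eval p).
Proof.
move=> pI; split.
  exact: (realZ_linf eval_bounded (realZ_Re eval_lstar pI)).
exact: (realZ_linf eval_bounded (realZ_Im eval_lstar pI)).
Qed.

Lemma clinf_chi h : clinf nu (fun t => chi t h).
Proof.
have [/(_ h) [m1 m2] /(_ h) [M hM] _ _ _] := hchi.
split; split=> //; exists M; apply: filterS hM => t; rewrite normc_def lecR => hM.
  by have := Re_norm_le (chi t h); rewrite normc_def /= => /le_trans; apply.
by have := Im_norm_le (chi t h); rewrite normc_def /= => /le_trans; apply.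
Qed.

Lemma tau_chi p h : laurent_inv p -> tau (bern p * h) = cint (fun t => laurent_eval p t * chi t h).
Proof. by move=> pI; case: hchi => _ _ _ /(_ h p pI). Qed.

Lemma tau_integral h : tau h = cint (fun t => chi t h).
Proof.
have := tau_chi h (@lmono0_inv R D); rewrite bern_mono (theta0 htheta) mul1r => ->.
by congr cintegral; apply/funext => t; rewrite eval_mono torus0 mul1r.
Qed.

(** A real element of the center integrates separately against the real and the imaginary part, so
    [realZ_separates] applies to each. *)
Lemma ae_zero (g : torus R D -> R[i]) : clinf nu g ->
  (forall w t, g (torus_act w t) = g t) ->
  (forall p, laurent_inv p -> cint (fun t => laurent_eval p t * g t) = 0) ->
  {ae nu, forall t, g t = 0}.
Proof.
move=> gl gI g0; have [l1 l2] := gl.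
have key u : realZ u -> (\int[nu]_(t in setT) (u t * complex.Re (g t)))%R = 0 /\
    (\int[nu]_(t in setT) (u t * complex.Im (g t)))%R = 0.
  move=> Zu; have [mu [p [pI pu]]] := Zu; have lu := realZ_linf eval_bounded Zu.
  have [[m1 _] [m2 _]] := clinf_mul (clinf_eval pI) gl.
  have := g0 p pI => e; split.
    rewrite -[RHS](congr1 (@complex.Re R) e) /=; apply: linf_I_ae => //.
      by case: (linfM lu l1).
    by apply: filterS pu => t ->; rewrite ReCM /= mul0r subr0.
  rewrite -[RHS](congr1 (@complex.Im R) e) /=; apply: linf_I_ae => //.
    by case: (linfM lu l2).
  by apply: filterS pu => t ->; rewrite ImCM /= mul0r addr0.
have h1 : {ae nu, forall t, complex.Re (g t) = 0}.
  apply: (realZ_separates eval_bounded eval_lstar l1) => [w t|u /key [] //].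
  by rewrite gI.
have h2 : {ae nu, forall t, complex.Im (g t) = 0}.
  apply: (realZ_separates eval_bounded eval_lstar l2) => [w t|u /key [] //].
  by rewrite gI.
by apply: filterS2 h1 h2 => t e1 e2; apply: complex_ext.
Qed.

Lemma ae_unique (g k : torus R D -> R[i]) : clinf nu g -> clinf nu k ->
  (forall w t, g (torus_act w t) = g t) -> (forall w t, k (torus_act w t) = k t) ->
  (forall p, laurent_inv p ->
    cint (fun t => laurent_eval p t * g t) = cint (fun t => laurent_eval p t * k t)) ->
  {ae nu, forall t, g t = k t}.
Proof.
move=> gl kl gI kI gk.
have h : {ae nu, forall t, -1 * k t + g t = 0}.
  apply: ae_zero => [|w t|p pI]; [exact: clinf_comb|by rewrite gI kI|].
  have lp := clinf_eval pI.
  have -> : (fun t => laurent_eval p t * (-1 * k t + g t)) =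
      (fun t => laurent_eval p t * g t - laurent_eval p t * k t).
    by apply/funext => t; ring.
  by rewrite cintegral_B ?gk ?subrr //; exact: clinf_mul.
by apply: filterS h => t /eqP; rewrite mulN1r addrC subr_eq0 => /eqP.
Qed.

Lemma chi_act w t h : chi (torus_act w t) h = chi t h.
Proof. by case: hchi. Qed.

Lemma chi_bern h p : laurent_inv p ->
  {ae nu, forall t, chi t (bern p * h) = laurent_eval p t * chi t h}.
Proof.
move=> pI; have lp := clinf_eval pI; have lh := clinf_chi h.
apply: ae_unique => [||w t|w t|r rI]; rewrite ?eval_act ?chi_act //.
- exact: clinf_chi.
- exact: clinf_mul.
rewrite -tau_chi // mulrA -(bern_mul htheta) tau_chi; last exact: lmulp_inv.
by congr cintegral; apply/funext => t; rewrite eval_mul mulrA.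
Qed.

Lemma chi_1 : {ae nu, forall t, chi t 1 = 1}.
Proof.
apply: ae_unique => [||w t|//|r rI]; rewrite ?chi_act //.
- exact: clinf_chi.
- by split; exact: linf_cst.
rewrite -tau_chi // mulr1; have [_ _ /(_ r rI) ->] := hnu.
by congr cintegral; apply/funext => t; rewrite mulr1.
Qed.

Lemma chi_central_pair h k : {ae nu, forall t, chi t (h * k) = chi t (k * h)}.
Proof.
apply: ae_unique => [||w t|w t|r rI]; rewrite ?chi_act //; try exact: clinf_chi.
rewrite -!tau_chi // mulrA tau_mulC mulrA.
by rewrite (bern_central hqq hq htheta) // mulrA.
Qed.

Lemma affweyl_enum : exists e : nat -> affweyl D, forall w, exists n, e n = w.
Proof.
have [e he] := lattice_enum (rd_latticeX D).
exists (fun n => let: (i, j) := odflt (0%N, 0%N) (choice.unpickle n) in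
  AffWeyl (nth 1%g (weyl_seq D) i) (e j)).
case=> w x; have [j <-] := he x.
exists (choice.pickle (index w (weyl_seq D), j)); rewrite choice.pickleK /=.
by rewrite nth_index // mem_weyl_seq.
Qed.

Lemma ae_central : {ae nu, forall t, central_functional (chi t)}.
Proof.
have [e he] := affweyl_enum; pose T n := @hecke_T R D q H (e n).
have : {ae nu, forall t, forall n i, chi t (T n * T i) = chi t (T i * T n)}.
  by apply: ae_foralln => n; apply: ae_foralln => i; exact: chi_central_pair.
apply: filterS => t ht h k; apply/eqP; rewrite raddfB subr_eq0; apply/eqP.
elim/hecke_ind: h => [|c h h' IH IH'|w]; first by rewrite mul0r mulr0.
  rewrite mulrDl mulrDr -(scalerAl c) -(scalerAr c) !raddfD /= IH'.
  by rewrite !linearZ /= IH.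
elim/hecke_ind: k => [|c h h' IH IH'|v]; first by rewrite mul0r mulr0.
  rewrite mulrDl mulrDr -(scalerAl c) -(scalerAr c) !raddfD /= IH'.
  by rewrite !linearZ /= IH.
by have [n <-] := he w; have [i <-] := he v; exact: ht.
Qed.

Let eval_lsqr p u : laurent_inv p -> {ae nu, forall t, laurent_eval p t = (u t)%:C} ->
  {ae nu, forall t, laurent_eval (lmulp (lstar p) p) t = (u t ^+ 2)%:C}.
Proof.
move=> pI pu; apply: filterS2 pu eval_lstar => t e /(_ p pI) e'.
by rewrite eval_mul e' e conjc_real -rmorphM expr2.
Qed.

Lemma chi_pos h : hecke_pos h -> {ae nu, forall t, 0 <= chi t h}.
Proof.
move=> [hh h0]; have [lr li] := clinf_chi h.
have key u p (pu : {ae nu, forall t, laurent_eval p t = (u t)%:C}) : realZ u -> laurent_inv p ->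
    tau (bern p * h) = (\int[nu]_(t in setT) (u t * complex.Re (chi t h)))%R +i*
      (\int[nu]_(t in setT) (u t * complex.Im (chi t h)))%R.
  move=> Zu pI; have lu := realZ_linf eval_bounded Zu.
  have [[m1 _] [m2 _]] := clinf_mul (clinf_eval pI) (clinf_chi h).
  rewrite tau_chi //; apply: complex_ext => /=; apply: linf_I_ae => //.
  - by case: (linfM lu lr).
  - by apply: filterS pu => t ->; rewrite ReCM /= mul0r subr0.
  - by case: (linfM lu li).
  - by apply: filterS pu => t ->; rewrite ImCM /= mul0r addr0.
have hr : {ae nu, forall t, 0 <= complex.Re (chi t h)}.
  apply: (realZ_ge0 eval_bounded eval_lstar lr) => [w t|u Zu]; first by rewrite chi_act.
  have [mu [p [pI pu]]] := Zu; have spI := lmulp_inv (lstar_inv pI) pI.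
  have Zu2 : realZ (fun t => u t ^+ 2) by under eq_fun do rewrite expr2; exact: realZ_mul.
  have := key _ _ (eval_lsqr pI pu) Zu2 spI.
  rewrite (bern_mul htheta) -(star_bern hqq hq htheta) //.
  (* The square of [u] is the symbol of the star of [bern p] times [bern p]; the trace property
     turns its pairing with [h] into an inner product that is nonnegative by definition of
     [hecke_pos]. *)
  have -> : tau (star (bern p) * bern p * h) = hecke_ip (h * star (bern p)) (star (bern p)).
    rewrite /hecke_ip hecke_starM hecke_starK hh.
    by rewrite -mulrA tau_mulC.
  move=> e; have := h0 (star (bern p)); rewrite e ge0_complexE /=.
  by case/andP.
have hi : {ae nu, forall t, complex.Im (chi t h) = 0}.
  apply: (realZ_separates eval_bounded eval_lstar li) => [w t|u Zu]; first by rewrite chi_act.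
  have [mu [p [pI pu]]] := Zu.
  (* Both [p] and [lstar p] represent the real function [u]. The two resulting values of the
     integral are conjugate because [h] is Hermitian, so the imaginary part vanishes. *)
  have pu' : {ae nu, forall t, laurent_eval (lstar p) t = (u t)%:C}.
    by apply: filterS2 pu eval_lstar => t e /(_ p pI) ->; rewrite e conjc_real.
  have := key _ _ pu' Zu (lstar_inv pI); have := key _ _ pu Zu pI.
  rewrite -(star_bern hqq hq htheta) //.
  have -> : tau (star (bern p) * h) = conjc (tau (bern p * h)).
    by rewrite -tau_star hecke_starM hh tau_mulC.
  move=> -> [] /eqP; rewrite eqNr => /eqP.
  by [].
by apply: filterS2 hr hi => t h1 h2; rewrite ge0_complexE h1 h2 eqxx.
Qed.

(* A countable family of positive elements approximates every positive element
   in coefficients: choose one in each rational cell that contains any. *)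
Lemma ae_positive : {ae nu, forall t, positive_functional (chi t)}.
Proof.
have [e he] := affweyl_enum; pose T n := @hecke_T R D q H (e n).
pose cell (k : seq (nat * rat * rat) * nat) : set H := [set h | hecke_pos h /\
  exists2 c : nat -> R[i], h = \sum_(x <- k.1) c x.1.1 *: T x.1.1 &
    forall x, x \in k.1 -> `|complex.Re (c x.1.1) - ratr x.1.2| <= k.2.+1%:R^-1 /\
      `|complex.Im (c x.1.1) - ratr x.2| <= k.2.+1%:R^-1].
have : {ae nu, forall t, forall n, 0 <= chi t (xget 0 (cell (odflt ([::], 0%N) (choice.unpickle n))))}.
  (* A cell without positive elements yields the default 0, on which every functional vanishes. *)
  apply: ae_foralln => n; case: xgetP => [h _ [hP _]|_]; first exact: chi_pos.
  by apply: aeW => t; rewrite raddf0.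
apply: filterS => t ht h hP; apply: ge0_approx => r r0.
have [c [hc _]] := hecke_basis h; have [ix hix] := choice he.
pose l := [seq ix w | w <- finsupp c].
have hE : h = \sum_(i <- l) c (e i) *: T i.
  by rewrite {1}hc big_map; apply: eq_bigr => w _; rewrite /T hix.
pose S := \sum_(i <- l) m (chi t (T i)).
have S0 : 0 <= S by apply: sumr_ge0 => i _; exact: Re_norm_ge0.
(* Coefficients of two elements of one cell differ by at most [2 / (n + 1)] in the real and in the
   imaginary part, whence the factor 4. *)
have [n hn] := inv_small (mulr_ge0 (ler0n R 4) S0) r0.
have n0 : 0 < n.+1%:R^-1 :> R by rewrite invr_gt0 ltr0n.
have rat_near (a : R) : exists b : rat, `|a - ratr b| <= n.+1%:R^-1.
  have [|b] := @rat_in_itvoo R (a - n.+1%:R^-1) (a + n.+1%:R^-1).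
    by rewrite ltrD2l gtrN.
  rewrite in_itv /= => /andP [h1 h2]; exists b; apply: ltW.
  by rewrite ltr_distl; apply/andP; split; [rewrite ltrBlDr|rewrite -ltrBlDr].
have [a ha] := choice (fun i => rat_near (complex.Re (c (e i)))).
have [b hb] := choice (fun i => rat_near (complex.Im (c (e i)))).
pose k := ([seq (i, a i, b i) | i <- l], n).
have kh : cell k h.
  split=> //; exists (fun i => c (e i)); first by rewrite big_map hE.
  by move=> _ /mapP [i _ ->] /=; split; [exact: ha|exact: hb].
have := ht (choice.pickle k); rewrite choice.pickleK /=.
have [_ [c' gE hc']] : cell k (xget 0 (cell k)) by exact: xgetPex (ex_intro _ h kh).
rewrite {2}/k /= big_map /= in gE.
set g := xget 0 _ in gE * => g0; exists (chi t g) => //.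
have -> : chi t h - chi t g = \sum_(i <- l) (c (e i) - c' i) * chi t (T i).
  rewrite -raddfB hE gE -sumrB raddf_sum; apply: eq_bigr => i _ /=.
  by rewrite -scalerBl linearZ.
apply: le_trans _ (ltW hn).
have mS (s : seq nat) (G : nat -> R[i]) : m (\sum_(i <- s) G i) <= \sum_(i <- s) m (G i).
  elim: s => [|i s IH]; first by rewrite !big_nil normr0.
  by rewrite !big_cons (le_trans (Re_normD _ _)) // lerD2l.
apply: le_trans (mS _ _) _.
rewrite mulrAC mulr_sumr !big_seq; apply: ler_sum => i il.
rewrite normrM (ge0_ReC (normr_ge0 (c (e i) - c' i))) (ge0_ReC (normr_ge0 (chi t (T i)))).
rewrite ReCM /= mulr0 subr0 ler_wpM2r ?Re_norm_ge0 //.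
have [h1 h2] := hc' (i, a i, b i) (map_f _ il).
apply: le_trans (Re_norm_leD _) _; rewrite !(ReCD, ReCN, ImCD, ImCN).
have h3 := ha i; have h4 := hb i; move: h1 h2 h3 h4 => /=.
move: (complex.Re _) (complex.Im _) (complex.Re _) (complex.Im _) (ratr _) (ratr _) => x y x' y' z' z h1 h2 h3 h4.
have -> : x - x' = (x - z) - (x' - z) by ring.
have -> : y - y' = (y - z') - (y' - z') by ring.
have h5 := ler_normB (x - z) (x' - z); have h6 := ler_normB (y - z') (y' - z').
by move: h1 h2 h3 h4 h5 h6; set d := n.+1%:R^-1; lra.
Qed.

Lemma ae_state : {ae nu, forall t, [/\ positive_functional (chi t),
  central_functional (chi t) & chi t 1 = 1]}.
Proof. by apply: filterS3 ae_positive ae_central chi_1 => t. Qed.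

(** A point with a null neighbourhood has only points off the support of [nu] around it, where [chi]
    is 0 by convention. Conversely [chi t 1 = 1] almost everywhere, so an open set on which [chi]
    vanishes is null. *)
Lemma chi_support : closure [set t | exists h, chi t h != 0] = measure_support nu.
Proof.
have [_ _ _ _ chi0] := hchi; apply/seteqP; split=> t ht.
  apply: contrapT => tn; apply: tn => U oU Ut; rewrite lt0e measure_ge0 andbT.
  apply/negP => /eqP U0.
  have [s [[h /eqP hs] Us]] := ht U (open_nbhs_nbhs (conj oU Ut)).
  apply: hs; apply: chi0 => /(_ U oU Us).
  by rewrite U0 ltxx.
move=> U; rewrite nbhsE => -[V [oV Vt] VU].
have nV := ht V oV Vt; apply: contrapT => hn.
have [N [mN N0 hN]] := chi_1.
suff : (nu (V : set B) <= nu N)%E by rewrite N0 leNgt => /negP; apply.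
apply: le_measure; rewrite ?inE //.
  exact: sub_sigma_algebra.
move=> s Vs; apply: hN => /= s1; apply: hn; exists s; split; last exact: VU.
by exists 1; rewrite s1 oner_neq0.
Qed.

End LocalTraces.

Theorem corollary3p23 (R : realType) (D : root_datum)
  (qq : R) (f q : affweyl D -> R)
  (hqq : 1 < qq)
  (hf : forall s s' w : affweyl D, Saff s -> Saff s' ->
     s' = (w * s * w^-1)%g -> f s' = f s)
  (hq : is_weight qq f q)
  (H : hecke_algebra q)
  (theta : rd_X D -> H) (htheta : is_theta theta)
  (E : hilbert_completion H)
  (nu : probability (torus_borel R D) R)
  (hnu : is_spectral_measure E theta nu)
  (chi : torus R D -> {scalar H})
  (hchi : is_local_trace theta nu chi) :
  [/\ closure [set t | exists h : H, chi t h != 0] = measure_support nu,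
      {ae nu, forall t, [/\ positive_functional (chi t),
                            central_functional (chi t) & chi t 1 = 1]},
      forall (h : H) (p : laurent R D), laurent_inv p ->
        {ae nu, forall t,
          chi t (bernstein theta p * h) = laurent_eval p t * chi t h},
      {ae nu, forall t, exists2 phi, tracial_state phi &
          forall h : H, phi (lmul E h) = chi t h}
    & forall h : H, hecke_tau H h = cintegral nu (fun t => chi t h)].
Proof.
have st := ae_state hqq hq htheta hnu hchi.
split=> // [|h p pI||h].
- exact: (chi_support hqq hq htheta hnu hchi).
- exact: (chi_bern hqq hq htheta hnu hchi).
- have aeF : Filter (almost_everywhere nu) by exact: ae_filter_ringOfSetsType.
  apply: filterS st => t [pos cen one].
  exact: (tracial_extension hqq hq E pos cen one).
- exact: (tau_integral htheta hchi).
Qed.
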